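(* Let $p$ be an odd prime and $F$ a field containing a primitive $p$th root of unity. If $F$ is $p$-rigid, then $F$ is hereditarily $p$-rigid, i.e. every field $K$ with $F\subseteq K\subseteq F(p)$ is $p$-rigid.
   Context: For a field $L$, $\dot L=L\setminus\{0\}$ and $\dot L^p$ is the group of nonzero $p$th powers. An element $b\in\dot L\setminus\dot L^p$ is $p$-rigid if every element of $N_{L(\sqrt[p]{b})/L}(L(\sqrt[p]{b})^\times)$ lies in $\bigcup_{k=0}^{p-1}b^k\dot L^p$; $L$ is $p$-rigid if every element of $\dot L\setminus\dot L^p$ is $p$-rigid. $F(p)$ is the maximal $p$-extension of $F$: the compositum, in a separable closure, of all finite Galois extensions of $F$ of $p$-power degree. *)

(* Defs.v *)
(* All fields are subfields (as Prop-predicates) of an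
   ambient algebraically closed field Omega. *)
From HB Require Import structures.
From mathcomp Require Import all_boot all_order all_algebra all_field.
Set Implicit Arguments. Unset Strict Implicit. Unset Printing Implicit Defensive.
Import GRing.Theory.
Local Open Scope ring_scope.

Section Defs.
Variable Omega : fieldType.

Definition is_subfield (E : Omega -> Prop) : Prop :=
  [/\ E 0, E 1,
      (forall x y, E x -> E y -> E (x - y)),
      (forall x y, E x -> E y -> E (x * y)) &
      (forall x, E x -> E x^-1)].

Definition sub_fld (E L : Omega -> Prop) : Prop := forall x, E x -> L x.

Definition is_basis (K L : Omega -> Prop) (n : nat) (s : 'I_n -> Omega) : Prop :=
  [/\ (forall i, L (s i)),
      (forall c : 'I_n -> Omega, (forall i, K (c i)) ->
          \sum_(i < n) c i * s i = 0 -> forall i, c i = 0) &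
      (forall y, L y -> exists2 c : 'I_n -> Omega, (forall i, K (c i)) &
          y = \sum_(i < n) c i * s i)].

Definition degree_is (K L : Omega -> Prop) (n : nat) : Prop :=
  exists s : 'I_n -> Omega, @is_basis K L n s.

Definition is_autF (F E : Omega -> Prop) (sigma : Omega -> Omega) : Prop :=
  (forall x, E x -> E (sigma x)) /\
  (forall x y, E x -> E y -> sigma (x + y) = sigma x + sigma y) /\
  (forall x y, E x -> E y -> sigma (x * y) = sigma x * sigma y) /\
  sigma 1 = 1 /\
  (forall x y, E x -> E y -> sigma x = sigma y -> x = y) /\
  (forall y, E y -> exists2 x, E x & sigma x = y) /\
  (forall x, F x -> sigma x = x).

Definition card_Aut_is (F E : Omega -> Prop) (n : nat) : Prop :=
  exists sig : 'I_n -> (Omega -> Omega),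
    [/\ (forall i, is_autF F E (sig i)),
        (forall i j, i <> j -> exists2 x, E x & sig i x <> sig j x) &
        (forall tau, is_autF F E tau ->
           exists i, forall x, E x -> tau x = sig i x)].

Definition galois_p_ext (p : nat) (F E : Omega -> Prop) : Prop :=
  sub_fld F E /\
  exists n m, [/\ degree_is F E n, n = (p ^ m)%N & card_Aut_is F E n].

Definition max_p_ext (p : nat) (F : Omega -> Prop) : Omega -> Prop :=
  fun x => forall M, is_subfield M ->
    (forall E, is_subfield E -> galois_p_ext p F E -> sub_fld E M) -> M x.

Definition adjoin (K : Omega -> Prop) (beta : Omega) : Omega -> Prop :=
  fun x => forall M, is_subfield M -> sub_fld K M -> M beta -> M x.

Definition is_norm (K L : Omega -> Prop) (y c : Omega) : Prop :=
  exists n (s : 'I_n -> Omega) (M : 'M[Omega]_n),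
    [/\ @is_basis K L n s,
        (forall i j, K (M i j)),
        (forall i, y * s i = \sum_(j < n) M i j * s j) &
        c = \det M].

Definition is_ppow (p : nat) (K : Omega -> Prop) (b : Omega) : Prop :=
  exists x, [/\ K x, x != 0 & b = x ^+ p].

Definition p_rigid_elt (p : nat) (K : Omega -> Prop) (b : Omega) : Prop :=
  forall beta, beta ^+ p = b ->
  forall y c, adjoin K beta y -> y != 0 -> is_norm K (adjoin K beta) y c ->
  exists k, (k < p)%N /\ exists x, [/\ K x, x != 0 & c = b ^+ k * x ^+ p].

Definition p_rigid (p : nat) (K : Omega -> Prop) : Prop :=
  forall b, K b -> b != 0 -> ~ is_ppow p K b -> p_rigid_elt p K b.

End Defs.

(* Main.v *)
(* Put T = F^p (nonzero p-th powers).  The norm of 1 - x^(1/p) shows that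
   1 - x lies in x^k T for an exponent k = k(x) modulo p, whenever x is not in
   T.  Computing x - y both as -y (1 - x/y) and as (1 - y) - (1 - x) relates the
   exponents of x, y and x/y, and forces k(x) to be 0 or 1 (x small or large)
   outside a subgroup T <y0>.  The small elements then lie in the maximal ideal M
   of a valuation ring of F such that 1 + M is contained in T and the units lie
   in T <y0>; it extends to a valuation ring of Omega by Chevalley's theorem.

   Call K valued rigid if 1 + M_K consists of p-th powers of K and the units of
   K are cyclic modulo p-th powers.  This implies rigidity: in the norm of
   sum_i c_i b^(i/p) either one term dominates, or b may be taken to be a unit,
   and then all units are in <b> K^p.  It is inherited by L = K(a^(1/p)), because
   Hilbert 90 and rigidity of K give L^* = <a^(1/p)> K^* L^p.  Finally F(p) is a
   union of towers of such extensions, and a field between F and such a tower is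
   itself one; the proof of the latter uses that p is odd through
   N(zeta_{p^2}) = zeta_p. *)

Require Import Defs.
From HB Require Import structures.
From mathcomp Require Import all_boot all_order all_algebra all_field.
From mathcomp Require Import all_fingroup all_solvable.
From mathcomp Require Import boolp.
From mathcomp Require classical_sets.
From mathcomp Require Import ring zify.
Set Implicit Arguments. Unset Strict Implicit. Unset Printing Implicit Defensive.
Import GRing.Theory.
Local Open Scope ring_scope.

(** * The valuation ring of a rigid field *)

(** Rigidity sees the size of x only through 1 - x. It is silent when x is a p-th power, and on <y0>
    exponents other than 0 and 1 can occur, so smallness is read off only outside T <y0>. Whether an
    element h of T <y0> is integral is therefore decided by its action, namely whether h s is small
    for every small s. The valuation ring is extended to Omega at once so that one ring serves every
    layer of a tower. No value group is formed: two elements are compared by asking which of their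
    quotients lies in the ring. A field K between F and F(p) may be infinite over F and need not be
    a tower, but each norm in the definition of rigidity involves finitely many elements of K, and
    these lie in a subfield of K contained in a finite tower. *)

Definition valuation_ring (F : fieldType) (O : F -> Prop) : Prop :=
  [/\ O 1, forall x y, O x -> O y -> O (x - y),
      forall x y, O x -> O y -> O (x * y) & forall x, O x \/ O x^-1].

(** For a valuation ring O this is the maximal ideal: a nonzero x with x^-1 outside O lies in O by
    the dichotomy. Zero is listed apart because 0^-1 is 0, which O contains. *)
Definition nonunit (F : fieldType) (O : F -> Prop) (x : F) : Prop :=
  x = 0 \/ ~ O x^-1.

Section RigidField.
Variables (F : fieldType) (p : nat).
Hypotheses (p_pr : prime p) (p_odd : odd p).

Definition ppow (x : F) : Prop := exists2 t, t != 0 & x = t ^+ p.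

Lemma ppow_neq0 x : ppow x -> x != 0.
Proof. by case=> t t0 ->; rewrite expf_neq0. Qed.

Lemma ppow1 : ppow 1.
Proof. by exists 1; rewrite ?oner_neq0 ?expr1n. Qed.

Lemma ppowM x y : ppow x -> ppow y -> ppow (x * y).
Proof.
by case=> t t0 -> [s s0 ->]; exists (t * s); rewrite ?mulf_neq0 ?exprMn.
Qed.

Lemma ppowV x : ppow x -> ppow x^-1.
Proof. by case=> t t0 ->; exists t^-1; rewrite ?invr_neq0 ?exprVn. Qed.

Lemma ppowN1 : ppow (- 1).
Proof.
by exists (- 1); rewrite ?oppr_eq0 ?oner_neq0 // -signr_odd p_odd expr1.
Qed.

Lemma ppowN x : ppow x -> ppow (- x).
Proof. by rewrite -mulN1r; apply: ppowM ppowN1. Qed.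

Lemma ppowNE x : ppow (- x) -> ppow x.
Proof. by move/ppowN; rewrite opprK. Qed.

Lemma ppow_div x y : ppow x -> ppow y -> ppow (x / y).
Proof. by move=> ? ?; apply: ppowM => //; apply: ppowV. Qed.

Lemma ppow_mulr x y : ppow y -> ppow (x * y) -> ppow x.
Proof.
by move=> Ty /ppow_div/(_ Ty); rewrite mulfK // ppow_neq0.
Qed.

Lemma ppowXz x (n : int) : ppow x -> ppow (x ^ n).
Proof.
move=> Tx; have hX m : ppow (x ^+ m).
  by elim: m => [|m IH]; [exact: ppow1 | rewrite exprS; apply: ppowM].
by case: n => n; [exact: hX | apply: ppowV; exact: hX].
Qed.

Lemma Fp_int_eq0 (n : int) : (n%:~R == 0 :> 'F_p) = (p%:Z %| n)%Z.
Proof. by rewrite (dvdz_pcharf (pchar_Fp p_pr)). Qed.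

Lemma Fp_int_surj (k : 'F_p) : exists n : int, n%:~R = k.
Proof. by exists (k : nat)%:Z; rewrite -pmulrn natr_Zp. Qed.

Lemma ppow_exp_dvd x (n : int) : x != 0 -> n%:~R = 0 :> 'F_p -> ppow (x ^ n).
Proof.
move=> x0 /eqP; rewrite Fp_int_eq0 => /dvdzP[q ->].
by exists (x ^ q); rewrite ?expfz_neq0 // -exprz_exp.
Qed.

Lemma ppow_coprime_root x (n : int) :
  x != 0 -> n%:~R != 0 :> 'F_p -> ppow (x ^ n) -> ppow x.
Proof.
move=> x0 n0 Tn; have [m hm] := Fp_int_surj (n%:~R)^-1.
have e : (1 - n * m)%:~R = 0 :> 'F_p.
  by rewrite rmorphB rmorphM /= hm mulfV // subrr.
have := ppowM (ppow_exp_dvd x0 e) (ppowXz m Tn).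
by rewrite exprz_exp -expfzDr // subrK expr1z.
Qed.

(** * Nonzero elements modulo p-th powers as a vector space over F_p *)

Definition pcong (x y : F) : Prop := ppow (x / y).

Lemma pcong_ppow x y : pcong x y -> ppow y -> ppow x.
Proof.
move=> Txy Ty; have := ppowM Txy Ty; rewrite divfK //; exact: ppow_neq0.
Qed.

Lemma pcong_neq0 x y : pcong x y -> (x != 0) * (y != 0).
Proof. by move/ppow_neq0; rewrite mulf_eq0 invr_eq0 negb_or => /andP[-> ->]. Qed.

Definition indep (x y : F) : Prop :=
  [/\ x != 0, y != 0 & forall i j : int, ppow (x ^ i * y ^ j) ->
   i%:~R = 0 :> 'F_p /\ j%:~R = 0 :> 'F_p].

(** Coordinates of the class of z with respect to x and y; they are unique when x and y are
    independent. *)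
Definition cls (x y z : F) (i j : 'F_p) : Prop :=
  exists a b : int, [/\ a%:~R = i, b%:~R = j & pcong z (x ^ a * y ^ b)].

Section Classes.
Variables (x y : F).
Hypotheses (x0 : x != 0) (y0 : y != 0).

Lemma cls_neq0 z i j : cls x y z i j -> z != 0.
Proof. by case=> a [b [_ _ /pcong_neq0[]]]. Qed.

Lemma cls_ppow z : ppow z -> cls x y z 0 0.
Proof. by move=> Tz; exists 0, 0; rewrite /pcong !expr0z mul1r divr1. Qed.

Lemma cls1 : cls x y x 1 0.
Proof.
by exists 1, 0; rewrite /pcong expr1z expr0z mulr1 divff //; split=> //; apply: ppow1.
Qed.

Lemma cls2 : cls x y y 0 1.
Proof.
by exists 0, 1; rewrite /pcong expr1z expr0z mul1r divff //; split=> //; apply: ppow1.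
Qed.

Lemma clsM z z' i j i' j' :
  cls x y z i j -> cls x y z' i' j' -> cls x y (z * z') (i + i') (j + j').
Proof.
case=> a [b [ha hb T1]] [a' [b' [ha' hb' T2]]].
exists (a + a'), (b + b'); split; rewrite ?rmorphD /= ?ha ?hb ?ha' ?hb' //.
have := ppowM T1 T2; rewrite /pcong !expfzDr //.
by rewrite mulf_div (mulrACA (x ^ a)).
Qed.

Lemma clsV z i j : cls x y z i j -> cls x y z^-1 (- i) (- j).
Proof.
case=> a [b [ha hb T1]]; exists (- a), (- b); split; rewrite ?rmorphN /= ?ha ?hb //.
by have := ppowV T1; rewrite /pcong -!invr_expz !invfM !invrK.
Qed.

Lemma clsX z i j (n : int) : cls x y z i j -> cls x y (z ^ n) (n%:~R * i) (n%:~R * j).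
Proof.
case=> a [b [ha hb T1]]; exists (n * a), (n * b); split; rewrite ?rmorphM /= ?ha ?hb //.
have := ppowXz n T1; rewrite /pcong expfzMl exprz_inv -invr_expz expfzMl.
by rewrite !exprz_exp (mulrC a) (mulrC b).
Qed.

Lemma cls_pcong z z' i j : pcong z z' -> cls x y z' i j -> cls x y z i j.
Proof.
move=> e c; have := clsM (cls_ppow e) c; rewrite !add0r divfK //.
exact: cls_neq0 c.
Qed.

Lemma cls_uniq z i j i' j' : indep x y ->
  cls x y z i j -> cls x y z i' j' -> i = i' /\ j = j'.
Proof.
move=> [_ _ ind] c1 c2; have := clsM c1 (clsV c2).
have z0 := cls_neq0 c1.
rewrite divff // => -[a [b [ha hb]]]; rewrite /pcong mul1r => /ppowV; rewrite invrK.
move=> /ind; rewrite ha hb => -[/eqP + /eqP +]; rewrite !subr_eq0.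
by move=> /eqP -> /eqP ->.
Qed.

Lemma cls_nppow z i j : indep x y -> cls x y z i j -> (i, j) <> (0, 0) -> ~ ppow z.
Proof.
by move=> ind c nz /cls_ppow c'; have [e1 e2] := cls_uniq ind c c'; rewrite e1 e2 in nz.
Qed.

Lemma cls_det z z' i j i' j' : indep x y -> cls x y z i j -> cls x y z' i' j' ->
  i * j' - j * i' != 0 -> indep z z'.
Proof.
move=> ind c1 c2 d; split; [exact: cls_neq0 c1|exact: cls_neq0 c2|] => m n.
move=> /cls_ppow; move: (clsM (clsX m c1) (clsX n c2)) => c3 c4.
have [] := cls_uniq ind c3 c4; set a := m%:~R; set b := n%:~R => e1 e2.
(* Cramer's rule for the two coordinate equations. *)
have ea : a * (i * j' - j * i') = (a * i + b * i') * j' - (a * j + b * j') * i' by ring.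
have eb : b * (i * j' - j * i') = (a * j + b * j') * i - (a * i + b * i') * j by ring.
move/eqP: ea; rewrite e1 e2 !mul0r subr0 mulf_eq0 (negPf d) orbF => /eqP.
by move/eqP: eb; rewrite e1 e2 !mul0r subr0 mulf_eq0 (negPf d) orbF => /eqP.
Qed.

End Classes.

Lemma indep_sym x y : indep x y -> indep y x.
Proof.
by move=> [x0 y0 ind]; split=> // i j; rewrite mulrC => /ind[].
Qed.

Lemma indep_nppow x y : indep x y -> ~ ppow x.
Proof.
move=> ind; have [x0 y0 _] := ind; apply: (cls_nppow x0 y0 ind (cls1 y x0)).
by case=> /eqP; rewrite oner_eq0.
Qed.

Lemma nindep_line x y : x != 0 -> y != 0 -> ~ ppow x -> ~ indep x y ->
  exists i : int, pcong y (x ^ i).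
Proof.
move=> x0 y0 nx nind; apply: contrapT => h; apply: nind; split=> // i j Tij.
have [j0|j0] := eqVneq (j%:~R : 'F_p) 0.
  have Tj := ppow_exp_dvd y0 j0; split=> //.
  have [//|i0] := eqVneq (i%:~R : 'F_p) 0.
  by case: nx; apply: (ppow_coprime_root x0 i0); apply: ppow_mulr Tij.
case: h; have [m hm] := Fp_int_surj (j%:~R)^-1; exists (- (i * m)).
have T1 := ppowXz m Tij.
have e : (1 - j * m)%:~R = 0 :> 'F_p by rewrite rmorphB rmorphM /= hm mulfV // subrr.
have := ppowM (ppow_exp_dvd y0 e) T1.
rewrite expfzMl !exprz_exp mulrCA -expfzDr // subrK expr1z.
by rewrite /pcong -invr_expz invrK mulrC.
Qed.

(* The paper's rigidity, applied to the norm of 1 - beta with beta^p = x. *)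
Hypothesis rigid : forall x : F, x != 0 -> ~ ppow x -> exists n : int, pcong (1 - x) (x ^ n).

(** The exponent k(x), as a relation; [kap_uniq] makes it a function outside T. *)
Definition kap (x : F) (k : 'F_p) : Prop :=
  exists n : int, n%:~R = k /\ pcong (1 - x) (x ^ n).

Lemma kap_ex x : x != 0 -> ~ ppow x -> exists k, kap x k.
Proof. by move=> x0 /(rigid x0)[n Tn]; exists n%:~R, n. Qed.

Lemma kap0 x : x != 0 -> kap x 0 <-> ppow (1 - x).
Proof.
move=> x0; split=> [[n [hn /pcong_ppow]]|]; first by apply; apply: ppow_exp_dvd.
by exists 0; rewrite /pcong expr0z divr1.
Qed.

Lemma kap_uniq x k k' : x != 0 -> ~ ppow x -> kap x k -> kap x k' -> k = k'.
Proof.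
move=> x0 nx [n [<- e]] [n' [<- e']]; apply/eqP; rewrite -subr_eq0.
apply/negP=> /negP h; apply: nx; apply: (ppow_coprime_root (n := n - n') x0).
  by rewrite rmorphB.
have [d0 _] := pcong_neq0 e.
have -> : x ^ (n - n') = ((1 - x) / x ^ n') / ((1 - x) / x ^ n); last exact: ppow_div.
by rewrite expfzDr // -invr_expz; field; rewrite d0 !expfz_neq0.
Qed.

(** Since -1 is a p-th power, 1 - 1/x = -(1 - x)/x has exponent k - 1 with respect to x, hence 1 - k
    with respect to 1/x. *)
Lemma kapV x k : x != 0 -> kap x k -> kap x^-1 (1 - k).
Proof.
move=> x0 [n [<- e]]; exists (1 - n); rewrite rmorphB /=; split=> //.
have -> : 1 - x^-1 = - 1 * ((1 - x) / x) by field.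
have := ppowM ppowN1 e; rewrite /pcong expfzDr ?invr_eq0 // expr1z -invr_expz exprz_inv.
rewrite -invr_expz invrK; congr ppow; field; rewrite x0 /=.
by rewrite expfz_neq0.
Qed.

Lemma ppow_invN x : ~ ppow x -> ~ ppow x^-1.
Proof. by move=> nx /ppowV; rewrite invrK. Qed.

Lemma kap_cls x y z i j k : x != 0 -> y != 0 ->
  cls x y z i j -> kap z k -> cls x y (1 - z) (k * i) (k * j).
Proof. by move=> x0 y0 c [n [<- e]]; apply: cls_pcong e _ => //; apply: clsX. Qed.

(* The two factorisations of x - y = - y (1 - x/y) = (1 - y) - (1 - x),
   compared modulo p-th powers. *)
Lemma kap_div x y k l m : indep x y -> kap x k -> kap y l -> kap (x / y) m ->
  (k, l) <> (0, 0) -> exists n, m = k - n * k /\ 1 - m = n * l.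
Proof.
move=> ind kx ky km kl; have [x0 y0 _] := ind.
have cx := cls1 y x0; have cy := cls2 x y0.
have c1x := kap_cls x0 y0 cx kx; have c1y := kap_cls x0 y0 cy ky.
have cxy := clsM x0 y0 cx (clsV cy).
have c1xy := kap_cls x0 y0 cxy km.
have cq := clsM x0 y0 c1y (clsV c1x).
have q0 := cls_neq0 cq.
(* This quotient has coordinates (-k, l), not both zero, so it has an exponent n of its own. *)
have nq : ~ ppow ((1 - y) / (1 - x)).
  apply: (cls_nppow x0 y0 ind cq); rewrite !(mulr0, mulr1, oppr0, add0r, addr0).
  by move/(congr1 (fun q => (- q.1, q.2))); rewrite /= opprK oppr0 => /kl.
have [n kq] := kap_ex q0 nq.
have c1q := kap_cls x0 y0 cq kq.
have cL := clsM x0 y0 (clsM x0 y0 (cls_ppow x y ppowN1) cy) c1xy.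
have cR := clsM x0 y0 (clsM x0 y0 (cls_ppow x y ppowN1) c1x) c1q.
have x1 := cls_neq0 c1x.
have e : -1 * y * (1 - x / y) = - 1 * (1 - x) * (1 - (1 - y) / (1 - x)).
  by field; rewrite x1 y0.
rewrite e in cL; have [e1 e2] := cls_uniq x0 y0 ind cL cR.
exists n; move: e1 e2.
rewrite !(mulr0, mulr1, oppr0, add0r, addr0, mulrN1, mulrN) => -> <-.
by split=> //; ring.
Qed.

Lemma indep_mull x y : indep x y -> indep (x * y) y.
Proof.
move=> ind; have [x0 y0 _] := ind.
have cx := cls1 y x0; have cy := cls2 x y0.
by apply: (cls_det x0 y0 ind (clsM x0 y0 cx cy) cy); rewrite !addr0 !mulr0 subr0 mulr1 oner_neq0.
Qed.

Lemma indepVr x y : indep x y -> indep x y^-1.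
Proof.
move=> ind; have [x0 y0 _] := ind.
have cx := cls1 y x0; have cy := cls2 x y0.
apply: (cls_det x0 y0 ind cx (clsV cy)).
by rewrite !mul0r subr0 mul1r oppr_eq0 oner_neq0.
Qed.

Lemma indepVl x y : indep x y -> indep x^-1 y.
Proof. by move/indep_sym/indepVr/indep_sym. Qed.

(** Compare x with 1/y, whose exponent 1 - l is nonzero: with k(x) = 0, the first relation of
    [kap_div] makes the exponent of the quotient vanish. *)
Lemma kap_indep_mul x y l : indep x y -> kap x 0 -> kap y l -> l != 1 -> kap (x * y) 0.
Proof.
move=> ind kx ky l1; have [x0 y0 _] := ind.
have nxy : ~ ppow (x / y^-1).
  by rewrite invrK; apply: indep_nppow (indep_mull ind).
have xy0 : x / y^-1 != 0 by rewrite invrK mulf_neq0.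
have [m km] := kap_ex xy0 nxy.
have [|n [e _]] := kap_div (indepVr ind) kx (kapV y0 ky) km.
  by move/(congr1 snd)/eqP; rewrite /= subr_eq0 eq_sym (negPf l1).
by rewrite invrK e mulr0 subr0 in km.
Qed.

(** Exponent 0 will mean small and exponent 1 large; an element with any other exponent behaves like
    a unit, by [exc_rel_unit]. *)
Definition exc (k : 'F_p) := (k != 0) && (k != 1).

(** If k = l, adding the two relations of [kap_div] gives 1 = k. *)
Lemma kap_exc_neq x y k l : indep x y -> kap x k -> kap y l -> exc k -> k != l.
Proof.
move=> ind kx ky /andP[k0 k1]; apply/eqP=> e; move: ky; rewrite -{}e => ky.
have [x0 y0 _] := ind.
have nxy : ~ ppow (x / y) by apply: indep_nppow (indep_mull (indepVr ind)).
have [m km] := kap_ex (mulf_neq0 x0 (invr_neq0 y0)) nxy.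
have [|n [e1 e2]] := kap_div ind kx ky km; first by move/(congr1 fst)/eqP; rewrite /= (negPf k0).
by case/eqP: k1; rewrite -(subrK (n * k) k) -e1 -e2 addrC subrK.
Qed.

(** For x and 1/y, of exponents k and 1 - l, the relations of [kap_div] are two equations for m and
    n. They can be solved because 1 - k - l is nonzero, by [kap_exc_neq] for the same pair. *)
Lemma kap_exc_mul x y k l : indep x y -> kap x k -> kap y l -> exc k -> exc l ->
  exists m, [/\ kap (x * y) m, exc m & 1 - m^-1 = (1 - k^-1) * (1 - l^-1)].
Proof.
move=> ind kx ky ek el; have [x0 y0 _] := ind.
have kV := kapV y0 ky; have indV := indepVr ind.
have kl1 := kap_exc_neq indV kx kV ek.
move: (ek) (el) => /andP[k0 k1] /andP[l0 l1].
have nxy : ~ ppow (x / y^-1).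
  by rewrite invrK; apply: indep_nppow (indep_mull ind).
have xy0 : x / y^-1 != 0 by rewrite invrK mulf_neq0.
have [m km] := kap_ex xy0 nxy.
have [|n [e1 e2]] := kap_div indV kx kV km; first by move/(congr1 fst)/eqP; rewrite /= (negPf k0).
rewrite invrK in km.
have d0 : 1 - k - l != 0.
  apply: contra kl1 => /eqP h; rewrite -subr_eq0 -oppr_eq0; apply/eqP.
  by rewrite -[RHS]h; ring.
have en : n = (1 - k) / (1 - k - l).
  apply: (mulIf d0); rewrite divfK //.
  have -> : n * (1 - k - l) = n * (1 - l) - n * k by ring.
  by rewrite -e2 e1; ring.
have em : m = - (k * l) / (1 - k - l) by rewrite e1 en; field.
have m0 : m != 0.
  by rewrite em mulf_eq0 oppr_eq0 mulf_eq0 invr_eq0 (negPf k0) (negPf l0) (negPf d0).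
exists m; split=> //; last by rewrite em; field; rewrite oppr_eq0 mulf_eq0 (negPf k0) (negPf l0) d0.
rewrite /exc m0 /=; apply/eqP=> m1; move: em; rewrite m1 => /(congr1 ( *%R^~ (1 - k - l))).
rewrite mul1r divfK // => /eqP; rewrite -subr_eq0.
have -> : 1 - k - l - - (k * l) = (1 - k) * (1 - l) by ring.
by rewrite mulf_eq0 !subr_eq0 ![1 == _]eq_sym (negPf k1) (negPf l1).
Qed.

(* 1 - 1/k is multiplicative on independent exceptional elements, so that
   x and x y^(p-1), which are independent, would share the same value. *)
Lemma exc_indep x y k l : indep x y -> kap x k -> kap y l -> exc k -> exc l -> False.
Proof.
move=> ind kx ky ek el; have [x0 y0 _] := ind.
have key j : exists m, [/\ kap (x * y ^+ j) m, exc m, indep (x * y ^+ j) y &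
     1 - m^-1 = (1 - k^-1) * (1 - l^-1) ^+ j].
  elim: j => [|j [m [km em indm tm]]]; first by exists k; rewrite expr0 !mulr1.
  have [m' [km' em' tm']] := kap_exc_mul indm km ky em el.
  exists m'; rewrite exprSr mulrA; split=> //; first exact: indep_mull.
  by rewrite tm' tm exprSr mulrA.
have [m [km em indm tm]] := key p.-1.
move: (ek) (el) => /andP[k0 k1] /andP[l0 l1].
have e1 : (1 - l^-1) ^+ p.-1 = 1.
  have h0 : 1 - l^-1 != 0 by rewrite subr_eq0 eq_sym invr_eq1.
  apply: (mulfI h0); rewrite mulr1 -exprS prednK ?prime_gt0 //.
  by rewrite -[RHS](expf_card (1 - l^-1)) card_Fp.
move: tm; rewrite e1 mulr1 => /addrI/oppr_inj/invr_inj em'; rewrite em' in km em.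
suff ind' : indep x (x * y ^+ p.-1) by move/eqP: (kap_exc_neq ind' kx km ek).
have cx := cls1 y x0; have cy := cls2 x y0; rewrite exprnP.
apply: (cls_det x0 y0 ind cx (clsM x0 y0 cx (clsX p.-1%:Z cy))).
rewrite !(mulr0, addr0, mulr1, add0r, mul1r, subr0) Fp_int_eq0.
apply/negP=> h; have p1 := prime_gt1 p_pr; have p0 := ltnW p1.
have : (p <= p.-1)%N by apply: dvdn_leq => //; rewrite -ltnS prednK.
by rewrite -ltnS prednK // ltnn.
Qed.

(* y behaves like a unit as seen from outside the line it spans. *)
Definition rel_unit (y : F) : Prop :=
  [/\ y != 0, ~ ppow y & forall z, indep y z -> kap z 0 ->
     kap (z * y) 0 /\ kap (z / y) 0].

Lemma rel_unitV y : rel_unit y -> rel_unit y^-1.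
Proof.
case=> y0 ny h; split; rewrite ?invr_neq0 //; first exact: ppow_invN.
move=> z /indepVl; rewrite invrK => ind kz; by have [h1 h2] := h z ind kz.
Qed.

Lemma exc_rel_unit y k : y != 0 -> ~ ppow y -> kap y k -> exc k -> rel_unit y.
Proof.
move=> y0 ny ky /andP[k0 k1]; split=> // z /indep_sym ind kz; split.
  exact: kap_indep_mul ind kz ky k1.
apply: (kap_indep_mul (indepVr ind) kz (kapV y0 ky)).
by rewrite -subr_eq0 addrAC subrr sub0r oppr_eq0.
Qed.

(** Let k(z) = 0. If z/x had a nonzero exponent, then k(x/z) would not be 1, while k(zy) = 0; so xy
    = (zy)(x/z) would have exponent 0 by [kap_indep_mul]. *)
Lemma line_rel_unit x y : x != 0 -> y != 0 -> ~ ppow x -> ~ ppow y -> ~ indep x y ->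
  kap x 0 -> kap y 0 -> ~ ppow (x * y) -> ~ kap (x * y) 0 -> rel_unit x.
Proof.
move=> x0 y0 nx ny nind kx ky nxy kxy; split=> // z ind kz.
have nz1 : (0 : 'F_p) != 1 by rewrite eq_sym oner_neq0.
split; first exact: (kap_indep_mul (indep_sym ind) kz kx nz1).
have [_ z0 _] := ind; have nz := indep_nppow (indep_sym ind).
have nzx : ~ ppow (z / x) by apply: indep_nppow (indep_mull (indepVr (indep_sym ind))).
have zx0 : z / x != 0 by rewrite mulf_neq0 ?invr_eq0.
have [m km] := kap_ex zx0 nzx.
have [m0|m0] := eqVneq m 0; first by rewrite m0 in km.
case: kxy; have kxz := kapV zx0 km.
rewrite invf_div in kxz.
have [i ei] := nindep_line x0 y0 nx nind.
have cx := cls1 z x0; have cz := cls2 x z0.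
have cy : cls x z y i%:~R 0.
  by apply: (cls_pcong x0 z0 ei); have := clsX i cx; rewrite mulr0 mulr1.
(* Modulo T, y is x^i, where i is neither 0 nor -1 because neither y nor xy lies in T; this makes z,
   y and zy, x/z independent pairs. *)
have i0 : i%:~R != 0 :> 'F_p.
  by apply/eqP=> hi; apply: ny; apply: pcong_ppow ei _; apply: ppow_exp_dvd.
have i1 : i%:~R + 1 != 0 :> 'F_p.
  apply/eqP=> hi; apply: nxy.
  have h : (i + 1)%:~R = 0 :> 'F_p by rewrite rmorphD.
  have := ppowM ei (ppow_exp_dvd x0 h); rewrite expfzDr // expr1z.
  by rewrite mulrA divfK ?expfz_neq0 // mulrC.
have indzy : indep z y.
  by apply: (cls_det x0 z0 ind cz cy); rewrite mul0r mul1r sub0r oppr_eq0.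
have kzy := kap_indep_mul indzy kz ky nz1.
have czy := clsM x0 z0 cz cy; have cxz := clsM x0 z0 cx (clsV cz).
have ind' : indep (z * y) (x / z).
  apply: (cls_det x0 z0 ind czy cxz).
  rewrite !(add0r, addr0, oppr0, mulr1, mulrN1, mul1r).
  by rewrite -opprD oppr_eq0.
have l1 : 1 - m != 1 by rewrite -subr_eq0 addrAC subrr sub0r oppr_eq0.
have := kap_indep_mul ind' kzy kxz l1.
by have -> : z * y * (x / z) = x * y by field.
Qed.

(** Let u and v be independent relative units. If k(v) = 0, then uv and v/u have exponent 0, and
    dividing both by v gives k(u) = 0 and k(1/u) = 0, against k(1/u) = 1 - k(u). Used for v and 1/v
    this makes k(v) exceptional, and k(u) by symmetry, which [exc_indep] excludes. *)
Lemma rel_unit_dep y y' : rel_unit y -> rel_unit y' -> ~ indep y y'.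
Proof.
have small u v : rel_unit u -> rel_unit v -> indep u v -> ~ kap v 0.
  move=> [u0 nu hu] [v0 nv hv] ind kv; have [k1 k2] := hu v ind kv.
  have indv := indep_mull ind; have indw := indep_mull (indepVl ind).
  rewrite mulrC in k1; rewrite mulrC in k2.
  have [_] := hv _ (indep_sym indv) k1; rewrite mulfK // => ku.
  have [_] := hv _ (indep_sym indw) k2; rewrite mulfK // => /kapV.
  rewrite invrK subr0 invr_eq0 => /(_ u0) ku'.
  by have /eqP := kap_uniq u0 nu ku ku'; rewrite eq_sym oner_eq0.
have excl u v : rel_unit u -> rel_unit v -> indep u v -> exists2 k, kap v k & exc k.
  move=> ru rv ind; have [v0 nv _] := rv; have [k kv] := kap_ex v0 nv.
  exists k => //; rewrite /exc; apply/andP; split; apply/eqP=> ek; rewrite ek in kv.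
    exact: small ru rv ind kv.
  apply: (small _ _ ru (rel_unitV rv) (indepVr ind)).
  by have := kapV v0 kv; rewrite subrr.
move=> ru rv ind; have [k kv ek] := excl _ _ ru rv ind.
have [l ku el] := excl _ _ rv ru (indep_sym ind).
exact: exc_indep ind ku kv el ek.
Qed.

Lemma unit_line : exists2 y0 : F, y0 != 0 & forall y, rel_unit y -> exists i : int, pcong y (y0 ^ i).
Proof.
have [[y0 r0]|h] := pselect (exists y, rel_unit y); last first.
  by exists 1; rewrite ?oner_neq0 // => y ry; case: h; exists y.
have [y00 ny0 _] := r0; exists y0 => // y ry; have [yn0 _ _] := ry.
by apply: nindep_line => //; apply: rel_unit_dep.
Qed.

(** * Small elements, and the ring of integral elements *)

Section UnitLine.
Variable y0 : F.
Hypotheses (y0_neq0 : y0 != 0)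
  (y0_line : forall y, rel_unit y -> exists i : int, pcong y (y0 ^ i)).

Definition on_line (x : F) : Prop := exists i : int, pcong x (y0 ^ i).

Lemma ppow_line x : ppow x -> on_line x.
Proof. by exists 0; rewrite /pcong expr0z divr1. Qed.

Lemma line_neq0 x : on_line x -> x != 0.
Proof. by case=> i /pcong_neq0[]. Qed.

Lemma lineM x y : on_line x -> on_line y -> on_line (x * y).
Proof.
move=> [i ei] [j ej]; exists (i + j); rewrite /pcong expfzDr // -mulf_div.
exact: ppowM.
Qed.

Lemma lineV x : on_line x -> on_line x^-1.
Proof.
by case=> i /ppowV ei; exists (- i); rewrite /pcong -invr_expz -invfM.
Qed.

Lemma line_div x y : on_line x -> on_line y -> on_line (x / y).
Proof. by move=> ? /lineV; apply: lineM. Qed.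

Lemma line_mulr x y : on_line y -> on_line (x * y) -> on_line x.
Proof. by move=> hy /line_div/(_ hy); rewrite mulfK // line_neq0. Qed.

Lemma line_mull x y : on_line x -> on_line (x * y) -> on_line y.
Proof. by rewrite mulrC; apply: line_mulr. Qed.

(** As p is odd, x^(p+1) = x^p x is a power of x^2, and x^p is on the line. *)
Lemma line_sqr x : x != 0 -> on_line (x * x) -> on_line x.
Proof.
move=> x0 h; have hX n : on_line ((x * x) ^+ n).
  elim: n => [|n IH]; first exact/ppow_line/ppow1.
  by rewrite exprS; apply: lineM.
have := hX p.+1./2; rewrite -expr2 -exprM mul2n.
have -> : p.+1./2.*2 = p.+1 by rewrite -[RHS]odd_double_half /= p_odd.
by rewrite exprSr; apply: line_mull; apply: ppow_line; exists x.
Qed.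

Definition small (x : F) : Prop := [/\ x != 0, ~ on_line x & ppow (1 - x)].

Definition line_integral (h : F) : Prop :=
  on_line h /\ forall s, small s -> small (h * s).

Definition integral (x : F) : Prop := [\/ x = 0, small x | line_integral x].

Lemma small_nppow x : small x -> ~ ppow x.
Proof. by case=> _ nx _ /ppow_line. Qed.

Lemma small_kap x : small x -> kap x 0.
Proof. by case=> x0 _ /kap0 h; apply/h. Qed.

(** An exceptional exponent would make x a relative unit and put it on the line, so k(x) is 0 or
    1. *)
Lemma small_dich x : x != 0 -> ~ on_line x -> small x \/ small x^-1.
Proof.
move=> x0 nx; have nTx : ~ ppow x by move/ppow_line.
have [k kx] := kap_ex x0 nTx.
have [k0|k0] := eqVneq k 0; first by left; split=> //; apply/kap0; rewrite -?k0.
have [k1|k1] := eqVneq k 1.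
  right; split; rewrite ?invr_eq0 //; first by move/lineV; rewrite invrK.
  by apply/kap0; rewrite ?invr_eq0 // -(subrr 1) -{2}k1; apply: kapV.
by case: nx; apply: y0_line; apply: exc_rel_unit x0 nTx kx _; rewrite /exc k0 k1.
Qed.

Lemma small_asym x : small x -> ~ small x^-1.
Proof.
move=> sx sxV; have [x0 _ _] := sx.
have k1 := small_kap sxV; have := kapV x0 (small_kap sx); rewrite subr0 => k2.
have xV0 : x^-1 != 0 by rewrite invr_eq0.
by have /eqP := kap_uniq xV0 (small_nppow sxV) k1 k2; rewrite eq_sym oner_eq0.
Qed.

(** For dependent x and y a failure would make x a relative unit, by [line_rel_unit]. *)
Lemma small_prod x y : small x -> small y -> ~ on_line (x * y) -> small (x * y).
Proof.
move=> sx sy nxy; have [x0 nx _] := sx; have [yn0 ny _] := sy.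
have xy0 : x * y != 0 by rewrite mulf_neq0.
split=> //; apply/(kap0 xy0).
have kx := small_kap sx; have ky := small_kap sy.
have [ind|nind] := pselect (indep x y).
  by apply: kap_indep_mul ind kx ky _; rewrite eq_sym oner_neq0.
apply: contrapT => nk; apply: nx; apply: y0_line.
apply: (line_rel_unit x0 yn0 (small_nppow sx) (small_nppow sy) nind kx ky _ nk).
by move/ppow_line.
Qed.

(** If ys or xs is off the line, two uses of [small_prod] suffice. Otherwise x^2 = (xy)(xs)/(ys) is
    on the line, hence so is x. *)
Lemma small_prod3 x y s : small x -> small y -> small s -> on_line (x * y) ->
  small (x * y * s).
Proof.
move=> sx sy ss hxy; have [x0 nx _] := sx; have [_ ns _] := ss.
have nxys : ~ on_line (x * y * s) by move/(line_mull hxy).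
have [hys|nys] := pselect (on_line (y * s)); last first.
  by rewrite -mulrA in nxys *; apply: small_prod => //; apply: small_prod.
have [hxs|nxs] := pselect (on_line (x * s)); last first.
  rewrite mulrAC in nxys *; apply: small_prod => //; exact: small_prod.
case: nx; apply: line_sqr => //; have := line_div (lineM hxy hxs) hys.
have [yn0 _ _] := sy; have [s0 _ _] := ss.
by have -> : x * y * (x * s) / (y * s) = x * x by field; rewrite s0 yn0.
Qed.

Lemma small_mul_integral x y : small x -> small y -> small (x * y) \/ line_integral (x * y).
Proof.
move=> sx sy; have [h|n] := pselect (on_line (x * y)); last by left; apply: small_prod.
by right; split=> // s ss; apply: small_prod3.
Qed.

(** If h fails at s and 1/h fails at s', then 1/(hs) and h/s' are small, so that both ss' and its
    inverse are products of two small elements. [small_mul_integral] leaves no room for that. *)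
Lemma line_integral_dich h : on_line h -> line_integral h \/ line_integral h^-1.
Proof.
move=> hh; have h0 := line_neq0 hh.
have [//|nh] := pselect (line_integral h); first by left.
right; split=> [|s' ss']; first exact: lineV.
have [s [ss nhs]] : exists s, small s /\ ~ small (h * s).
  apply: contrapT => N; apply: nh; split=> // s ss; apply: contrapT => nhs.
  by apply: N; exists s.
have [s0 ns _] := ss; have [s'0 ns' _] := ss'.
have [//|sV] : small (h^-1 * s') \/ small (h^-1 * s')^-1.
  apply: small_dich; first by rewrite mulf_neq0 ?invr_eq0.
  by move/(line_mull (lineV hh)).
have [//|sV2] : small (h * s) \/ small (h * s)^-1.
  apply: small_dich; first by rewrite mulf_neq0.
  by move/(line_mull hh).
have e : (h * s)^-1 * (h^-1 * s')^-1 = (s * s')^-1 by field; rewrite h0 s0 s'0.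
have := small_mul_integral sV2 sV; rewrite e.
have [sss|oss] := small_mul_integral ss ss'.
  case=> [/(small_asym sss)//|[/lineV]]; rewrite invrK => hss.
  by case: sss => _ /(_ hss).
case=> [[_ nss _]|[_ /(_ s ss)]]; first by case: nss; apply: lineV; case: oss.
by rewrite invfM mulrAC mulVf // mul1r => /(small_asym ss').
Qed.

(** -1 is its own inverse, so both alternatives of the dichotomy agree. *)
Lemma line_integralN1 : line_integral (- 1).
Proof.
by have [] := line_integral_dich (ppow_line ppowN1); rewrite ?invrN1.
Qed.

Lemma smallN x : small x -> small (- x).
Proof. by move=> sx; rewrite -mulN1r; apply: line_integralN1.2. Qed.

Lemma small_subr1_ppow x : small x -> ppow (1 + x).
Proof. by move/smallN => [_ _]; rewrite opprK. Qed.

(* If (1 - x) y were not small then 1 - (1 - x) y = (1 - y) + x y would lie in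
   the class of y, whereas it lies on the line of x y; if x and y are dependent
   this makes y a relative unit. *)
Lemma small_subr1 x : small x -> line_integral (1 - x).
Proof.
move=> sx; have [x0 nx Tx] := sx; split=> [|y sy]; first exact: ppow_line.
have [yn0 ny Ty] := sy; have u0 := ppow_neq0 Tx.
have uy0 : (1 - x) * y != 0 by rewrite mulf_neq0.
have key z : indep x z -> ppow (1 - z) -> kap z 0 -> kap ((1 - x) * z) 0.
  move=> ind Tz kz; have [_ z0 _] := ind.
  have cx := cls1 z x0; have cz := cls2 x z0.
  have cu := cls_ppow x z Tx; have cuz := clsM x0 z0 cu cz; rewrite !add0r in cuz.
  have uz0 := cls_neq0 cuz.
  have nuz : ~ ppow ((1 - x) * z).
    by apply: (cls_nppow x0 z0 ind cuz); move/(congr1 snd)/eqP; rewrite oner_eq0.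
  have [k kuz] := kap_ex uz0 nuz.
  have c1 := kap_cls x0 z0 cuz kuz.
  have cw := clsM x0 z0 (cls_ppow x z (ppowN (ppowV Tz))) (clsM x0 z0 cx cz).
  rewrite !(add0r, addr0) in cw.
  have nw : ~ ppow (- (1 - z)^-1 * (x * z)).
    by apply: (cls_nppow x0 z0 ind cw); move/(congr1 snd)/eqP; rewrite oner_eq0.
  have [l kl] := kap_ex (cls_neq0 cw) nw.
  have c2 := clsM x0 z0 (cls_ppow x z Tz) (kap_cls x0 z0 cw kl).
  have z1 := ppow_neq0 Tz.
  have e : (1 - z) * (1 - - (1 - z)^-1 * (x * z)) = 1 - (1 - x) * z by field.
  rewrite e in c2; have [e1 e2] := cls_uniq x0 z0 ind c1 c2.
  by move: e1 e2 kuz; rewrite !(add0r, mulr0, mulr1) => <- ->.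
have nuy : ~ on_line ((1 - x) * y) by move/(line_mull (ppow_line Tx)).
split=> //; apply/(kap0 uy0); have kx := small_kap sx; have ky := small_kap sy.
have [ind|nind] := pselect (indep x y); first exact: key.
apply: contrapT => nk; apply: ny; apply: y0_line.
have nTx := small_nppow sx; have nTy := small_nppow sy.
have [i ei] := nindep_line x0 yn0 nTx nind.
(* If z/y had a nonzero exponent, then (1 - x) y = ((1 - x) z)(y/z) would have exponent 0 by [key]
   and [kap_indep_mul]. *)
split=> // z indyz kz; have [_ z0 _] := indyz.
have Tz : ppow (1 - z) by apply/(kap0 z0).
have nz1 : (0 : 'F_p) != 1 by rewrite eq_sym oner_neq0.
split; first exact: (kap_indep_mul (indep_sym indyz) kz ky nz1).
have indxz : indep x z.
  apply: contrapT => /(nindep_line x0 z0 nTx) [j ej].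
  have i0 : i%:~R != 0 :> 'F_p.
    by apply/eqP=> hi; apply: nTy; apply: pcong_ppow ei _; apply: ppow_exp_dvd.
  have [_ _ /(_ (- j) i)] := indyz; case; last by move/eqP: i0.
  have := ppowM (ppowXz (- j) ei) (ppowXz i ej).
  have -> // : (y / x ^ i) ^ (- j) * (z / x ^ j) ^ i = y ^ (- j) * z ^ i.
  rewrite !expfzMl mulrACA -[RHS]mulr1; congr (_ * _).
  rewrite !exprz_inv opprK !exprz_exp -expfzDr //.
  by have -> : i * j + j * - i = 0 by ring.
have nzy : ~ ppow (z / y) by apply: indep_nppow (indep_mull (indepVr (indep_sym indyz))).
have zy0 : z / y != 0 by rewrite mulf_neq0 ?invr_eq0.
have [m km] := kap_ex zy0 nzy.
have [m0|m0] := eqVneq m 0; first by rewrite m0 in km.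
case: nk; have kyz := kapV zy0 km; rewrite invf_div in kyz.
have kuz := key z indxz Tz kz.
have cy := cls1 z yn0; have cz := cls2 y z0.
have cuz := clsM yn0 z0 (cls_ppow y z Tx) cz.
have ind' : indep ((1 - x) * z) (y / z).
  apply: (cls_det yn0 z0 indyz cuz (clsM yn0 z0 cy (clsV cz))).
  by rewrite !(add0r, addr0, oppr0, mulr1, mul0r, mul1r, sub0r) oppr_eq0 oner_neq0.
have l1 : 1 - m != 1 by rewrite -subr_eq0 addrAC subrr sub0r oppr_eq0.
have := kap_indep_mul ind' kuz kyz l1.
by have -> : (1 - x) * z * (y / z) = (1 - x) * y by field.
Qed.

Lemma small_subr1V x : small x -> line_integral (1 - x)^-1.
Proof.
move=> sx; have [x0 nx Tx] := sx; have u0 := ppow_neq0 Tx.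
have e : (1 - x)^-1 = 1 - - (x / (1 - x)) by field.
rewrite e; apply: small_subr1; split.
- by rewrite oppr_eq0 mulf_neq0 ?invr_eq0.
- rewrite -mulNr => /(line_mulr (lineV (ppow_line Tx))).
  by move/(lineM (ppow_line ppowN1)); rewrite mulrN mulN1r opprK.
- by rewrite -e; apply: ppowV.
Qed.

Lemma integralM x y : integral x -> integral y -> integral (x * y).
Proof.
case=> [->|sx|ox]; first by rewrite mul0r => _; apply: Or31.
  case=> [->|sy|oy]; first by rewrite mulr0; apply: Or31.
    by case: (small_mul_integral sx sy) => h; [apply: Or32 | apply: Or33].
  by rewrite mulrC; apply: Or32; apply: oy.2.
case=> [->|sy|oy]; first by rewrite mulr0; apply: Or31.
  by apply: Or32; apply: ox.2.
apply: Or33; split=> [|s ss]; first by apply: lineM; [case: ox | case: oy].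
by rewrite -mulrA; apply: ox.2; apply: oy.2.
Qed.

Lemma integral_dich x : integral x \/ integral x^-1.
Proof.
have [->|x0] := eqVneq x 0; first by left; apply: Or31.
have [hx|nx] := pselect (on_line x).
  by case: (line_integral_dich hx) => h; [left | right]; apply: Or33.
by case: (small_dich x0 nx) => h; [left | right]; apply: Or32.
Qed.

Lemma integral_subr1 x : integral x -> integral (1 - x).
Proof.
case=> [->|sx|ox]; last first.
- have [->|v0] := eqVneq (1 - x) 0; first exact: Or31.
  have [hx hS] := ox; have x0 := line_neq0 hx.
  have [hv|nv] := pselect (on_line (1 - x)); last first.
    case: (small_dich v0 nv) => [sv|[_ _ Tv]]; first exact: Or32.
    (* If 1/(1 - x) were small, then -x/(1 - x) would lie in T, which puts 1 - x on the line
       together with x. *)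
    case: nv; have e : 1 - (1 - x)^-1 = - x / (1 - x) by field.
    rewrite e mulNr in Tv; have h := line_div hx (ppow_line (ppowNE Tv)).
    by have -> : 1 - x = x / (x / (1 - x)) by field; rewrite x0 v0.
  apply: Or33; split=> // s ss.
  have [s0 ns Ts] := ss.
  have vs0 : (1 - x) * s != 0 by rewrite mulf_neq0.
  have nvs : ~ on_line ((1 - x) * s) by move/(line_mull hv).
  have t0 := ppow_neq0 Ts.
  have sxs := smallN ((small_subr1V ss).2 _ (hS s ss)).
  split=> //; have [_ _ T1] := sxs.
  (* The correction (1 - s)^-1 x s is small, because x and (1 - s)^-1 are line-integral. *)
  have -> : 1 - (1 - x) * s = (1 - s) * (1 - - ((1 - s)^-1 * (x * s))) by field.
  exact: ppowM.
- by apply: Or33; apply: small_subr1.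
rewrite subr0; apply: Or33; split=> [|s ss]; first exact/ppow_line/ppow1.
by rewrite mul1r.
Qed.

Lemma integral1 : integral 1.
Proof. by have := integral_subr1 (Or31 _ _ (erefl (0 : F))); rewrite subr0. Qed.

Lemma integral_valuation : valuation_ring integral.
Proof.
have iN x : integral x -> integral (- x).
  by rewrite -mulN1r; apply: integralM; apply: Or33; apply: line_integralN1.
split; [exact: integral1| |exact: integralM|exact: integral_dich].
move=> x y ix iy.
have [->|x0] := eqVneq x 0; first by rewrite sub0r; apply: iN.
have [->|yn0] := eqVneq y 0; first by rewrite subr0.
have [h|h] := integral_dich (y / x).
  have -> : x - y = x * (1 - y / x) by field.
  by apply: integralM => //; apply: integral_subr1.
rewrite invf_div in h; have -> : x - y = - (y * (1 - x / y)) by field.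
by apply: iN; apply: integralM => //; apply: integral_subr1.
Qed.

(** A nonunit x on the line is a product st of small elements: s is taken so that s/x is not small,
    and then t = x/s is. Now 1 - st = (1 - s)(1 + (1 - t)s/(1 - s)), whose last summand is small. *)
Lemma integral_nonunit x : nonunit integral x -> ppow (1 - x).
Proof.
case=> [->|nx]; first by rewrite subr0; apply: ppow1.
have [ix|//] := integral_dich x.
case: ix nx => [->|[_ _ //]|ox nx]; first by rewrite subr0 => _; apply: ppow1.
have [hx hS] := ox; have x0 := line_neq0 hx.
have [s [ss nsx]] : exists s, small s /\ ~ small (x^-1 * s).
  apply: contrapT => N; apply: nx; apply: Or33; split; first exact: lineV.
  by move=> s ss; apply: contrapT => nhs; apply: N; exists s.
have [s0 ns Ts] := ss.
have [//|st] : small (x^-1 * s) \/ small (x^-1 * s)^-1.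
  apply: small_dich; first by rewrite mulf_neq0 ?invr_eq0.
  by move/(line_mull (lineV hx)).
set t := (x^-1 * s)^-1 in st; have [t0 _ Tt] := st.
have ex : x = s * t by rewrite /t; field; rewrite x0 s0.
have s1 := ppow_neq0 Ts.
have sm : small ((1 - t) * ((1 - s)^-1 * s)).
  by apply: (small_subr1 st).2; apply: (small_subr1V ss).2.
have := ppowM Ts (small_subr1_ppow sm).
by have -> // : (1 - s) * (1 + (1 - t) * ((1 - s)^-1 * s)) = 1 - x by rewrite ex; field.
Qed.

Lemma integral_unit x : x != 0 -> integral x -> integral x^-1 -> on_line x.
Proof.
move=> x0 [/eqP|sx|[]//]; first by rewrite (negPf x0).
case=> [/eqP|sx'|[/lineV]]; first by rewrite invr_eq0 (negPf x0).
  by case: (small_asym sx sx').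
by rewrite invrK.
Qed.

End UnitLine.

Theorem rigid_valuation : exists (O : F -> Prop) (y0 : F),
  [/\ valuation_ring O, forall x, nonunit O x -> ppow (1 - x), y0 != 0 &
      forall x, x != 0 -> O x -> O x^-1 -> exists i : int, pcong x (y0 ^ i)].
Proof.
have [y0 y00 hy0] := unit_line; exists (integral y0), y0; split=> //.
- exact: integral_valuation.
- exact: integral_nonunit.
- exact: integral_unit.
Qed.

End RigidField.

(** * Extension of valuation rings *)

Section PolyIn.
Variable Omega : fieldType.

Definition subring_pred (A : Omega -> Prop) : Prop :=
  [/\ A 1, forall x y, A x -> A y -> A (x - y) &
      forall x y, A x -> A y -> A (x * y)].

Definition poly_in (A : Omega -> Prop) (q : {poly Omega}) : Prop := forall i, A q`_i.

Variable A : Omega -> Prop.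
Hypothesis A_ring : subring_pred A.

Lemma subring0 : A 0.
Proof. by case: A_ring => A1 AB _; rewrite -(subrr 1); apply: AB. Qed.

Lemma subringN x : A x -> A (- x).
Proof. by case: A_ring => _ AB _ Ax; rewrite -sub0r; apply: AB => //; apply: subring0. Qed.

Lemma subringD x y : A x -> A y -> A (x + y).
Proof. by case: A_ring => _ AB _ Ax Ay; rewrite -[y]opprK; apply: AB => //; apply: subringN. Qed.

Lemma subring_sum (I : Type) (r : seq I) (P : pred I) (f : I -> Omega) :
  (forall i, P i -> A (f i)) -> A (\sum_(i <- r | P i) f i).
Proof. by move=> h; apply: big_ind => //; [exact: subring0 | exact: subringD]. Qed.

Lemma subring_prod (I : Type) (r : seq I) (P : pred I) (f : I -> Omega) :
  (forall i, P i -> A (f i)) -> A (\prod_(i <- r | P i) f i).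
Proof. by case: A_ring => A1 _ AM h; apply: big_ind. Qed.

Lemma subringX x n : A x -> A (x ^+ n).
Proof.
case: A_ring => A1 _ AM Ax; elim: n => [//|n IH].
by rewrite exprS; apply: AM.
Qed.

Lemma poly_inB q r : poly_in A q -> poly_in A r -> poly_in A (q - r).
Proof. by case: A_ring => _ AB _ hq hr i; rewrite coefB; apply: AB. Qed.

Lemma poly_inD q r : poly_in A q -> poly_in A r -> poly_in A (q + r).
Proof. by move=> hq hr i; rewrite coefD; apply: subringD. Qed.

Lemma poly_inM q r : poly_in A q -> poly_in A r -> poly_in A (q * r).
Proof. by case: A_ring => _ _ AM hq hr i; rewrite coefM; apply: subring_sum => j _; apply: AM. Qed.

Lemma poly_inC c : A c -> poly_in A c%:P.
Proof. by move=> Ac i; rewrite coefC; case: ifP => // _; apply: subring0. Qed.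

Lemma poly_inZ c q : A c -> poly_in A q -> poly_in A (c *: q).
Proof. by move=> Ac Aq; rewrite -mul_polyC; apply: poly_inM => //; apply: poly_inC. Qed.

Lemma poly_inXn n : poly_in A 'X^n.
Proof.
by move=> i; rewrite coefXn; case: eqP => _; [case: A_ring | apply: subring0].
Qed.

Lemma poly_in_poly n (f : nat -> Omega) :
  (forall i, (i < n)%N -> A (f i)) -> poly_in A (\poly_(i < n) f i).
Proof. by move=> h i; rewrite coef_poly; case: ifP => // hi; [apply: h | apply: subring0]. Qed.

Lemma poly_in_prod (I : Type) (r : seq I) (f : I -> {poly Omega}) :
  (forall i, poly_in A (f i)) -> poly_in A (\prod_(i <- r) f i).
Proof.
move=> h; apply: big_ind => //; last exact: poly_inM.
by rewrite -[1]/(1%:P); apply: poly_inC; case: A_ring.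
Qed.

Lemma poly_in_horner q x : poly_in A q -> A x -> A q.[x].
Proof.
move=> hq hx; rewrite horner_coef; apply: subring_sum => i _.
by case: A_ring => _ _ AM; apply: AM => //; apply: subringX.
Qed.

End PolyIn.

(** * Maximal subrings over a valuation ring *)

Section Chevalley.
Variables (Omega : fieldType) (F O : Omega -> Prop).
Hypotheses (F_fld : is_subfield F) 
  (O_ring : subring_pred O) (O_val : forall x, F x -> O x \/ O x^-1).

(** This condition on A and F takes the place of the usual pairs of a ring and a prime ideal; it is
    what keeps 1 out of the ideal [J] below. *)
Let lies_over (A : Omega -> Prop) : Prop :=
  [/\ subring_pred A, forall x, O x -> A x & forall x, F x -> A x -> O x].

Lemma F_div x y : F x -> F y -> F (x / y).
Proof. by case: F_fld => _ _ _ FM FV Fx Fy; apply/FM/FV. Qed.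

Section Maximal.
Variable A : Omega -> Prop.
Hypotheses (A_over : lies_over A)
  (A_max : forall B, lies_over B -> (forall x, A x -> B x) -> forall x, B x -> A x).

Let A_ring : subring_pred A. Proof. by case: A_over. Qed.
Let AM x y : A x -> A y -> A (x * y). Proof. by case: A_ring => _ _; apply. Qed.
Let A1 : A 1. Proof. by case: A_ring. Qed.
Let OA x : O x -> A x. Proof. by case: A_over => _ + _; apply. Qed.

(* The ideal generated in A by the nonunits of O; a single generator suffices
   because nonunits are comparable for divisibility. *)
Let J (c : Omega) : Prop := exists m a, [/\ F m, nonunit O m, A a & c = m * a].

Lemma J_comb c d : J c -> J d -> exists m a b,
  [/\ F m, nonunit O m, A a, A b & c = m * a /\ d = m * b].
Proof.
move=> [m [a [Fm Om Aa ->]]] [n [b [Fn On Ab ->]]].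
have [->|m0] := eqVneq m 0.
  by exists n, 0, b; rewrite mulr0 mul0r; split=> //; apply: subring0.
have [->|n0] := eqVneq n 0.
  by exists m, a, 0; rewrite mulr0 mul0r; split=> //; apply: subring0.
case: (O_val (F_div Fm Fn)) => h.
  exists n, (m / n * a), b; split=> //; first by apply: AM => //; apply: OA.
  by split=> //; field.
rewrite invf_div in h; exists m, a, (n / m * b); split=> //; first by apply: AM => //; apply: OA.
by split=> //; field.
Qed.

Lemma JD c d : J c -> J d -> J (c + d).
Proof.
move=> Jc Jd; have [m [a [b [Fm Om Aa Ab [-> ->]]]]] := J_comb Jc Jd.
by exists m, (a + b); split=> //; [apply: subringD | rewrite mulrDr].
Qed.

Lemma JM c a : J c -> A a -> J (c * a).
Proof.
by move=> [m [b [Fm Om Ab ->]]] Aa; exists m, (b * a); split=> //; [apply: AM | rewrite mulrA].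
Qed.

Lemma JA c : J c -> A c.
Proof.
move=> [m [b [Fm Om Ab ->]]]; apply: AM => //; apply: OA.
case: Om => [->|nm]; first exact: subring0.
by case: (O_val Fm).
Qed.

(** From 1 = m b one gets that m^-1 = b lies in A and in F, hence in O, against m being a
    nonunit. *)
Lemma J1 : ~ J 1.
Proof.
move=> [m [b [Fm Om Ab e]]].
have m0 : m != 0 by apply/eqP=> m0; move/eqP: e; rewrite m0 mul0r oner_eq0.
case: Om => [/eqP|]; first by rewrite (negPf m0).
have -> : m^-1 = b by apply: (mulfI m0); rewrite -e divff.
apply; case: A_over => _ _; apply => //.
have -> : b = m^-1 by apply: (mulfI m0); rewrite -e divff.
by case: F_fld => _ _ _ _; apply.
Qed.

Lemma J_sub1_neq0 c : J c -> 1 - c != 0.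
Proof. by move=> Jc; rewrite subr_eq0; apply/eqP=> e; apply: J1; rewrite e. Qed.

(** The fractions with numerator in A and denominator 1 - d, d in J, form a ring that still lies
    over O, so maximality puts it inside A. *)
Lemma J_sub1_unit c : J c -> A (1 - c)^-1.
Proof.
move=> Jc; pose B x := exists a d, [/\ A a, J d & x = a / (1 - d)].
have J0 : J 0.
  by exists 0, 0; rewrite mulr0; split=> //; [case: F_fld | left | apply: subring0].
have JN d : J d -> J (- d).
  by move=> Jd; rewrite -mulrN1; apply: JM => //; apply: subringN.
apply: (A_max (B := B)); last by exists 1, c; rewrite mul1r.
  split; first split.
  - by exists 1, 0; rewrite subr0 divr1.
  - move=> _ _ [a [d [Aa Jd ->]]] [b [e [Ab Je ->]]].
    exists (a * (1 - e) - b * (1 - d)), (d + e - d * e).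
    have ? := J_sub1_neq0 Jd; have ? := J_sub1_neq0 Je.
    have AB x y : A x -> A y -> A (x - y) by case: A_ring => _ + _; apply.
    split.
    + by apply: (AB); apply: AM => //; apply: AB => //; apply: JA.
    + apply: JD; [exact: JD | apply: JN; apply: JM => //; exact: JA].
    + field; apply/and3P; split=> //.
      have -> : 1 - (d + e - d * e) = (1 - d) * (1 - e) by ring.
      by rewrite mulf_neq0.
  - move=> _ _ [a [d [Aa Jd ->]]] [b [e [Ab Je ->]]].
    exists (a * b), (d + e - d * e).
    have ? := J_sub1_neq0 Jd; have ? := J_sub1_neq0 Je.
    split; first exact: AM.
    + apply: JD; [exact: JD | apply: JN; apply: JM => //; exact: JA].
    + field; apply/and3P; split=> //.
      have -> : 1 - (d + e - d * e) = (1 - d) * (1 - e) by ring.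
      by rewrite mulf_neq0.
  - by move=> x /OA Ax; exists x, 0; rewrite subr0 divr1.
  - move=> x Fx [a [d [Aa Jd e]]]; apply: contrapT => nOx; apply: J1.
    have x0 : x != 0 by apply/eqP=> x0; apply: nOx; rewrite x0; apply: subring0.
    have d0 := J_sub1_neq0 Jd.
    have -> : 1 = x^-1 * a + d by rewrite -[a](divfK d0) -e mulrA mulVf // mul1r subrK.
    apply: JD => //; exists x^-1, a; split=> //; last by right; rewrite invrK.
    by case: F_fld => _ _ _ _; apply.
by move=> x Ax; exists x, 0; rewrite subr0 divr1.
Qed.

(** By maximality A[x] does not lie over O, so it contains some y in F outside O; m is the inverse
    of y. *)
Lemma max_not_in x : ~ A x ->
  exists m g, [/\ F m, nonunit O m, poly_in A g & m * g.[x] = 1].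
Proof.
move=> nAx; apply: contrapT => N; apply: nAx.
pose B y := exists2 g, poly_in A g & y = g.[x].
apply: (A_max (B := B)); last by exists 'X; rewrite ?hornerX //; apply: (poly_inXn A_ring 1).
  split; first split.
  - by exists 1; rewrite ?hornerE //; apply: (poly_inC A_ring A1).
  - by move=> _ _ [g Ag ->] [h Ah ->]; exists (g - h); rewrite ?hornerE //; apply: poly_inB.
  - by move=> _ _ [g Ag ->] [h Ah ->]; exists (g * h); rewrite ?hornerE //; apply: poly_inM.
  - by move=> y /OA Ay; exists y%:P; rewrite ?hornerC //; apply: poly_inC.
  - move=> y Fy [g Ag e]; apply: contrapT => nOy; apply: N.
    have y0 : y != 0 by apply/eqP=> y0; apply: nOy; rewrite y0; apply: subring0.
    exists y^-1, g; rewrite -e mulVf //; split=> //; last by right; rewrite invrK.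
    by case: F_fld => _ _ _ _; apply.
by move=> y Ay; exists y%:P; rewrite ?hornerC //; apply: poly_inC.
Qed.

(* Eliminating the leading term of g with the help of h lowers n + n'. *)
Lemma no_two_relations N : forall x m n n' g h, (n + n' < N)%N -> x != 0 ->
  F m -> nonunit O m -> poly_in A g -> poly_in A h ->
  (size g <= n.+1)%N -> (size h <= n'.+1)%N ->
  m * g.[x] = 1 -> m * h.[x^-1] = 1 -> False.
Proof.
elim: N => [//|N IH] x m n n' g h lt x0 Fm Om Ag Ah sg sh eg eh.
(* Exchanging x with 1/x exchanges g with h. *)
wlog le : x x0 n n' g h lt Ag Ah sg sh eg eh / (n' <= n)%N.
  move=> W; case: (leqP n' n) => [|/ltnW] le; first exact: (W x x0 n n' g h).
  by apply: (W x^-1 _ n' n h g); rewrite ?invrK ?invr_eq0 // addnC.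
case: n => [|n] in lt sg le *.
  apply: J1; exists m, h`_0; split=> //; rewrite -[LHS]eh.
  move: le sh; rewrite leqn0 => /eqP -> /size1_polyC ->.
  by rewrite hornerC coefC.
have Jh : J (m * h`_0) by exists m, h`_0.
(* Multiplied by x^(n+1), the relation m h(1/x) = 1 can be solved for x^(n+1), as 1 - m h_0 is
   invertible in A; the right-hand side then has degree at most n in x. *)
have d0 := J_sub1_neq0 Jh; have Ae := J_sub1_unit Jh.
set e := (1 - m * h`_0)^-1 in Ae.
pose r := \poly_(i < n.+1) h`_(n.+1 - i).
have Am : A m by rewrite -[m]mulr1; apply: JA; exists m, 1.
have ex : x ^+ n.+1 = e * m * r.[x].
  have hx : x ^+ n.+1 * h.[x^-1] = h`_0 * x ^+ n.+1 + r.[x].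
    rewrite (@horner_coef_wide _ n.+2) ?(leq_trans sh) // mulr_sumr.
    rewrite (reindex_inj rev_ord_inj) big_ord_recr /= addrC subnn; congr (_ + _).
      by rewrite expr0 mulr1 mulrC.
    rewrite horner_poly; apply: eq_bigr => i _; rewrite subSS.
    have hi : (i <= n.+1)%N by rewrite ltnW.
    by rewrite mulrCA exprVn; congr (_ * _); rewrite -{1}(subnK hi) exprD mulrAC divff ?mul1r // expf_neq0.
  have := congr1 ( *%R (x ^+ n.+1)) eh; rewrite mulr1 mulrCA hx mulrDr => h1.
  have h2 : (1 - m * h`_0) * x ^+ n.+1 = m * r.[x] by rewrite mulrBl mul1r -{1}h1; ring.
  by rewrite -mulrA -h2 mulKf.
pose g' := \poly_(i < n.+1) g`_i + (g`_n.+1 * e * m) *: r.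
apply: (IH x m n n' g' h) => //.
- apply: poly_inD => //; first by apply: poly_in_poly.
  apply: poly_inZ => //; last by apply: poly_in_poly.
  by apply: (AM) => //; apply: AM.
- rewrite (leq_trans (size_polyD _ _)) // geq_max size_poly.
  by rewrite (leq_trans (size_scale_leq _ _)) // size_poly.
rewrite -[RHS]eg; congr (_ * _).
rewrite /g' hornerD hornerZ -!mulrA [e * _]mulrA -ex horner_poly.
by rewrite [RHS](@horner_coef_wide _ n.+2 g) // [RHS]big_ord_recr.
Qed.

Lemma max_valuation : valuation_ring A.
Proof.
case: A_ring => _ AB _; split=> // x.
apply: contrapT => /not_orP[nx nxV].
have x0 : x != 0 by apply/eqP=> x0; apply: nx; rewrite x0; apply: subring0.
have [m [g [Fm Om Ag eg]]] := max_not_in nx.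
have [n [h [Fn On Ah eh]]] := max_not_in nxV.
have Jm : J m by exists m, 1; rewrite mulr1.
have Jn : J n by exists n, 1; rewrite mulr1.
(* The two relations come with different nonunits; a common divisor k of them is moved in front of
   both. *)
have [k [a [b [Fk Ok Aa Ab [em en]]]]] := J_comb Jm Jn.
apply: (no_two_relations (N := (size g + size h).+1) (x := x) (m := k)
   (n := size g) (n' := size h) (g := a *: g) (h := b *: h)) => //.
- exact: poly_inZ.
- exact: poly_inZ.
- by rewrite (leq_trans (size_scale_leq _ _)).
- by rewrite (leq_trans (size_scale_leq _ _)).
- by rewrite hornerZ mulrA -em.
- by rewrite hornerZ mulrA -en.
Qed.

End Maximal.

Theorem valuation_extension : exists O' : Omega -> Prop,
  valuation_ring O' /\ forall x, F x -> (O' x <-> O x).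
Proof.
(* Adjoining O to the set A makes the empty chain, whose union is empty, admissible. *)
have [|A [Aover Amax]] := @classical_sets.Zorn_bigcup Omega
   (fun A => lies_over (fun x => A x \/ O x)).
  move=> C hC tot; set U := fun x => _.
  have two x y : U x -> U y -> exists D,
      [/\ lies_over D, D x, D y & forall z, D z -> U z].
    have one X : C X -> exists D, [/\ lies_over D, forall z, X z -> D z,
        forall z, O z -> D z & forall z, D z -> U z].
      move=> CX; exists (fun z => X z \/ O z); split; [exact: hC|by left|by right|].
      by move=> z [Xz|]; [left; exists X | right].
    case=> [[X CX Xx]|Ox] [[Y CY Yy]|Oy].
    - have [XY|YX] := tot _ _ CX CY.
        by have [D [h1 h2 h3 h4]] := one Y CY; exists D; split; auto.
      by have [D [h1 h2 h3 h4]] := one X CX; exists D; split; auto.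
    - by have [D [h1 h2 h3 h4]] := one X CX; exists D; split; auto.
    - by have [D [h1 h2 h3 h4]] := one Y CY; exists D; split; auto.
    - by exists O; split=> //; by right.
  split; first split.
  - by right; case: O_ring.
  - move=> x y Ux Uy; have [D [[[_ DB _] _ _] Dx Dy DU]] := two x y Ux Uy.
    by apply: DU; apply: DB.
  - move=> x y Ux Uy; have [D [[[_ _ DM] _ _] Dx Dy DU]] := two x y Ux Uy.
    by apply: DU; apply: DM.
  - by right.
  - by move=> x Fx Ux; have [D [[_ _ DO] Dx _ _]] := two x x Ux Ux; apply: DO.
exists (fun x => A x \/ O x); split.
  apply: max_valuation => // B Bover AB x Bx; apply: contrapT => nx.
  have [_ OB _] := Bover.
  apply: (Amax B).
    split; last by move=> h; apply: nx; left; apply: h.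
    by move=> y Ay; apply: AB; left.
  have -> // : (fun y => B y \/ O y) = B.
  by apply/funext => y; apply/propext; split; [case=> // /OB | left].
by case: Aover => _ OA AO x Fx; split; [apply: AO | right].
Qed.

End Chevalley.

(** * Polynomials with unit roots over valued fields *)

Section ValuationRing.
Variables (R : fieldType) (O : R -> Prop).
Hypothesis O_val : valuation_ring O.
Local Notation M := (nonunit O).

Lemma valuation_subring : subring_pred O.
Proof. by case: O_val. Qed.

Lemma valM x y : O x -> O y -> O (x * y).
Proof. by case: O_val => _ _ + _; apply. Qed.

Lemma vring1 : O 1.
Proof. by case: O_val. Qed.

Lemma vring0 : O 0.
Proof. exact: (subring0 valuation_subring). Qed.

Lemma nonunit_val x : M x -> O x.
Proof.
case=> [->|nx]; first exact: vring0.
by case: O_val => _ _ _ /(_ x)[].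
Qed.

Lemma nonunit0 : M 0. Proof. by left. Qed.

Lemma nonunit1 : ~ M 1.
Proof. by case=> [/eqP|]; rewrite ?oner_eq0 // invr1; apply; apply: vring1. Qed.

Lemma val_unit x : O x -> ~ M x -> x != 0 /\ O x^-1.
Proof.
move=> Ox nM; split; first by apply/eqP=> x0; apply: nM; left.
by apply: contrapT => nx; apply: nM; right.
Qed.

Lemma nonunitM x y : O x -> M y -> M (x * y).
Proof.
move=> Ox My; have [->|x0] := eqVneq x 0; first by rewrite mul0r; left.
case: My => [->|nV]; first by rewrite mulr0; left.
right=> h; apply: nV; have := valM Ox h.
by rewrite invfM mulVKf.
Qed.

Lemma nonunitMr x y : M x -> O y -> M (x * y).
Proof. by rewrite mulrC => Mx Oy; apply: nonunitM. Qed.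

Lemma nonunitN x : M x -> M (- x).
Proof.
by rewrite -mulN1r; apply: nonunitM; apply: (subringN valuation_subring); apply: vring1.
Qed.

Lemma nonunitD x y : M x -> M y -> M (x + y).
Proof.
wlog h : x y / O (y / x) => [W|] Mx My.
  case: (O_val) => _ _ _ /(_ (y / x))[|] h; first exact: W.
  by rewrite addrC; apply: W => //; rewrite -invf_div.
have [->|x0] := eqVneq x 0; first by rewrite add0r.
have -> : x + y = (1 + y / x) * x by field.
by apply: nonunitM => //; apply: (subringD valuation_subring) => //; apply: vring1.
Qed.

Lemma nonunitB x y : M x -> M y -> M (x - y).
Proof. by move=> Mx /nonunitN; apply: nonunitD. Qed.

Lemma nonunit_sum (I : Type) (r : seq I) (P : pred I) (f : I -> R) :
  (forall i, P i -> M (f i)) -> M (\sum_(i <- r | P i) f i).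
Proof. by move=> h; apply: (big_ind M) => //; [exact: nonunit0 | exact: nonunitD]. Qed.

Lemma valX x n : O x -> O (x ^+ n).
Proof. exact: (subringX valuation_subring). Qed.

Lemma val_root x n : (0 < n)%N -> O (x ^+ n) -> O x.
Proof.
case: n => // n _ h; case: (O_val) => _ _ _ /(_ x)[//|hV].
have [->|x0] := eqVneq x 0; first exact: vring0.
by have := valM h (valX n hV); rewrite exprVn exprSr mulrAC divff ?mul1r // expf_neq0.
Qed.

Lemma nonunit_1D_unit x : M x -> [/\ 1 + x != 0, O (1 + x) & O (1 + x)^-1].
Proof.
move=> Mx; have Ox := nonunit_val Mx.
have O1x : O (1 + x) by apply: (subringD valuation_subring) => //; apply: vring1.
have nM : ~ M (1 + x) by move/nonunitB/(_ Mx); rewrite addrK; apply: nonunit1.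
by have [h1 h2] := val_unit O1x nM.
Qed.

(** If x is not in O, then x^-1 is a nonunit, and dividing q(x) = 0 by the top power of x writes 1
    as a sum of nonunits. *)
Lemma val_integral (q : {poly R}) x : q \is monic -> poly_in O q -> root q x -> O x.
Proof.
move=> qm Oq /rootP qx; apply: contrapT => nO.
have x0 : x != 0 by apply/eqP=> x0; apply: nO; rewrite x0; apply: vring0.
have MV : M x^-1 by right; rewrite invrK.
apply: nonunit1; have sq : size q = (size q).-1.+1 by rewrite prednK // size_poly_gt0 monic_neq0.
move: qx; rewrite horner_coef sq big_ord_recr /= -lead_coefE (monicP qm) mul1r.
set n := (size q).-1 => /(congr1 ( *%R (x^-1 ^+ n))).
rewrite mulr0 mulrDr -exprMn mulVf // expr1n mulr_sumr => /eqP.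
rewrite addrC addr_eq0 => /eqP ->; apply/nonunitN/nonunit_sum => i _.
have -> : x^-1 ^+ n * (q`_i * x ^+ i) = q`_i * x^-1 ^+ (n - i).
  rewrite mulrCA; congr (_ * _); rewrite -{1}(subnK (ltnW (ltn_ord i))) exprD.
  by rewrite -mulrA -exprMn mulVf // expr1n mulr1.
apply: nonunitM => //; have : (0 < n - i)%N by rewrite subn_gt0.
by case: (n - i)%N => // k _; rewrite exprS; apply: nonunitMr => //; apply: valX; apply: nonunit_val.
Qed.

End ValuationRing.

Lemma monic_division (R : fieldType) (A : R -> Prop) (q f : {poly R}) :
  subring_pred A -> q \is monic -> poly_in A q -> poly_in A f ->
  exists s r, [/\ poly_in A s, poly_in A r, f = q * s + r & (size r < size q)%N].
Proof.
move=> A_ring qm Aq; have q0 : (0 < size q)%N by rewrite size_poly_gt0 monic_neq0.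
have [N] := ubnP (size f); elim: N f => // N IH f /ltnSE hN Af.
case: (ltnP (size f) (size q)) => [lt|le].
  exists 0, f; rewrite mulr0 add0r; split=> //.
  by move=> i; rewrite coef0; apply: (subring0 A_ring).
pose d := (size q).-1; have sq : size q = d.+1 by rewrite prednK.
case: N => [|N] in IH hN *; first by move: (leq_trans le hN); rewrite sq.
have dN : (d <= N)%N by rewrite -ltnS -sq (leq_trans le).
pose t := f`_N *: 'X^(N - d).
have At : poly_in A t by apply: poly_inZ => //; apply: poly_inXn.
have [||s [r [As Ar e lt]]] := IH (f - q * t).
- rewrite ltnS; apply/leq_sizeP => j Nj; rewrite coefB /t -scalerAr coefZ coefMXn.
  rewrite ltnNge (leq_trans (leq_subr d N) Nj) /=.
  move: Nj; rewrite leq_eqVlt => /orP[/eqP <-|Nj].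
    by rewrite subKn // -[d]/(size q).-1 -lead_coefE (monicP qm) mulr1 subrr.
  rewrite (leq_sizeP _ _ hN) // [q`_ _](leq_sizeP _ _ (leqnn (size q))) ?mulr0 ?subr0 //.
  by rewrite sq; lia.
- by apply: poly_inB => //; apply: poly_inM.
exists (s + t), r; split=> //; first exact: poly_inD.
by rewrite mulrDr addrAC -e addrNK.
Qed.

Section Subfield.
Variables (Omega : fieldType) (K : Omega -> Prop).
Hypothesis K_fld : is_subfield K.

Lemma subfield_subring : subring_pred K.
Proof. by case: K_fld. Qed.

Lemma fldM x y : K x -> K y -> K (x * y).
Proof. by case: K_fld => _ _ _ + _; apply. Qed.

Lemma fldB x y : K x -> K y -> K (x - y).
Proof. by case: K_fld => _ _ + _ _; apply. Qed.

Lemma fldD x y : K x -> K y -> K (x + y).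
Proof. exact: (subringD subfield_subring). Qed.

Lemma fldV x : K x -> K x^-1.
Proof. by case: K_fld => _ _ _ _; apply. Qed.

Lemma fld_div x y : K x -> K y -> K (x / y).
Proof. by move=> Kx Ky; apply/fldM/fldV. Qed.

Lemma fld0 : K 0. Proof. by case: K_fld. Qed.

Lemma fld1 : K 1. Proof. by case: K_fld. Qed.

Lemma fldX x n : K x -> K (x ^+ n).
Proof. exact: (subringX subfield_subring). Qed.

Variable p : nat.

Lemma is_ppowM x y : is_ppow p K x -> is_ppow p K y -> is_ppow p K (x * y).
Proof.
move=> [a [Ka a0 ->]] [b [Kb b0 ->]]; exists (a * b).
by rewrite mulf_neq0 ?exprMn //; split=> //; apply: fldM.
Qed.

Lemma is_ppowV x : is_ppow p K x -> is_ppow p K x^-1.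
Proof.
move=> [a [Ka a0 ->]]; exists a^-1.
by rewrite invr_eq0 exprVn; split=> //; apply: fldV.
Qed.

Lemma is_ppow_exp x : K x -> x != 0 -> is_ppow p K (x ^+ p).
Proof. by move=> Kx x0; exists x. Qed.

Lemma is_ppowX x n : is_ppow p K x -> is_ppow p K (x ^+ n).
Proof.
move=> [a [Ka a0 ->]]; exists (a ^+ n); rewrite expf_neq0 //.
by split=> //; [apply: fldX | rewrite exprAC].
Qed.

Lemma is_ppow_coprime x d : prime p -> K x -> x != 0 -> ~~ (p %| d)%N ->
  is_ppow p K (x ^+ d) -> is_ppow p K x.
Proof.
move=> p_pr Kx x0 nd h; have d0 : (0 < d)%N by case: d nd {h}; rewrite ?dvdn0.
have cop : coprime d p by rewrite coprime_sym prime_coprime.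
have [a b e _] := egcdnP p d0; rewrite (eqP cop) in e.
have -> : x = (x ^+ d) ^+ a * ((x ^+ b) ^+ p)^-1.
  apply: (canRL (mulfK _)); first by rewrite !expf_neq0.
  by rewrite -!exprM -exprS (mulnC d) e addn1.
apply: is_ppowM; first exact: is_ppowX.
by apply/is_ppowV/is_ppow_exp; [apply: fldX | rewrite expf_neq0].
Qed.

End Subfield.

(** Its only nonunit is 0, so [unramified] specialises to the irreducibility of X^p - b over K. *)
Lemma trivial_valuation (R : fieldType) : valuation_ring (fun _ : R => True).
Proof. by split=> // x; left. Qed.

(** * A p-th root of a unit, over the residue field *)

Section Unramified.
Variables (Omega : closedFieldType) (p : nat) (K O : Omega -> Prop).
Hypotheses (p_pr : prime p) (K_fld : is_subfield K) (O_val : valuation_ring O)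
  (K_hens : forall x, K x -> nonunit O (x - 1) -> is_ppow p K x).
Variables (u v : Omega).
Hypotheses (Ku : K u) (u0 : u != 0) (Ou : O u) (OuV : O u^-1)
  (u_nppow : ~ is_ppow p K u) (v_root : v ^+ p = u).
Local Notation M := (nonunit O).

Let KO x := K x /\ O x.

Let KO_ring : subring_pred KO.
Proof.
have [O1 OB OM _] := O_val.
split; first by split=> //; exact: fld1.
  by move=> x y [? ?] [? ?]; split; [apply: fldB | apply: OB].
by move=> x y [? ?] [? ?]; split; [apply: fldM | apply: OM].
Qed.

Let p_gt0 : (0 < p)%N := prime_gt0 p_pr.

Lemma root_unit_val : O v.
Proof. by apply: (val_root O_val p_gt0); rewrite v_root. Qed.

Let residue_degree d :=
  exists q : {poly Omega}, [/\ q \is monic, poly_in KO q, size q = d.+1 & M q.[v]].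

Lemma monic_truncation q : poly_in KO q -> M q.[v] -> ~ poly_in M q ->
  exists2 d, (d < size q)%N & residue_degree d.
Proof.
have [N] := ubnP (size q); elim: N q => // N IH q /ltnSE hN Kq Mq nMq.
case: N => [|N] in IH hN *.
  by case: nMq; move: hN; rewrite leqn0 size_poly_eq0 => /eqP -> i; rewrite coef0; apply: nonunit0.
have [MN|nMN] := pselect (M q`_N); last first.
  have [KN ON] := Kq N; have [N0 NV] := val_unit ON nMN.
  have sq : size q = N.+1.
    apply/eqP; rewrite eqn_leq hN ltnNge; apply/negP=> /leq_sizeP/(_ N (leqnn N))/eqP.
    by rewrite (negPf N0).
  exists N; first by rewrite sq.
  exists ((q`_N)^-1 *: q); split.
  - by rewrite monicE lead_coefZ lead_coefE sq /= mulVf.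
  - by apply: poly_inZ => //; split=> //; apply: fldV.
  - by rewrite size_scale // invr_eq0.
  - by rewrite hornerZ; apply: nonunitM.
have [||||d hd Rd] := IH (\poly_(i < N) q`_i).
- by rewrite ltnS size_poly.
- by apply: poly_in_poly.
- have -> : (\poly_(i < N) q`_i).[v] = q.[v] - q`_N * v ^+ N.
    by rewrite (@horner_coef_wide _ N.+1 q) // big_ord_recr /= addrK horner_poly.
  by apply: nonunitB => //; apply: nonunitMr => //; apply: valX => //; apply: root_unit_val.
- move=> h; apply: nMq => i; case: (ltngtP i N) => [lt|gt|->] //.
    by have := h i; rewrite coef_poly lt.
  by rewrite (leq_sizeP _ _ hN) //; apply: nonunit0.
exists d => //; apply: leq_trans hd _; apply/leq_sizeP => i hi.
by rewrite coef_poly; case: ifP => // _; apply: (leq_sizeP _ _ (leqnn (size q))).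
Qed.

Lemma nonunit_prod_sub (rs : seq Omega) :
  (forall r, r \in rs -> M (r ^+ p - u)) ->
  M (\prod_(r <- rs) r ^+ p - u ^+ size rs).
Proof.
elim: rs => [|r rs IH] h; first by rewrite big_nil expr0 subrr; apply: nonunit0.
rewrite big_cons /= exprS.
set P := \prod_(r <- rs) _; set s := size rs.
have -> : r ^+ p * P - u * u ^+ s = (r ^+ p - u) * (P - u ^+ s) + (r ^+ p - u) * u ^+ s + u * (P - u ^+ s) by ring.
have h1 : M (r ^+ p - u) by apply: h; rewrite mem_head.
have h2 : M (P - u ^+ s) by apply: IH => r' hr'; apply: h; rewrite inE hr' orbT.
apply: nonunitD => //; first apply: nonunitD => //.
- by apply: nonunitM => //; apply: nonunit_val.
- by apply: nonunitMr => //; apply: valX.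
- exact: nonunitM.
Qed.

(* X^p - u stays irreducible over the residue field of K: a monic factor of
   degree d < p would make u^d, hence u, a p-th power. *)
Theorem unramified (q : {poly Omega}) : poly_in K q -> poly_in O q ->
  (size q <= p)%N -> M q.[v] -> poly_in M q.
Proof.
move=> Kq Oq sq Mq; apply: contrapT => nMq.
have [d0 hd0 Rd0] : exists2 d, (d < size q)%N & residue_degree d.
  by apply: monic_truncation => // i; split.
have exd : exists d, `[<residue_degree d>] by exists d0; apply/asboolP.
have [d /asboolP[g [gm Kg sg Mg]] dmin] := ex_minnP exd.
have d_lt_p : (d < p)%N.
  by apply: leq_ltn_trans (dmin d0 _) (leq_trans hd0 sq); apply/asboolP.
have d_gt0 : (0 < d)%N.
  rewrite lt0n; apply/eqP=> e; apply: (nonunit1 O_val); move: sg gm Mg.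
  rewrite e => /eqP/size_poly1P[c c0 ->]; rewrite monicE lead_coefC => /eqP ->.
  by rewrite hornerC.
have Of : poly_in KO ('X^p - u%:P).
  by apply: poly_inB => //; [apply: poly_inXn | apply: poly_inC].
have [s [r [Ks Kr e sr]]] := monic_division KO_ring gm Kg Of.
(* Otherwise [monic_truncation] would extract from r a degree smaller than d. *)
have Mr : poly_in M r.
  apply: contrapT => nMr; have [|d' hd' Rd'] := monic_truncation Kr _ nMr.
    have -> : r = 'X^p - u%:P - g * s by rewrite e addrAC subrr add0r.
    rewrite !hornerE v_root subrr sub0r; apply: nonunitN => //; apply: nonunitMr => //.
    by apply: (poly_in_horner (valuation_subring O_val)); [move=> i; case: (Ks i) | apply: root_unit_val].
  by have := dmin d' (asboolT Rd'); rewrite leqNgt -ltnS -sg (leq_trans _ sr) // ltnS.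
(* As r is in M, every root z of g has z^p = u modulo M. The product of the d roots is g(0) up to
   sign, which gives c in K with c^p = u^d modulo M. *)
have [rs ers] := closed_field_poly_normal g.
move: (ers); rewrite (monicP gm) scale1r => eg.
have hr z : z \in rs -> M (z ^+ p - u).
  move=> zrs; have gz : root g z by rewrite eg root_prod_XsubC.
  have Oz : O z by apply: val_integral gm _ gz => // i; case: (Kg i).
  have := congr1 (fun f => f.[z]) e; rewrite !hornerE (rootP gz) mul0r add0r => ->.
  rewrite horner_coef; apply: nonunit_sum => // i _.
  by apply: nonunitMr => //; apply: valX.
have srs : size rs = d by apply: succn_inj; rewrite -sg eg size_prod_XsubC.
have := nonunit_prod_sub hr; rewrite srs prodrXl.
have -> : \prod_(z <- rs) z = (-1) ^+ d * g`_0.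
  rewrite -horner_coef0 eg horner_prod -srs.
  by elim: (rs) => [|z l IHl]; rewrite ?big_nil ?mulr1 // !big_cons IHl !hornerE /= exprS; ring.
set c := _ * g`_0 => Mc.
have Kc : K c.
  by apply: fldM => //; [apply: fldX => //; apply: (subringN (subfield_subring K_fld)); apply: fld1 | case: (Kg 0%N)].
have ud0 : u ^+ d != 0 by rewrite expf_neq0.
have Mcd : M (c ^+ p / u ^+ d - 1).
  have -> : c ^+ p / u ^+ d - 1 = (c ^+ p - u ^+ d) * (u ^+ d)^-1 by field.
  by apply: nonunitMr => //; rewrite -exprVn; apply: valX.
have c0 : c != 0.
  apply/eqP=> c0; move: Mcd; rewrite c0 expr0n gtn_eqF // mul0r sub0r.
  by move/(nonunitN O_val); rewrite opprK; apply: nonunit1.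
apply: u_nppow; apply: (is_ppow_coprime K_fld (d := d) p_pr Ku u0).
  by rewrite gtnNdvd.
have Kcd : K (c ^+ p / u ^+ d) by apply: fld_div => //; apply: fldX.
have := is_ppowV K_fld (K_hens Kcd Mcd); rewrite invf_div => h.
rewrite -[_ ^+ d](divfK (_ : c ^+ p != 0)); last by rewrite expf_neq0.
by apply: is_ppowM => //; apply: is_ppow_exp.
Qed.

End Unramified.

(** * Kummer extensions *)

Lemma comp_scaleXE (R : comNzRingType) (q : {poly R}) (c : R) :
  q \Po (c *: 'X) = \poly_(i < size q) (q`_i * c ^+ i).
Proof.
rewrite comp_polyE poly_def; apply: eq_bigr => i _.
by rewrite exprZn scalerA.
Qed.

Lemma coef_comp_scaleX (R : comNzRingType) (q : {poly R}) (c : R) i :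
  (q \Po (c *: 'X))`_i = q`_i * c ^+ i.
Proof.
rewrite comp_scaleXE coef_poly; case: ltnP => // h.
by rewrite (leq_sizeP _ _ (leqnn (size q))) // mul0r.
Qed.

Lemma horner_comp_scaleX (R : comNzRingType) (q : {poly R}) (c x : R) :
  (q \Po (c *: 'X)).[x] = q.[c * x].
Proof. by rewrite horner_comp hornerZ hornerX. Qed.

Section Adjoin.
Variables (Omega : fieldType) (K : Omega -> Prop) (b : Omega).

Lemma adjoin_fld : is_subfield (adjoin K b).
Proof.
split=> [M HM _ _|M HM _ _|x y hx hy M HM KM Mb|x y hx hy M HM KM Mb|x hx M HM KM Mb].
- exact: fld0 HM.
- exact: fld1 HM.
- by apply: (fldB HM); [apply: hx | apply: hy].
- by apply: (fldM HM); [apply: hx | apply: hy].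
- by apply: (fldV HM); apply: hx.
Qed.

Lemma adjoin_sub : sub_fld K (adjoin K b).
Proof. by move=> x Kx M _ KM _; apply: KM. Qed.

Lemma adjoin_gen : adjoin K b b.
Proof. by move=> M _ _ Mb. Qed.

Lemma adjoin_min M : is_subfield M -> sub_fld K M -> M b -> sub_fld (adjoin K b) M.
Proof. by move=> HM KM Mb x; apply. Qed.

Lemma adjoin_horner q : poly_in K q -> adjoin K b q.[b].
Proof.
move=> Kq; apply: (poly_in_horner (subfield_subring adjoin_fld)); last exact: adjoin_gen.
by move=> i; apply: adjoin_sub.
Qed.

End Adjoin.

Lemma adjoinS (Omega : fieldType) (K L : Omega -> Prop) b :
  sub_fld K L -> sub_fld (adjoin K b) (adjoin L b).
Proof.
move=> KL; apply: adjoin_min; [exact: adjoin_fld | | exact: adjoin_gen].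
by move=> x /KL; apply: adjoin_sub.
Qed.

Lemma adjoin_id (Omega : fieldType) (K : Omega -> Prop) b :
  is_subfield K -> K b -> adjoin K b = K.
Proof.
move=> K_fld Kb; apply/funext => x; apply/propext; split; last exact: adjoin_sub.
exact: adjoin_min.
Qed.

Section RootsOfUnity.
Variables (R : fieldType) (p : nat) (zeta : R).
Hypotheses (p_pr : prime p) (p_odd : odd p) (zeta_prim : p.-primitive_root zeta).

(** The total exponent is the binomial coefficient C(p, 2), which p divides because p is odd. *)
Lemma prod_zeta_powers : \prod_(k < p) zeta ^+ k = 1.
Proof.
rewrite prodrXr -(big_mkord xpredT id) bin2_sum -(prim_expr_mod zeta_prim).
have p2 : (2 < p)%N by case: p p_pr p_odd => [|[|[|]]].
have /eqP -> : ('C(p, 2) %% p == 0)%N by apply: prime_dvd_bin.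
by rewrite expr0.
Qed.

Lemma prod_zeta_root (x : R) : \prod_(k < p) (zeta ^+ k * x) = x ^+ p.
Proof. by rewrite big_split /= prod_zeta_powers mul1r prodr_const card_ord. Qed.

Lemma zetaX_root x k : (zeta ^+ k * x) ^+ p = x ^+ p.
Proof. by rewrite exprMn exprAC (prim_expr_order zeta_prim) expr1n mul1r. Qed.

Lemma root_ratio x y : y != 0 -> x ^+ p = y ^+ p -> exists2 k, (k < p)%N & x = zeta ^+ k * y.
Proof.
move=> y0 e; have h : (x / y) ^+ p = 1 by rewrite expr_div_n e divff // expf_neq0.
have [k ek] := prim_rootP zeta_prim h; exists k => //; by rewrite -ek divfK.
Qed.

Lemma sum_zeta_powers j : ~~ (p %| j)%N -> \sum_(k < p) zeta ^+ (k * j) = 0.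
Proof.
move=> nj; have z1 : zeta ^+ j - 1 != 0.
  by rewrite subr_eq0 -(prim_order_dvd zeta_prim).
apply: (mulfI z1); rewrite mulr0.
under eq_bigr => k _ do rewrite mulnC exprM.
by rewrite -subrX1 exprAC (prim_expr_order zeta_prim) expr1n subrr.
Qed.

End RootsOfUnity.

Section Kummer.
Variables (Omega : closedFieldType) (p : nat) (zeta : Omega) (K : Omega -> Prop).
Hypotheses (p_pr : prime p) (p_odd : odd p) (zeta_prim : p.-primitive_root zeta)
  (K_fld : is_subfield K) (Kzeta : K zeta).
Let K_ring : subring_pred K := subfield_subring K_fld.
Let p_gt0 : (0 < p)%N := prime_gt0 p_pr.

Section Generator.
Variables (b beta : Omega).
Hypotheses (Kb : K b) (b0 : b != 0) (b_nppow : ~ is_ppow p K b) (beta_root : beta ^+ p = b).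

Lemma kummer_indep (q : {poly Omega}) :
  poly_in K q -> (size q <= p)%N -> q.[beta] = 0 -> q = 0.
Proof.
move=> Kq sq q0.
have hens x : K x -> nonunit (fun _ : Omega => True) (x - 1) -> is_ppow p K x.
  move=> Kx [/eqP|//]; rewrite subr_eq0 => /eqP ->; exists 1.
  by rewrite oner_eq0 expr1n; split=> //; apply: fld1.
have := unramified p_pr K_fld (trivial_valuation Omega) hens Kb b0 I I b_nppow beta_root Kq.
move=> h; apply/polyP => i; rewrite coef0.
by have [//|[]] := h (fun _ => I) sq (or_introl q0) i.
Qed.

Lemma kummer_reduce (f : {poly Omega}) : poly_in K f ->
  exists2 r, poly_in K r & (size r <= p)%N /\ forall x, x ^+ p = b -> f.[x] = r.[x].
Proof.
move=> Kf; have m : 'X^p - b%:P \is monic by apply: monicXnsubC.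
have Kg : poly_in K ('X^p - b%:P).
  by apply: poly_inB => //; [apply: poly_inXn | apply: poly_inC].
have [s [r [Ks Kr e sr]]] := monic_division K_ring m Kg Kf.
exists r => //; split; first by rewrite size_XnsubC // ltnS in sr.
by move=> x ex; rewrite e !hornerE ex subrr mul0r add0r.
Qed.

Lemma kummer_vanish (f : {poly Omega}) x : poly_in K f -> f.[beta] = 0 ->
  x ^+ p = b -> f.[x] = 0.
Proof.
move=> Kf f0 ex; have [r Kr [sr er]] := kummer_reduce Kf.
rewrite er // (kummer_indep Kr sr) ?horner0 // -er //.
Qed.

Lemma zeta_beta_root k : (zeta ^+ k * beta) ^+ p = b.
Proof. by rewrite (zetaX_root zeta_prim). Qed.

Lemma poly_in_scale (q : {poly Omega}) k : poly_in K q -> poly_in K (q \Po (zeta ^+ k *: 'X)).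
Proof.
by move=> Kq i; rewrite coef_comp_scaleX; apply: fldM => //; do 2 apply: fldX => //.
Qed.

Definition conj_norm (q : {poly Omega}) : Omega := \prod_(k < p) q.[zeta ^+ k * beta].

(** The product Q of the q(zeta^k X) is unchanged by X -> zeta X, so only powers of X^p occur in it,
    and beta^p = b is in K. *)
Lemma conj_norm_in (q : {poly Omega}) : poly_in K q -> K (conj_norm q).
Proof.
move=> Kq; pose Q := \prod_(k < p) (q \Po (zeta ^+ k *: 'X)).
have KQ : poly_in K Q by apply: poly_in_prod => // k; apply: poly_in_scale.
have invQ : Q \Po (zeta *: 'X) = Q.
  have -> : Q \Po (zeta *: 'X) = \prod_(k < p) (q \Po (zeta ^+ k.+1 *: 'X)).
    rewrite /Q rmorph_prod; apply: eq_bigr => k _; rewrite /= -comp_polyA.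
    by rewrite comp_polyZ comp_polyX scalerA exprSr.
  rewrite /Q; case: p p_gt0 (prim_expr_order zeta_prim) => // n _ ez.
  by rewrite big_ord_recr ez big_ord_recl expr0 mulrC.
have -> : conj_norm q = Q.[beta].
  by rewrite horner_prod; apply: eq_bigr => k _; rewrite horner_comp_scaleX.
rewrite horner_coef; apply: subring_sum => // i _.
have [/dvdnP[j ->]|ndvd] := boolP (p %| i)%N.
  by apply: fldM => //; rewrite mulnC exprM beta_root; apply: fldX.
have /eqP := congr1 (fun f : {poly Omega} => f`_i) invQ.
rewrite coef_comp_scaleX -subr_eq0 -{2}[Q`_i]mulr1 -mulrBr mulf_eq0 subr_eq0.
rewrite -(prim_order_dvd zeta_prim) (negPf ndvd) orbF => /eqP ->.
by rewrite mul0r; apply: fld0.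
Qed.

(** If q vanishes at zeta^k beta, its reduction r of degree below p makes r(zeta^k X) vanish at
    beta; hence r = 0, and q(beta) = 0. *)
Lemma conj_norm_neq0 (q : {poly Omega}) : poly_in K q -> q.[beta] != 0 -> conj_norm q != 0.
Proof.
move=> Kq q0; apply/prodf_neq0 => k _; apply: contra q0 => /eqP e.
have [r Kr [sr er]] := kummer_reduce Kq.
have h : (r \Po (zeta ^+ k *: 'X)) = 0.
  apply: kummer_indep; first exact: poly_in_scale.
    by rewrite comp_scaleXE (leq_trans (size_poly _ _)).
  by rewrite horner_comp_scaleX -er ?zeta_beta_root.
have r0 : r = 0.
  apply/polyP => i; have /eqP := congr1 (fun f : {poly Omega} => f`_i) h.
  rewrite coef_comp_scaleX !coef0 mulf_eq0 !expf_eq0 (prim_root_eq0 zeta_prim).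
  by rewrite (gtn_eqF p_gt0) !andbF orbF => /eqP.
by rewrite er // r0 horner0.
Qed.

Lemma adjoinP x : adjoin K beta x <-> exists2 q, poly_in K q & (size q <= p)%N /\ x = q.[beta].
Proof.
split=> [|[q Kq [_ ->]]]; last exact: adjoin_horner.
have red f : poly_in K f ->
    exists2 q, poly_in K q & (size q <= p)%N /\ f.[beta] = q.[beta].
  by move=> /kummer_reduce[r Kr [sr er]]; exists r => //; rewrite er.
move: x; apply: (@adjoin_min _ K beta (fun x => exists2 q, poly_in K q & (size q <= p)%N /\ x = q.[beta])).
- split.
  + by exists 0; rewrite ?size_poly0 ?horner0 //; move=> i; rewrite coef0; apply: fld0.
  + by have [q Kq] := red 1%:P (poly_inC K_ring (fld1 K_fld)); rewrite hornerC; exists q.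
  + move=> _ _ [q Kq [_ ->]] [r Kr [_ ->]].
    by rewrite -hornerN -hornerD; apply: red; apply: poly_inB.
  + move=> _ _ [q Kq [_ ->]] [r Kr [_ ->]].
    by rewrite -hornerM; apply: red; apply: poly_inM.
  + move=> _ [q Kq [_ ->]]; have [->|q0] := eqVneq q.[beta] 0.
      rewrite invr0; exists 0; rewrite ?size_poly0 ?horner0 //.
      by move=> i; rewrite coef0; apply: fld0.
    have n0 := conj_norm_neq0 Kq q0; have Kn := conj_norm_in Kq.
    (* The inverse is the product of the other conjugates divided by the norm. *)
    pose f := (conj_norm q)^-1 *: \prod_(k < p.-1) (q \Po (zeta ^+ k.+1 *: 'X)).
    have -> : q.[beta]^-1 = f.[beta].
      apply: (mulfI q0); rewrite divff // hornerZ horner_prod mulrCA.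
      apply: (mulfI n0); rewrite mulVKf // mulr1 /conj_norm.
      rewrite -(prednK p_gt0) big_ord_recl expr0 mul1r; congr (_ * _).
      by apply: eq_bigr => k _; rewrite horner_comp_scaleX.
    apply: red; apply: poly_inZ => //; first exact: fldV.
    by apply: poly_in_prod => // k; apply: poly_in_scale.
- by move=> y Ky; have := red y%:P (poly_inC K_ring Ky); rewrite hornerC.
- by have := red 'X (poly_inXn K_ring 1); rewrite hornerX.
Qed.

Lemma kummer_basis : is_basis K (adjoin K beta) (fun i : 'I_p => beta ^+ i).
Proof.
split=> [i|c Kc c0 i|x /adjoinP[q Kq [sq ->]]].
- by apply: (fldX (adjoin_fld K beta)); apply: adjoin_gen.
- pose f := \poly_(i < p) (if insub i is Some j then c j else 0).
  have Kf : poly_in K f.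
    by apply: poly_in_poly => // k _; case: insub => [j|] //; apply: fld0.
  have f0 : f.[beta] = 0.
    by rewrite horner_poly -[RHS]c0; apply: eq_bigr => k _; rewrite valK.
  have := congr1 (fun g : {poly Omega} => g`_i) (kummer_indep Kf (size_poly _ _) f0).
  by rewrite coef_poly ltn_ord valK coef0.
- by exists (fun i => q`_i) => //; rewrite (horner_coef_wide _ sq).
Qed.

Lemma zeta_beta_inj : beta != 0 -> forall i j : 'I_p, zeta ^+ i * beta = zeta ^+ j * beta -> i = j.
Proof.
move=> beta0 i j /(mulIf beta0)/eqP; rewrite (eq_prim_root_expr zeta_prim).
by rewrite !modn_small // => /eqP/val_inj.
Qed.

(* Applying the p conjugations to y s_i = sum_j M_ij s_j diagonalises M. *)
Lemma is_norm_conj (q : {poly Omega}) c : poly_in K q ->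
  is_norm K (adjoin K beta) q.[beta] c -> c = conj_norm q.
Proof.
move=> Kq [n [s [M [[Ls s_free s_span] KM eM ->]]]].
have beta0 : beta != 0 by apply: contra_neq b0 => beta0; rewrite -beta_root beta0 expr0n gtn_eqF.
have /choice[g hg] i : exists g, [/\ poly_in K g, (size g <= p)%N & s i = g.[beta]].
  by have /adjoinP[g Kg [sg eg]] := Ls i; exists g.
have eM' i (k : 'I_p) : q.[zeta ^+ k * beta] * (g i).[zeta ^+ k * beta] =
    \sum_(j < n) M i j * (g j).[zeta ^+ k * beta].
  pose f := q * g i - \sum_(j < n) M i j *: g j.
  have fE x : f.[x] = q.[x] * (g i).[x] - \sum_(j < n) M i j * (g j).[x].
    by rewrite !hornerE horner_sum; congr (_ - _); apply: eq_bigr => j _; rewrite hornerZ.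
  have Kf : poly_in K f.
    apply: poly_inB => //; first by apply: poly_inM => //; case: (hg i).
    move=> l; rewrite coef_sum; apply: subring_sum => // j _.
    by rewrite coefZ; apply: fldM => //; case: (hg j).
  have := kummer_vanish Kf _ (zeta_beta_root k); rewrite !fE => h.
  apply/eqP; rewrite -subr_eq0; apply/eqP/h; apply/eqP; rewrite subr_eq0.
  have [_ _ <-] := hg i; rewrite eM; apply/eqP/eq_bigr => j _.
  by have [_ _ <-] := hg j.
(* The basis s in [is_norm] is arbitrary, even in length. P and Q pass between it and the powers of
   beta; being inverse to each other they force n = p. *)
pose P := \matrix_(i < n, j < p) (g i)`_j.
have gE i x : (g i).[x] = \sum_(j < p) P i j * x ^+ j.
  have [_ sg _] := hg i; rewrite (horner_coef_wide _ sg).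
  by apply: eq_bigr => j _; rewrite mxE.
have KP i j : K (P i j) by rewrite mxE; case: (hg i).
have /choice[Q' hQ'] (j : 'I_p) : exists c : 'I_n -> Omega,
    (forall i, K (c i)) /\ beta ^+ j = \sum_(i < n) c i * s i.
  have [d Kd ed] := s_span (beta ^+ j) (fldX (adjoin_fld K beta) j (@adjoin_gen _ K beta)).
  by exists d.
pose Q := \matrix_(j < p, i < n) Q' j i.
have KQ i j : K (Q i j) by rewrite mxE; case: (hQ' i).
have PQ : P *m Q = 1%:M.
  apply/matrixP => i l; apply/eqP; rewrite -subr_eq0; apply/eqP.
  apply: (s_free (fun l => (P *m Q) i l - (1%:M : 'M_n) i l)).
    move=> j; apply: fldB => //; rewrite !mxE; first by apply: subring_sum => // k _; apply: fldM.
    by case: eqP => _; [apply: fld1 | apply: fld0].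
  under eq_bigr do rewrite mulrBl; rewrite big_split /= sumrN; apply/eqP; rewrite subr_eq0.
  have -> : \sum_(j < n) (1%:M : 'M_n) i j * s j = s i.
    rewrite (bigD1 i) //= mxE eqxx mul1r big1 ?addr0 // => j ji.
    by rewrite mxE eq_sym (negPf ji) mul0r.
  have [_ _ ->] := hg i; rewrite gE; apply/eqP.
  under eq_bigr do rewrite mxE mulr_suml.
  rewrite exchange_big; apply: eq_bigr => j _ /=.
  have [_ ->] := hQ' j; rewrite mulr_sumr; apply: eq_bigr => k _.
  by rewrite mulrA [Q _ _]mxE.
have QP : Q *m P = 1%:M.
  have [_ b_free _] := kummer_basis.
  apply/matrixP => i l; apply/eqP; rewrite -subr_eq0; apply/eqP.
  apply: (b_free (fun l => (Q *m P) i l - (1%:M : 'M_p) i l)).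
    move=> j; apply: fldB => //; rewrite !mxE; first by apply: subring_sum => // k _; apply: fldM.
    by case: eqP => _; [apply: fld1 | apply: fld0].
  under eq_bigr do rewrite mulrBl; rewrite big_split /= sumrN; apply/eqP; rewrite subr_eq0.
  have -> : \sum_(j < p) (1%:M : 'M_p) i j * beta ^+ j = beta ^+ i.
    rewrite (bigD1 i) //= mxE eqxx mul1r big1 ?addr0 // => j ji.
    by rewrite mxE eq_sym (negPf ji) mul0r.
  have [_ ->] := hQ' i; apply/eqP.
  under eq_bigr do rewrite mxE mulr_suml.
  rewrite exchange_big; apply: eq_bigr => j _ /=.
  have [_ _ ->] := hg j; rewrite gE mulr_sumr; apply: eq_bigr => k _.
  by rewrite mulrA [Q _ _]mxE.
have np : n = p by apply/eqP; rewrite eqn_leq (mulmx1_min PQ) (mulmx1_min QP).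
(* The columns of P W are the conjugates of the basis s, so M is similar to the diagonal matrix
   D. *)
pose W : 'M_p := Vandermonde p (\row_(k < p) (zeta ^+ k * beta)).
have WE j k : W j k = (zeta ^+ k * beta) ^+ j by rewrite !mxE.
have W_unit : W \in unitmx.
  rewrite unitmxE unitfE det_Vandermonde; apply/prodf_neq0 => i _; apply/prodf_neq0 => j ij.
  rewrite !mxE subr_eq0; apply/eqP => /(zeta_beta_inj beta0) e.
  by rewrite e ltnn in ij.
pose D : 'M_p := diag_mx (\row_(k < p) q.[zeta ^+ k * beta]).
have MPW : M *m (P *m W) = (P *m W) *m D.
  apply/matrixP => i k; rewrite mul_mx_diag [LHS]mxE mxE [X in _ = _ * X]mxE.
  have PWE j : (P *m W) j k = (g j).[zeta ^+ k * beta].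
    by rewrite mxE gE; apply: eq_bigr => l _; rewrite WE.
  rewrite -/((P *m W) i k) PWE mulrC eM'; apply: eq_bigr => j _.
  by rewrite PWE.
have MPW' : M = P *m (W *m D *m invmx W *m Q).
  have -> : M = M *m (P *m W *m (invmx W *m Q)).
    by rewrite -mulmxA (mulmxA W) mulmxV // mul1mx PQ mulmx1.
  by rewrite mulmxA MPW !mulmxA.
rewrite MPW'; subst n.
rewrite det_mulmx mulrC -det_mulmx -!mulmxA QP mulmx1 !det_mulmx mulrCA.
by rewrite -det_mulmx mulmxV // det1 mulr1 det_diag; apply: eq_bigr => k _; rewrite mxE.
Qed.

(** It suffices to exhibit one matrix of the multiplication by q(beta), since [is_norm_conj]
    evaluates its determinant. *)
Lemma conj_norm_is_norm (q : {poly Omega}) : poly_in K q ->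
  is_norm K (adjoin K beta) q.[beta] (conj_norm q).
Proof.
move=> Kq.
have /choice[r hr] (i : 'I_p) : exists r, [/\ poly_in K r, (size r <= p)%N & q.[beta] * beta ^+ i = r.[beta]].
  have [|r Kr [sr er]] := kummer_reduce (f := q * 'X^i).
    by apply: poly_inM => //; apply: poly_inXn.
  by exists r; split=> //; rewrite -er // hornerM hornerXn.
pose M := \matrix_(i < p, j < p) (r i)`_j.
suff N : is_norm K (adjoin K beta) q.[beta] (\det M) by rewrite -(is_norm_conj Kq N).
exists p, (fun i => beta ^+ i), M; split=> //; first exact: kummer_basis.
  by move=> i j; rewrite mxE; case: (hr i).
move=> i; have [_ sr ->] := hr i; rewrite (horner_coef_wide _ sr).
by apply: eq_bigr => j _; rewrite mxE.
Qed.

End Generator.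
End Kummer.

(** * The generating automorphism of K(beta) over K, and Hilbert 90 *)

Section KummerConjugation.
Variables (Omega : closedFieldType) (p : nat) (zeta : Omega) (K : Omega -> Prop).
Hypotheses (p_pr : prime p) (p_odd : odd p) (zeta_prim : p.-primitive_root zeta)
  (K_fld : is_subfield K) (Kzeta : K zeta).
Let K_ring : subring_pred K := subfield_subring K_fld.
Let p_gt0 : (0 < p)%N := prime_gt0 p_pr.
Variables (b beta : Omega).
Hypotheses (Kb : K b) (b0 : b != 0) (b_nppow : ~ is_ppow p K b) (beta_root : beta ^+ p = b).

Local Notation L := (adjoin K beta).
Let L_fld : is_subfield L := adjoin_fld K beta.

Lemma beta_neq0 : beta != 0.
Proof. by apply: contra_neq b0 => e; rewrite -beta_root e expr0n gtn_eqF. Qed.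

Lemma adjoin_poly x : L x -> exists2 q, poly_in K q & x = q.[beta].
Proof.
by move/(adjoinP p_pr zeta_prim K_fld Kzeta Kb b0 b_nppow beta_root) => [q Kq [_ ->]]; exists q.
Qed.

(** A polynomial is chosen for each element of L. The result does not depend on the choice, as a
    relation over K satisfied by beta holds at every p-th root of b. *)
Lemma kummer_conj_ex : exists sigma : Omega -> Omega,
  forall q, poly_in K q -> sigma q.[beta] = q.[zeta * beta].
Proof.
have [f hf] : exists f : Omega -> {poly Omega}, forall x, L x -> poly_in K (f x) /\ x = (f x).[beta].
  have /choice[f hf] x : exists q, L x -> poly_in K q /\ x = q.[beta].
    have [/adjoin_poly[q Kq e]|nL] := pselect (L x); first by exists q.
    by exists 0.
  by exists f.
exists (fun x => (f x).[zeta * beta]) => q Kq.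
have [Kf ef] := hf _ (adjoin_horner (b := beta) Kq).
apply/eqP; rewrite -subr_eq0 -hornerN -hornerD; apply/eqP.
apply: (kummer_vanish p_pr K_fld Kb b0 b_nppow beta_root).
- exact: poly_inB.
- by rewrite !hornerE -ef subrr.
- by rewrite -[zeta]expr1 (zetaX_root zeta_prim).
Qed.

Variable sigma : Omega -> Omega.
Hypothesis sigma_horner : forall q, poly_in K q -> sigma q.[beta] = q.[zeta * beta].

Lemma iter_sigma_horner q k : poly_in K q -> iter k sigma q.[beta] = q.[zeta ^+ k * beta].
Proof.
elim: k => [|k IH] Kq; first by rewrite expr0 mul1r.
have Ks := poly_in_scale K_fld Kzeta k Kq.
by rewrite iterS IH // -horner_comp_scaleX sigma_horner // horner_comp_scaleX mulrA exprSr.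
Qed.

Lemma sigma_in x : L x -> L (sigma x).
Proof.
move/adjoin_poly => [q Kq ->]; rewrite sigma_horner //.
have := poly_in_scale K_fld Kzeta 1 Kq; rewrite expr1 => Ks.
by rewrite -horner_comp_scaleX; apply: adjoin_horner.
Qed.

Lemma iter_sigma_in k x : L x -> L (iter k sigma x).
Proof. by move=> Lx; elim: k => // k IH; apply: sigma_in. Qed.

Lemma sigmaD x y : L x -> L y -> sigma (x + y) = sigma x + sigma y.
Proof.
move=> /adjoin_poly[q Kq ->] /adjoin_poly[r Kr ->].
by rewrite -hornerD !sigma_horner ?hornerD //; apply: poly_inD.
Qed.

Lemma sigmaM x y : L x -> L y -> sigma (x * y) = sigma x * sigma y.
Proof.
move=> /adjoin_poly[q Kq ->] /adjoin_poly[r Kr ->].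
by rewrite -hornerM !sigma_horner ?hornerM //; apply: poly_inM.
Qed.

Lemma sigma_id x : K x -> sigma x = x.
Proof.
by move=> Kx; have := sigma_horner (poly_inC K_ring Kx); rewrite !hornerC.
Qed.

Lemma sigma_beta : sigma beta = zeta * beta.
Proof. by have := sigma_horner (poly_inXn K_ring 1); rewrite !hornerX. Qed.

Lemma sigmaX x n : L x -> sigma (x ^+ n) = sigma x ^+ n.
Proof.
move=> Lx; elim: n => [|n IH]; first by rewrite !expr0 sigma_id //; apply: fld1.
by rewrite !exprS sigmaM ?IH //; apply: (fldX L_fld).
Qed.

Lemma sigma_prod (I : Type) (r : seq I) (f : I -> Omega) : (forall i, L (f i)) ->
  sigma (\prod_(i <- r) f i) = \prod_(i <- r) sigma (f i).
Proof.
move=> Lf; elim: r => [|i r IH]; first by rewrite !big_nil sigma_id //; apply: fld1.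
by rewrite !big_cons sigmaM ?IH //; apply: (subring_prod (subfield_subring L_fld)).
Qed.

Lemma sigma_sum (I : Type) (r : seq I) (f : I -> Omega) : (forall i, L (f i)) ->
  sigma (\sum_(i <- r) f i) = \sum_(i <- r) sigma (f i).
Proof.
move=> Lf; elim: r => [|i r IH]; first by rewrite !big_nil sigma_id //; apply: fld0.
by rewrite !big_cons sigmaD ?IH //; apply: (subring_sum (subfield_subring L_fld)).
Qed.

Lemma iter_sigma_p x : L x -> iter p sigma x = x.
Proof.
move=> /adjoin_poly[q Kq ->]; rewrite iter_sigma_horner //.
by rewrite (prim_expr_order zeta_prim) mul1r.
Qed.

Lemma sigma_neq0 x : L x -> x != 0 -> sigma x != 0.
Proof.
move=> Lx x0; apply/eqP=> s0; move/eqP: x0; apply.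
(* From sigma x = 0 the remaining p - 1 iterations would give x = 0. *)
rewrite -(iter_sigma_p Lx) -(prednK p_gt0) iterSr s0.
by elim: (p.-1) => // n IHn; rewrite iterS IHn sigma_id //; apply: fld0.
Qed.

Lemma iter_sigmaM k x y : L x -> L y -> iter k sigma (x * y) = iter k sigma x * iter k sigma y.
Proof.
by move=> Lx Ly; elim: k => // k IH; rewrite !iterS IH sigmaM //; apply: iter_sigma_in.
Qed.

Lemma iter_sigma_id k x : K x -> iter k sigma x = x.
Proof. by move=> Kx; elim: k => // k IH; rewrite iterS IH sigma_id. Qed.

Lemma iter_sigma_beta k : iter k sigma beta = zeta ^+ k * beta.
Proof. by have := iter_sigma_horner k (poly_inXn K_ring 1); rewrite !hornerX. Qed.

(** Invariance means zeta^i q_i = q_i for all coefficients, which leaves only q_0. *)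
Lemma sigma_fixed x : L x -> sigma x = x -> K x.
Proof.
move/(adjoinP p_pr zeta_prim K_fld Kzeta Kb b0 b_nppow beta_root) => [q Kq [sq ->]].
rewrite sigma_horner // => e.
have := poly_in_scale K_fld Kzeta 1 Kq; rewrite expr1 => Ks.
have q0 : q \Po (zeta *: 'X) - q = 0.
  apply: (kummer_indep p_pr K_fld Kb b0 b_nppow beta_root); first exact: poly_inB.
    rewrite (leq_trans (size_polyD _ _)) // geq_max size_polyN sq andbT.
    by rewrite comp_scaleXE (leq_trans (size_poly _ _)).
  by rewrite hornerD hornerN horner_comp_scaleX e subrr.
suff -> : q = (q`_0)%:P by rewrite hornerC.
apply/polyP => i; rewrite coefC; case: eqP => [-> //|/eqP i0].
have [h|h] := ltnP i (size q); last by rewrite (leq_sizeP _ _ h).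
have /eqP := congr1 (fun f : {poly Omega} => f`_i) q0.
rewrite coefB coef_comp_scaleX coef0 -{2}[q`_i]mulr1 -mulrBr mulf_eq0 subr_eq0.
rewrite -(prim_order_dvd zeta_prim) gtnNdvd ?lt0n ?(leq_trans h) //.
by rewrite orbF => /eqP.
Qed.

Definition sigma_norm x := \prod_(k < p) iter k sigma x.

Lemma sigma_norm_horner q : poly_in K q -> sigma_norm q.[beta] = conj_norm p zeta beta q.
Proof. by move=> Kq; apply: eq_bigr => k _; rewrite iter_sigma_horner. Qed.

Lemma sigma_normM x y : L x -> L y -> sigma_norm (x * y) = sigma_norm x * sigma_norm y.
Proof.
move=> Lx Ly; rewrite /sigma_norm -big_split; apply: eq_bigr => k _.
exact: iter_sigmaM.
Qed.

Lemma sigma_norm_id x : K x -> sigma_norm x = x ^+ p.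
Proof.
move=> Kx; rewrite /sigma_norm; under eq_bigr => k _ do rewrite iter_sigma_id //.
by rewrite prodr_const card_ord.
Qed.

Lemma sigma_norm_beta : sigma_norm beta = b.
Proof.
rewrite /sigma_norm; under eq_bigr => k _ do rewrite iter_sigma_beta.
by rewrite (prod_zeta_root p_pr p_odd zeta_prim).
Qed.

(* The resolvents of the powers of beta cannot all vanish, since their
   combination with coefficients beta^(-j) is p. *)
Lemma hilbert90 u : L u -> sigma_norm u = 1 -> exists z, [/\ L z, z != 0 & u * sigma z = z].
Proof.
move=> Lu Nu; pose P k := \prod_(l < k) iter l sigma u.
have LP k : L (P k) by apply: (subring_prod (subfield_subring L_fld)) => l _; apply: iter_sigma_in.
have PS k : u * sigma (P k) = P k.+1.
  rewrite /P big_ord_recl sigma_prod; last by move=> l; apply: iter_sigma_in.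
  by congr (_ * _).
(* The map t -> u sigma(t) shifts the terms of this resolvent by one, and N(u) = 1 closes the cycle:
   P p = 1 = P 0. *)
pose Z t := \sum_(k < p) P k * iter k sigma t.
have LZ t : L t -> L (Z t).
  move=> Lt; apply: (subring_sum (subfield_subring L_fld)) => k _.
  by apply: (fldM L_fld) => //; apply: iter_sigma_in.
have eZ t : L t -> u * sigma (Z t) = Z t.
  move=> Lt; rewrite sigma_sum; last by move=> k; apply: (fldM L_fld) => //; apply: iter_sigma_in.
  rewrite mulr_sumr /Z.
  transitivity (\sum_(k < p) P k.+1 * iter k.+1 sigma t).
    by apply: eq_bigr => k _; rewrite sigmaM ?mulrA ?PS //; apply: iter_sigma_in.
  have Pp : P p * iter p sigma t = P 0%N * iter 0 sigma t.
    by rewrite iter_sigma_p // [P p]Nu /P big_ord0.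
  case: p p_gt0 Pp => // n _ Pp.
  by rewrite big_ord_recr Pp [RHS]big_ord_recl addrC.
have [j nz] : exists j : 'I_p, Z (beta ^+ j) != 0.
  apply: contrapT => N; have /eqP := prim_root_natf_neq0 zeta_prim; apply.
  have -> : (p%:R : Omega) = \sum_(j < p) Z (beta ^+ j) / beta ^+ j.
    have e (j : 'I_p) : Z (beta ^+ j) / beta ^+ j = \sum_(k < p) P k * zeta ^+ (k * j).
      rewrite mulr_suml; apply: eq_bigr => k _; rewrite -mulrA; congr (_ * _).
      have -> : iter k sigma (beta ^+ j) = zeta ^+ (k * j) * beta ^+ j.
        elim: (k : nat) => [|l IHl]; first by rewrite mul0n mul1r.
        have Kl : K (zeta ^+ (l * j)) by apply: fldX.
        have Lb : L beta by apply: adjoin_gen.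
        rewrite iterS IHl (sigmaM (adjoin_sub (b := beta) Kl) (fldX L_fld j Lb)).
        rewrite (sigma_id Kl) (sigmaX _ Lb) sigma_beta exprMn.
        by rewrite mulrA -exprD mulSn addnC.
      by rewrite mulfK // expf_neq0 // beta_neq0.
    under eq_bigr => j _ do rewrite e.
    rewrite exchange_big /= (bigD1 (Ordinal p_gt0)) //= [X in _ = _ + X]big1 ?addr0; last first.
      move=> k k0; rewrite -mulr_sumr.
      under eq_bigr => j _ do rewrite mulnC.
      rewrite (sum_zeta_powers zeta_prim) ?mulr0 // gtnNdvd //.
      by rewrite lt0n; apply: contra k0 => /eqP k0; apply/eqP/val_inj.
    rewrite /P; under eq_bigr => j _ do rewrite big_ord0 mul0n expr0 mulr1.
    by rewrite sumr_const card_ord.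
  rewrite big1 // => j _; have [->|nz] := eqVneq (Z (beta ^+ j)) 0; first by rewrite mul0r.
  by case: N; exists j.
exists (Z (beta ^+ j)); split=> //; [apply: LZ | apply: eZ];
  by apply: (fldX L_fld); apply: adjoin_gen.
Qed.

Hypothesis K_rigid : p_rigid_elt p K b.

Lemma rigid_norm x : L x -> x != 0 ->
  exists k t, [/\ K t, t != 0 & sigma_norm x = b ^+ k * t ^+ p].
Proof.
move=> Lx x0; have [q Kq e] := adjoin_poly Lx.
have N := conj_norm_is_norm p_pr zeta_prim K_fld Kzeta Kb b0 b_nppow beta_root Kq.
rewrite -e in N; have [k [_ [t [Kt t0 et]]]] := K_rigid beta_root Lx x0 N.
by exists k, t; split=> //; rewrite e sigma_norm_horner.
Qed.

(** * The subgroup generated by beta, the nonzero elements of K and the p-th powers of L *)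

Definition generated x :=
  exists i f z, [/\ K f, f != 0, L z, z != 0 & x = beta ^+ i * f * z ^+ p].

Lemma generated_in x : generated x -> L x /\ x != 0.
Proof.
case=> i [f [z [Kf f0 Lz z0 ->]]]; split; last by rewrite !mulf_neq0 ?expf_neq0 // beta_neq0.
apply: (fldM L_fld); last exact: (fldX L_fld).
apply: (fldM L_fld); last exact: adjoin_sub.
by apply: (fldX L_fld); apply: adjoin_gen.
Qed.

Lemma generatedM x y : generated x -> generated y -> generated (x * y).
Proof.
case=> i [f [z [Kf f0 Lz z0 ->]]] [j [g [w [Kg g0 Lw w0 ->]]]].
exists (i + j)%N, (f * g), (z * w); rewrite !mulf_neq0 //; split=> //.
- exact: fldM.
- exact: (fldM L_fld).
- by rewrite exprD exprMn; ring.
Qed.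

Lemma generated_id f : K f -> f != 0 -> generated f.
Proof.
move=> Kf f0; exists 0%N, f, 1; rewrite expr0 expr1n mul1r mulr1 oner_neq0.
by split=> //; apply: (fld1 L_fld).
Qed.

Lemma generated_pow z : L z -> z != 0 -> generated (z ^+ p).
Proof.
move=> Lz z0; exists 0%N, 1, z; rewrite expr0 !mul1r oner_neq0.
by split=> //; apply: fld1.
Qed.

Lemma generatedX x n : generated x -> generated (x ^+ n).
Proof.
move=> gx; elim: n => [|n IH]; last by rewrite exprS; apply: generatedM.
by rewrite expr0; apply: generated_id; [apply: fld1 | rewrite oner_neq0].
Qed.

Lemma generated_sigma x : generated x -> generated (sigma x).
Proof.
case=> i [f [z [Kf f0 Lz z0 ->]]].
have Lb : L beta by apply: adjoin_gen.
have Lbi := fldX L_fld i Lb; have Lf := adjoin_sub (b := beta) Kf.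
rewrite (sigmaM (fldM L_fld Lbi Lf) (fldX L_fld p Lz)) (sigmaM Lbi Lf).
rewrite (sigmaX i Lb) (sigmaX p Lz) (sigma_id Kf) sigma_beta.
exists i, (zeta ^+ i * f), (sigma z); split.
- by apply: fldM => //; apply: fldX.
- by rewrite mulf_neq0 // expf_neq0 // (prim_root_eq0 zeta_prim) gtn_eqF.
- exact: sigma_in.
- exact: sigma_neq0.
- by rewrite exprMn; ring.
Qed.

(* delta is sigma - 1 on L^*/L^*p, written with nonnegative exponents. *)
Definition delta x := sigma x * x ^+ p.-1.

Lemma delta_in x : L x -> x != 0 -> L (delta x) /\ delta x != 0.
Proof.
move=> Lx x0; split; last by rewrite mulf_neq0 ?expf_neq0 //; apply: sigma_neq0.
by apply: (fldM L_fld); [apply: sigma_in | apply: (fldX L_fld)].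
Qed.

Lemma iter_delta_in n x : L x -> x != 0 -> L (iter n delta x) /\ iter n delta x != 0.
Proof. by move=> Lx x0; elim: n => // n [Ln n0]; apply: delta_in. Qed.

Lemma iter_deltaM n x y : L x -> x != 0 -> L y -> y != 0 ->
  iter n delta (x * y) = iter n delta x * iter n delta y.
Proof.
move=> Lx x0 Ly y0; elim: n => // n IH; rewrite !iterS IH /delta.
have [Ln _] := iter_delta_in n Lx x0; have [Lm _] := iter_delta_in n Ly y0.
by rewrite sigmaM // exprMn mulrACA.
Qed.

Lemma generated_delta n x : generated x -> generated (iter n delta x).
Proof.
move=> gx; elim: n => // n IH; rewrite iterS.
by apply: generatedM; [apply: generated_sigma | apply: generatedX].
Qed.

(** The binomial expansion of (sigma + (p - 1))^n in exponential notation; the induction is Pascal's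
    rule. *)
Lemma iter_deltaE n x : L x -> iter n delta x =
  \prod_(k < n.+1) iter k sigma x ^+ ('C(n, k) * p.-1 ^ (n - k)).
Proof.
move=> Lx; elim: n => [|n IH]; first by rewrite big_ord_recl big_ord0 mulr1.
have Li k : L (iter k sigma x) by apply: iter_sigma_in.
rewrite iterS {1}/delta IH sigma_prod; last by move=> k; apply: (fldX L_fld).
rewrite -prodrXl.
have -> : \prod_(k < n.+1) (iter k sigma x ^+ ('C(n, k) * p.-1 ^ (n - k))) ^+ p.-1 =
   x ^+ (p.-1 ^ n.+1) * \prod_(k < n.+1) iter k.+1 sigma x ^+ ('C(n, k.+1) * p.-1 ^ (n - k)).
  rewrite big_ord_recl [X in _ = _ * X]big_ord_recr /= (@bin_small n n.+1) // mul0n expr0 mulr1.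
  rewrite bin0 mul1n subn0 -exprM -expnSr; congr (_ * _).
  apply: eq_bigr => k _; rewrite -exprM -mulnA -expnSr /bump /= add1n.
  by rewrite subnSK.
rewrite [RHS]big_ord_recl bin0 mul1n subn0 mulrCA; congr (_ * _).
rewrite -big_split; apply: eq_bigr => k _ /=.
by rewrite sigmaX // -exprD -mulnDl /bump /= add1n subSS binS addnC.
Qed.

(** In characteristic p, (sigma - 1)^p = sigma^p - 1 = 0. The inner binomials give p-th powers, and
    the two outer terms combine to x^((p-1)^p + 1), whose exponent p divides as p is odd. *)
Lemma generated_iter_p_delta x : L x -> x != 0 -> generated (iter p delta x).
Proof.
move=> Lx x0; have it0 l : iter l sigma x != 0.
  by elim: l => // l IHl; apply: sigma_neq0 => //; apply: iter_sigma_in.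
rewrite iter_deltaE // big_ord_recr /= iter_sigma_p // binn subnn mul1n expn0 expr1.
have gprod (I : Type) (r : seq I) (f : I -> Omega) :
    (forall i, generated (f i)) -> generated (\prod_(i <- r) f i).
  move=> gf; apply: (big_ind generated) => //; last exact: generatedM.
  by apply: generated_id; [apply: fld1 | apply: oner_neq0].
rewrite -(prednK p_gt0) big_ord_recl /= prednK // bin0 mul1n subn0 mulrAC.
apply: generatedM; last first.
  apply: gprod => k; rewrite /bump /= add1n.
  have hk : (k.+1 < p)%N by rewrite -[X in (_ < X)%N](prednK p_gt0) ltnS.
  have /dvdnP[m ->] : (p %| 'C(p, k.+1))%N by apply: prime_dvd_bin.
  rewrite mulnAC exprM; apply: generated_pow.
    by apply: (fldX L_fld); apply: (iter_sigma_in k.+1).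
  by rewrite expf_neq0 //; apply: (it0 k.+1).
have /dvdnP[m em] : (p %| (p.-1 ^ p).+1)%N.
  rewrite (dvdn_pcharf (pchar_Fp p_pr)) -natr1 natrX.
  have -> : (p.-1%:R : 'F_p) = -1.
    apply/eqP; rewrite -addr_eq0 natr1 prednK //.
    by rewrite -(dvdn_pcharf (pchar_Fp p_pr)).
  by rewrite -signr_odd p_odd expr1 addNr.
rewrite -exprSr em exprM; apply: generated_pow; first exact: (fldX L_fld).
by rewrite expf_neq0.
Qed.

(* By Hilbert 90 every x is delta z modulo generated elements; iterate until
   delta^p = 0 modulo p-th powers. *)
Theorem kummer_generated x : L x -> x != 0 -> generated x.
Proof.
have step y : L y -> y != 0 -> exists w z,
    [/\ generated w, L z, z != 0 & y = w * delta z].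
  move=> Ly y0; have [k [t [Kt t0 eN]]] := rigid_norm Ly y0.
  have Lb : L beta by apply: adjoin_gen.
  have Lt := adjoin_sub (b := beta) Kt.
  have Lbk := fldX L_fld k Lb.
  have c0 : beta ^+ k * t != 0 by rewrite mulf_neq0 // expf_neq0 // beta_neq0.
  have Lc : L (beta ^+ k * t) by apply: (fldM L_fld).
  (* Since N(beta) = b, the element beta^k t has the same norm b^k t^p as y. *)
  pose u := y / (beta ^+ k * t); have Lu : L u by apply: (fld_div L_fld).
  have Nc : sigma_norm (beta ^+ k * t) = b ^+ k * t ^+ p.
    rewrite sigma_normM // (sigma_norm_id Kt); congr (_ * _).
    elim: k {eN Lbk c0 Lc u Lu} => [|k IHk].
      by rewrite !expr0 sigma_norm_id ?expr1n //; apply: fld1.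
    by rewrite !exprS sigma_normM ?IHk ?sigma_norm_beta //; apply: (fldX L_fld).
  have Nu : sigma_norm u = 1.
    have n0 : b ^+ k * t ^+ p != 0 by rewrite mulf_neq0 ?expf_neq0.
    by apply: (mulIf n0); rewrite mul1r -{1}Nc -sigma_normM // divfK.
  have [z [Lz z0 ez]] := hilbert90 Lu Nu.
  have Lzi : L z^-1 by apply: (fldV L_fld).
  have zi0 : z^-1 != 0 by rewrite invr_eq0.
  (* Here u = z / sigma(z) = z^p delta(z^-1), the factor z^p making up for the exponent p - 1 in
     [delta]. *)
  exists (beta ^+ k * t * z ^+ p), z^-1; split=> //.
    by exists k, t, z.
  have sz0 := sigma_neq0 Lz z0.
  have sV : sigma z^-1 = (sigma z)^-1.
    apply: (mulfI sz0); rewrite -sigmaM // divff // divff // sigma_id //.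
    exact: fld1.
  have zp : z ^+ p * z^-1 ^+ p.-1 = z.
    by rewrite -{1}(prednK p_gt0) exprS -mulrA -exprMn mulfV // expr1n mulr1.
  have eu : u = z ^+ p * ((sigma z)^-1 * z^-1 ^+ p.-1).
    by apply: (mulIf sz0); rewrite ez (mulrC (sigma z)^-1) mulrA zp -mulrA mulVf // mulr1.
  by rewrite /delta sV -mulrA -eu /u mulrC divfK.
have key n y : L y -> y != 0 -> exists w z,
    [/\ generated w, L z, z != 0 & y = w * iter n delta z].
  elim: n y => [|n IH] y Ly y0.
    exists 1, y; rewrite mul1r; split=> //.
    by apply: generated_id; [apply: fld1 | apply: oner_neq0].
  have [w [z [gw Lz z0 ->]]] := IH y Ly y0.
  have [w' [z' [gw' Lz' z'0 ->]]] := step z Lz z0.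
  have [Lw' w'0] := generated_in gw'; have [Ld d0] := delta_in Lz' z'0.
  exists (w * iter n delta w'), z'; split=> //.
    by apply: generatedM => //; apply: generated_delta.
  by rewrite iter_deltaM // mulrA -iterSr.
move=> Lx x0; have [w [z [gw Lz z0 ->]]] := key p x Lx x0.
by apply: generatedM => //; apply: generated_iter_p_delta.
Qed.

Lemma kummer_generated_mod x : L x -> x != 0 ->
  exists i f z, [/\ (i < p)%N, K f, f != 0, L z & z != 0 /\ x = beta ^+ i * f * z ^+ p].
Proof.
move=> Lx x0; have [i [f [z [Kf f0 Lz z0 ->]]]] := kummer_generated Lx x0.
exists (i %% p)%N, (b ^+ (i %/ p) * f), z; split=> //.
- exact: ltn_pmod.
- by apply: fldM => //; apply: fldX.
- by rewrite mulf_neq0 // expf_neq0.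
split=> //; rewrite mulrA -beta_root -exprM -exprD; congr (_ ^+ _ * _ * _).
by rewrite mulnC addnC -divn_eq.
Qed.

End KummerConjugation.

(** * Valued rigid fields *)

Section SubfieldType.
Variables (Omega : fieldType) (F : Omega -> Prop).
Hypothesis F_fld : is_subfield F.

Let mem_F : {pred Omega} := fun x => `[<F x>].

Lemma mem_F_divring : divring_closed mem_F.
Proof.
have [F0 F1 FB FM FV] := F_fld; split; first exact/asboolP.
  by move=> x y /asboolP Fx /asboolP Fy; apply/asboolP/FB.
by move=> x y /asboolP Fx /asboolP Fy; apply/asboolP/FM => //; apply: FV.
Qed.

HB.instance Definition _ := GRing.isDivringClosed.Build Omega mem_F mem_F_divring.
Let sub_F := {x | x \in mem_F}.
HB.instance Definition _ := SubType.on sub_F.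
HB.instance Definition _ := Choice.on sub_F.
HB.instance Definition _ := [SubChoice_isSubIntegralDomain of sub_F by <:].
HB.instance Definition _ := [SubIntegralDomain_isSubField of sub_F by <:].

(** Presents the predicate F as the image of a field type, the setting of [rigid_valuation]. *)
Lemma subfield_type : exists (U : fieldType) (f : {rmorphism U -> Omega}),
  forall x, F x <-> exists u, f u = x.
Proof.
exists sub_F, (val : {rmorphism sub_F -> Omega}) => x; split=> [Fx|[[y Fy] <-]].
  by exists (exist _ x (asboolT Fx) : sub_F).
exact/asboolP.
Qed.


End SubfieldType.

(* Unlike rigidity, which it implies, this property of K visibly passes to
   Kummer extensions of K. *)
Definition valued_rigid (Omega : fieldType) (p : nat) (O K : Omega -> Prop) : Prop :=
  (forall x, K x -> nonunit O (x - 1) -> is_ppow p K x) /\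
  exists y0, [/\ K y0, y0 != 0 & forall x, K x -> x != 0 -> O x -> O x^-1 ->
    exists i t, [/\ K t, t != 0 & x = y0 ^+ i * t ^+ p]].

(** A negative exponent becomes natural through -(n+1) = (n+1)(p-1) - (n+1)p. *)
Lemma pcong_nat_exp (F : fieldType) (p : nat) (x y : F) (i : int) : (0 < p)%N -> y != 0 ->
  pcong p x (y ^ i) -> exists j t, t != 0 /\ x = y ^+ j * t ^+ p.
Proof.
move=> p0 y0 e; have [x0 yi0] := pcong_neq0 e; case: e => s s0 es.
have ex : x = y ^ i * s ^+ p by rewrite -es mulrC divfK.
case: i {es} ex yi0 => n ex yi0; first by exists n, s.
exists (n.+1 * p.-1)%N, (s / y ^+ n.+1); rewrite mulf_neq0 ?invr_eq0 ?expf_neq0 //.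
split=> //; rewrite ex NegzE -invr_expz -exprnP.
rewrite expr_div_n mulrCA mulrC; congr (_ * _).
have h : y ^+ n.+1 ^+ p = y ^+ n.+1 * y ^+ (n.+1 * p.-1).
  by rewrite -exprM -exprD -mulnS prednK.
rewrite h invfM mulrC -mulrA mulVf ?mulr1 // expf_neq0 //.
Qed.

(** * From rigidity to a valuation on Omega *)

Section RigidValued.
Variables (Omega : closedFieldType) (p : nat) (zeta : Omega).
Hypotheses (p_pr : prime p) (p_odd : odd p) (zeta_prim : p.-primitive_root zeta).
Let p_gt0 : (0 < p)%N := prime_gt0 p_pr.

Lemma root_ex (b : Omega) : exists beta, beta ^+ p = b.
Proof.
have /closed_rootP[beta] : size ('X^p - b%:P) != 1.
  by rewrite size_XnsubC // eqSS gtn_eqF.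
by rewrite rootE !hornerE subr_eq0 => /eqP; exists beta.
Qed.

Lemma prod_1sub_zeta (x : Omega) : \prod_(k < p) (1 - zeta ^+ k * x) = 1 - x ^+ p.
Proof.
have [->|x0] := eqVneq x 0.
  by rewrite big1 => [|k _]; rewrite ?mulr0 ?subr0 // expr0n gtn_eqF // subr0.
have := congr1 (fun f : {poly Omega} => f.[x^-1]) (factor_Xn_sub_1 zeta_prim).
rewrite big_mkord horner_prod !hornerE => /(congr1 ( *%R (x ^+ p))).
rewrite mulrBr mulr1 -exprMn mulfV // expr1n => <-.
rewrite -[p in x ^+ p]card_ord -prodr_const -big_split; apply: eq_bigr => k _ /=.
by rewrite !hornerE mulrBr mulfV // mulrC.
Qed.

Theorem rigid_valued (F : Omega -> Prop) : is_subfield F -> F zeta -> p_rigid p F ->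
  exists O, valuation_ring O /\ valued_rigid p O F.
Proof.
move=> F_fld Fzeta rF; have [U [f hf]] := subfield_type F_fld.
have Ff u : F (f u) by apply/hf; exists u.
have ppow_f u : ppow p u <-> is_ppow p F (f u).
  split=> [[t t0 ->]|[_ [/hf[t <-] t0 e]]].
    by exists (f t); rewrite fmorph_eq0 rmorphXn.
  exists t; first by rewrite fmorph_eq0 in t0.
  by apply: (fmorph_inj f); rewrite rmorphXn.
have rU (u : U) : u != 0 -> ~ ppow p u -> exists n : int, pcong p (1 - u) (u ^ n).
  move=> u0 nu; have nfu : ~ is_ppow p F (f u) by rewrite -ppow_f.
  have fu0 : f u != 0 by rewrite fmorph_eq0.
  have [beta eb] := root_ex (f u).
  pose q : {poly Omega} := 1%:P - 'X.
  have Fq : poly_in F q.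
    have F_ring := subfield_subring F_fld.
    by apply: (poly_inB F_ring); [apply: (poly_inC F_ring (fld1 F_fld)) | apply: (poly_inXn F_ring 1)].
  have N := conj_norm_is_norm p_pr zeta_prim F_fld Fzeta (Ff u) fu0 nfu eb Fq.
  have eN : conj_norm p zeta beta q = 1 - f u.
    rewrite -eb -prod_1sub_zeta; apply: eq_bigr => k _.
    by rewrite hornerD hornerN hornerC hornerX.
  have u1 : 1 - f u != 0.
    by rewrite subr_eq0 eq_sym -(rmorph1 f) fmorph_eq; apply/eqP=> e; apply: nu; rewrite e; apply: ppow1.
  have q0 : q.[beta] != 0.
    apply: contra u1; rewrite /q !hornerE !subr_eq0 => /eqP e.
    by rewrite -eb -e expr1n.
  have [k [_ [t [Ft t0 et]]]] := rF _ (Ff u) fu0 nfu _ eb _ _ (adjoin_horner (b := beta) Fq) q0 N.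
  exists k%:Z; apply/ppow_f; exists t; split=> //.
  rewrite rmorphM fmorphV rmorphB rmorph1 -eN et -exprnP rmorphXn mulrC.
  by rewrite mulKf // expf_neq0.
have [O [y0 [O_val O_hens y00 O_unit]]] := rigid_valuation p_pr p_odd rU.
pose OF x := exists u, f u = x /\ O u.
have OFf u : OF (f u) <-> O u.
  by split=> [[v [/fmorph_inj -> //]]|Ou]; exists u.
have [||O' [O'_val O'F]] := @valuation_extension Omega F OF F_fld.
- have [O1 OB OM _] := O_val; split.
  + by exists 1; rewrite rmorph1.
  + by move=> _ _ [u [<- Ou]] [v [<- Ov]]; exists (u - v); rewrite rmorphB; split=> //; apply: OB.
  + by move=> _ _ [u [<- Ou]] [v [<- Ov]]; exists (u * v); rewrite rmorphM; split=> //; apply: OM.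
- move=> _ /hf[u <-]; have [_ _ _ /(_ u)[Ou|OV]] := O_val; [left | right].
    by exists u.
  by exists u^-1; rewrite fmorphV.
have O'f u : O' (f u) <-> O u by rewrite O'F ?OFf.
exists O'; split=> //; split.
  move=> _ /hf[u <-] nu; apply/ppow_f; rewrite -[u](subKr 1); apply: O_hens.
  rewrite -opprB; apply: nonunitN => //.
  case: nu => [/eqP|]; first by rewrite subr_eq0 -(rmorph1 f) => /eqP/fmorph_inj ->; rewrite subrr; left.
  by move=> h; right => Oh; apply: h; rewrite -(rmorph1 f) -rmorphB -fmorphV O'f.
exists (f y0); rewrite fmorph_eq0; split=> // _ /hf[u <-].
rewrite fmorph_eq0 -fmorphV !O'f => u0 Ou OV.
have [i ei] := O_unit u u0 Ou OV; have [j [t [t0 ->]]] := pcong_nat_exp p_gt0 y00 ei.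
by exists j, (f t); rewrite fmorph_eq0 rmorphM !rmorphXn.
Qed.

End RigidValued.

Section MoreValuation.
Variables (R : fieldType) (O : R -> Prop).
Hypothesis O_val : valuation_ring O.
Local Notation M := (nonunit O).

(** Selects a term of largest absolute value, in the sense that it divides all the others in O. *)
Lemma val_max (n : nat) (f : nat -> R) : (exists2 i, (i < n)%N & f i != 0) ->
  exists i, [/\ (i < n)%N, f i != 0 & forall j, (j < n)%N -> O (f j / f i)].
Proof.
elim: n => [[]//|n IH [i0 hi0 fi0]].
have [[i hi fi]|N] := pselect (exists2 i, (i < n)%N & f i != 0); last first.
  have lt0 j : (j < n)%N -> f j = 0.
    by move=> hj; apply: contrapT => /eqP nz; apply: N; exists j.
  have ei : i0 = n.
    by apply/eqP; move: hi0; rewrite ltnS leq_eqVlt => /orP[//|/lt0 e]; rewrite e eqxx in fi0.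
  subst i0; exists n; split=> // j; rewrite ltnS leq_eqVlt => /orP[/eqP ->|/lt0 ->].
    by rewrite divff //; apply: (vring1 O_val).
  by rewrite mul0r; apply: (vring0 O_val).
have [m [hm fm max]] := IH (ex_intro2 _ _ i hi fi).
have [fn0|fn0] := eqVneq (f n) 0.
  exists m; split=> //; first exact: ltnW.
  move=> j; rewrite ltnS leq_eqVlt => /orP[/eqP ->|]; last exact: max.
  by rewrite fn0 mul0r; apply: (vring0 O_val).
have [_ _ _ /(_ (f n / f m))[h|]] := O_val.
  exists m; split=> //; first exact: ltnW.
  by move=> j; rewrite ltnS leq_eqVlt => /orP[/eqP ->|]; last exact: max.
rewrite invf_div => h; exists n; split=> // j; rewrite ltnS leq_eqVlt => /orP[/eqP ->|hj].
  by rewrite divff //; apply: (vring1 O_val).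
have -> : f j / f n = f j / f m * (f m / f n) by field; rewrite fm fn0.
by apply: (valM O_val) => //; apply: max.
Qed.

Lemma nonunit_prod_sub1 (I : Type) (r : seq I) (f : I -> R) :
  (forall i, M (f i - 1)) -> M (\prod_(i <- r) f i - 1).
Proof.
move=> h; elim: r => [|i r IH]; first by rewrite big_nil subrr; apply: nonunit0.
rewrite big_cons; set P := \prod_(_ <- r) _ in IH *.
have -> : f i * P - 1 = (f i - 1) * P + (P - 1) by ring.
apply: (nonunitD O_val) => //; apply: (nonunitMr O_val) => //.
by rewrite -[P](subrK 1); apply: (subringD (valuation_subring O_val)); [apply: (nonunit_val O_val) | apply: (vring1 O_val)].
Qed.

Lemma nonunit_sub1_unit x : M (x - 1) -> [/\ x != 0, O x & O x^-1].
Proof. by move/(nonunit_1D_unit O_val); rewrite addrC subrK. Qed.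

Lemma nonunit_div_sub1 x y : M (x - 1) -> M (y - 1) -> M (x / y - 1).
Proof.
move=> Mx My; have [y0 Oy OV] := nonunit_sub1_unit My.
have -> : x / y - 1 = ((x - 1) - (y - 1)) * y^-1 by field.
by apply: (nonunitMr O_val) => //; apply: (nonunitB O_val).
Qed.

Lemma nonunitX_sub1 x n : M (x - 1) -> M (x ^+ n - 1).
Proof.
move=> Mx; have := nonunit_prod_sub1 (index_enum 'I_n) (fun _ => Mx).
by rewrite prodr_const card_ord.
Qed.

End MoreValuation.

Lemma modn_solve (p i j : nat) : prime p -> ~~ (p %| j)%N ->
  exists2 k, (k < p)%N & (k * j = i %[mod p])%N.
Proof.
move=> p_pr nj; have j0 : (0 < j)%N by case: j nj; rewrite ?dvdn0.
have cop : coprime j p by rewrite coprime_sym prime_coprime.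
have [a b e _] := egcdnP p j0; rewrite (eqP cop) in e.
exists ((i * a) %% p)%N; first by rewrite ltn_pmod // prime_gt0.
by rewrite modnMml -mulnA e mulnDr muln1 mulnA -modnDml modnMl add0n.
Qed.

Lemma exp_mod_ppow (Omega : fieldType) (p : nat) (K : Omega -> Prop) (y : Omega) (i j : nat) :
  is_subfield K -> K y -> y != 0 -> (i = j %[mod p])%N ->
  exists s, [/\ K s, s != 0 & y ^+ i = y ^+ j * s ^+ p].
Proof.
move=> K_fld Ky y0 e; exists (y ^+ (i %/ p) / y ^+ (j %/ p)).
rewrite mulf_neq0 ?invr_eq0 ?expf_neq0 //; split=> //.
  by apply: fld_div => //; apply: fldX.
rewrite {1}(divn_eq i p) {1}(divn_eq j p) e !exprD !exprM expr_div_n.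
by field; rewrite !expf_neq0.
Qed.

(** * Valued rigid fields are rigid *)

Section ValuedRigid.
Variables (Omega : closedFieldType) (p : nat) (zeta : Omega) (O : Omega -> Prop).
Hypotheses (p_pr : prime p) (p_odd : odd p) (zeta_prim : p.-primitive_root zeta)
  (O_val : valuation_ring O).
Local Notation M := (nonunit O).
Let p_gt0 : (0 < p)%N := prime_gt0 p_pr.

Definition val_unit_in (K : Omega -> Prop) u := [/\ K u, u != 0, O u & O u^-1].

Lemma val_unitM K u v : is_subfield K ->
  val_unit_in K u -> val_unit_in K v -> val_unit_in K (u * v).
Proof.
move=> K_fld [Ku u0 Ou OuV] [Kv v0 Ov OvV]; split; rewrite ?mulf_neq0 //.
- exact: fldM.
- exact: (valM O_val).
- by rewrite invfM; apply: (valM O_val).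
Qed.

Lemma val_unitV K u : is_subfield K -> val_unit_in K u -> val_unit_in K u^-1.
Proof.
by move=> K_fld [Ku u0 Ou OuV]; split; rewrite ?invr_eq0 ?invrK //; apply: fldV.
Qed.

Lemma val_unitX K u n : is_subfield K -> val_unit_in K u -> val_unit_in K (u ^+ n).
Proof.
move=> K_fld [Ku u0 Ou OuV]; split; rewrite ?expf_neq0 -?exprVn //.
- exact: fldX.
- exact: (valX O_val).
- exact: (valX O_val).
Qed.

Lemma val_unit_root (K : Omega -> Prop) u v : K v -> val_unit_in K u -> v ^+ p = u -> val_unit_in K v.
Proof.
move=> Kv [_ u0 Ou OuV] e; split=> //.
- by apply: contra_neq u0 => v0; rewrite -e v0 expr0n gtn_eqF.
- by apply: (val_root O_val p_gt0); rewrite e.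
- by apply: (val_root O_val p_gt0); rewrite exprVn e.
Qed.

(** Says that the value of a is divisible by p in the value group of K; it separates the unramified
    from the ramified p-th roots. *)
Definition unit_class (K : Omega -> Prop) a :=
  exists u t, [/\ val_unit_in K u, K t, t != 0 & a = u * t ^+ p].

Lemma unit_class_coprime K a n : is_subfield K -> K a -> a != 0 -> ~~ (p %| n)%N ->
  unit_class K (a ^+ n) -> unit_class K a.
Proof.
move=> K_fld Ka a0 nn [u [t [uu Kt t0 e]]].
have [k _ ek] := modn_solve 1 p_pr nn.
have [s [Ks s0 es]] := exp_mod_ppow K_fld Ka a0 ek.
exists (u ^+ k), (t ^+ k / s); split.
- exact: val_unitX.
- by apply: fld_div => //; apply: fldX.
- by rewrite mulf_neq0 ?invr_eq0 ?expf_neq0.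
rewrite expr_div_n mulrA; apply: (canRL (mulfK _)); first by rewrite expf_neq0.
by rewrite -{1}[a]expr1 -es mulnC exprM e exprMn -!exprM (mulnC k p).
Qed.

Lemma zeta_unit k : O (zeta ^+ k) /\ O (zeta ^+ k)^-1.
Proof.
have h x : x ^+ p = 1 -> O x.
  by move=> e; apply: (val_root O_val p_gt0); rewrite e; apply: (vring1 O_val).
have e : (zeta ^+ k) ^+ p = 1 by rewrite exprAC (prim_expr_order zeta_prim) expr1n.
by split; apply: h; rewrite ?exprVn e ?invr1.
Qed.

Section Extension.
Variables (K : Omega -> Prop).
Hypotheses (K_fld : is_subfield K) (Kzeta : K zeta) (K_val : valued_rigid p O K).
Let K_hens := K_val.1.
Variables (b : Omega).
Hypotheses (Kb : K b) (b0 : b != 0) (b_nppow : ~ is_ppow p K b).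

(** Divide q by a coefficient of largest absolute value. One coefficient of g is then 1, so by
    [unramified] its value at a p-th root of u cannot be a nonunit. *)
Lemma unramified_factor u (q : {poly Omega}) : val_unit_in K u -> ~ is_ppow p K u ->
  poly_in K q -> (size q <= p)%N -> q != 0 ->
  exists d g, [/\ K d, d != 0, q = d *: g, poly_in K g /\ poly_in O g &
    forall v, v ^+ p = u -> [/\ g.[v] != 0, O g.[v] & O g.[v]^-1]].
Proof.
move=> [Ku u0 Ou OuV] nu Kq sq q0.
have [|i [hi qi0 max]] := @val_max _ O O_val p (fun i => q`_i).
  exists (size q).-1; first by rewrite (leq_trans _ sq) // prednK // size_poly_gt0.
  by rewrite -lead_coefE lead_coef_eq0.
have Kg : poly_in K ((q`_i)^-1 *: q).
  by apply: (poly_inZ (subfield_subring K_fld)) => //; apply: fldV.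
have Og : poly_in O ((q`_i)^-1 *: q).
  move=> j; rewrite coefZ mulrC; have [/max//|h] := ltnP j p.
  by rewrite (leq_sizeP _ _ sq j h) mul0r; apply: (vring0 O_val).
exists q`_i, ((q`_i)^-1 *: q); split=> //; first by rewrite scalerA divff // scale1r.
move=> v ev; have Ov : O v by apply: (val_root O_val p_gt0); rewrite ev.
have Ogv : O ((q`_i)^-1 *: q).[v] by apply: (poly_in_horner (valuation_subring O_val)).
have nM : ~ M ((q`_i)^-1 *: q).[v].
  move/(unramified p_pr K_fld O_val K_hens Ku u0 Ou OuV nu ev Kg Og).
  rewrite (leq_trans (size_scale_leq _ _)) // => /(_ isT i).
  by rewrite coefZ mulVf //; apply: nonunit1.
by have [h1 h2] := val_unit Ogv nM.
Qed.

(** Two nonzero terms q_j beta^j and q_l beta^l of equal value would make b^(l-j), hence b, a unit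
    times a p-th power. So one term dominates, and it does so in all conjugates because zeta is a
    unit. *)
Lemma ramified_dominant beta (q : {poly Omega}) : ~ unit_class K b -> beta ^+ p = b ->
  poly_in K q -> (size q <= p)%N -> q != 0 ->
  exists2 i, (i < p)%N /\ q`_i != 0 &
    forall k, M (q.[zeta ^+ k * beta] / (zeta ^+ (i * k) * (q`_i * beta ^+ i)) - 1).
Proof.
move=> nb eb Kq sq q0.
have beta0 : beta != 0 by apply: contra_neq b0 => h; rewrite -eb h expr0n gtn_eqF.
pose T i := q`_i * beta ^+ i.
have [|i [hi Ti0 max]] := @val_max _ O O_val p T.
  exists (size q).-1; first by rewrite (leq_trans _ sq) // prednK // size_poly_gt0.
  by rewrite mulf_neq0 ?expf_neq0 // -lead_coefE lead_coef_eq0.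
have qi0 : q`_i != 0 by apply: contra_neq Ti0 => e; rewrite /T e mul0r.
have key j l : (j < l < p)%N -> q`_j != 0 -> q`_l != 0 ->
    O (T j / T l) -> O (T l / T j) -> False.
  move=> /andP[jl lp] qj0 ql0 O1 O2; apply: nb.
  apply: (unit_class_coprime (n := l - j) K_fld Kb b0).
    by rewrite gtnNdvd ?subn_gt0 //; lia.
  have eT : (T l / T j) ^+ p = q`_l ^+ p * b ^+ (l - j) / q`_j ^+ p.
    have hbeta : beta ^+ l = beta ^+ (l - j) * beta ^+ j by rewrite -exprD subnK // ltnW.
    have -> : T l / T j = q`_l * beta ^+ (l - j) / q`_j.
      by rewrite /T hbeta; field; rewrite qj0 expf_neq0.
    by rewrite expr_div_n exprMn exprAC eb.
  exists ((T l / T j) ^+ p), (q`_j / q`_l); split.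
  - split; first by rewrite eT; apply: fld_div => //; [apply: fldM => //|]; apply: fldX.
    + by rewrite eT !mulf_neq0 ?invr_eq0 ?expf_neq0.
    + exact: (valX O_val).
    + by rewrite -exprVn invf_div; apply: (valX O_val).
  - exact: fld_div.
  - by rewrite mulf_neq0 ?invr_eq0.
  by rewrite eT expr_div_n; field; rewrite !expf_neq0.
have small j : (j < p)%N -> j != i -> M (T j / T i).
  move=> hj ji; apply: contrapT => nM; have Oji := max j hj.
  have [r0 OV] := val_unit Oji nM; rewrite invf_div in OV.
  have qj0 : q`_j != 0 by apply: contra_neq r0 => e; rewrite /T e !mul0r.
  by case: (ltngtP j i) ji => [lt _|gt _|//]; [apply: (key j i) | apply: (key i j)] => //; apply/andP.
exists i => // k.
have zk0 n : zeta ^+ n != 0 by rewrite expf_neq0 // (prim_root_eq0 zeta_prim) gtn_eqF.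
rewrite (horner_coef_wide _ sq) (bigD1 (Ordinal hi)) //=.
have -> : q`_i * (zeta ^+ k * beta) ^+ i = zeta ^+ (i * k) * (q`_i * beta ^+ i).
  by rewrite exprMn -exprM mulnC mulrCA.
have nz : zeta ^+ (i * k) * T i != 0 by rewrite mulf_neq0 ?zk0.
rewrite -/(T i) mulrDl (divff nz) addrAC subrr add0r mulr_suml.
apply: (nonunit_sum O_val) => // j ji.
have -> : q`_j * (zeta ^+ k * beta) ^+ j / (zeta ^+ (i * k) * T i) =
   (zeta ^+ (k * j) * (zeta ^+ (i * k))^-1) * (T j / T i).
  have -> : q`_j * (zeta ^+ k * beta) ^+ j = zeta ^+ (k * j) * T j.
    by rewrite exprMn -exprM mulrCA.
  by field; rewrite Ti0 zk0.
apply: (nonunitM O_val) => //; last exact: small.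
by apply: (valM O_val) => //; [case: (zeta_unit (k * j)) | case: (zeta_unit (i * k))].
Qed.

(** Modulo p-th powers b is y0^j, with j prime to p because b is no p-th power; so b generates the
    same cyclic group as y0. *)
Lemma valued_unit_class u : unit_class K b -> val_unit_in K u ->
  exists k s, [/\ (k < p)%N, K s, s != 0 & u = b ^+ k * s ^+ p].
Proof.
move=> [v [t [uv Kt t0 eb]]] [Ku u0 Ou OuV].
have [_ [y0 [Ky0 y00 cyc]]] := K_val.
have [i [r [Kr r0 er]]] := cyc u Ku u0 Ou OuV.
have [Kv v0 Ov OvV] := uv.
have [j [w [Kw w0 ew]]] := cyc v Kv v0 Ov OvV.
have nj : ~~ (p %| j)%N.
  apply/negP=> /dvdnP[m ej]; apply: b_nppow; rewrite eb ew ej exprM -!exprMn.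
  apply: is_ppow_exp; last by rewrite !mulf_neq0 ?expf_neq0.
  by do 2 apply: fldM => //; apply: fldX.
have [k kp ek] := modn_solve i p_pr nj.
have [s [Ks s0 es]] := exp_mod_ppow K_fld Ky0 y00 (esym ek).
exists k, (s * r / (w * t) ^+ k); split=> //.
- apply: fld_div => //; first exact: fldM.
  by apply: fldX => //; apply: fldM.
- by rewrite !mulf_neq0 ?invr_eq0 ?expf_neq0 ?mulf_neq0.
rewrite er es eb ew !expr_div_n !exprMn -!exprM (mulnC j) !(mulnC p).
by field; rewrite !expf_neq0.
Qed.

Lemma valued_conj_norm beta (q : {poly Omega}) : beta ^+ p = b ->
  poly_in K q -> (size q <= p)%N -> q != 0 ->
  exists k s, [/\ (k < p)%N, K s, s != 0 & conj_norm p zeta beta q = b ^+ k * s ^+ p].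
Proof.
move=> eb Kq sq q0.
have KN := conj_norm_in p_pr zeta_prim K_fld Kzeta Kb eb Kq.
have [hb|nb] := pselect (unit_class K b); last first.
  have [i [ip qi0] dom] := ramified_dominant nb eb Kq sq q0.
  have /(nonunit_prod_sub1 O_val (index_enum 'I_p)) := fun k : 'I_p => dom k.
  rewrite prodf_div -/(conj_norm p zeta beta q) big_split /=.
  rewrite (eq_bigr (fun k : 'I_p => (zeta ^+ k) ^+ i)); last by move=> k _; rewrite mulnC exprM.
  rewrite prodrXl (prod_zeta_powers p_pr p_odd zeta_prim) expr1n mul1r prodr_const card_ord.
  rewrite exprMn exprAC eb => Mq.
  have d0 : q`_i ^+ p * b ^+ i != 0 by rewrite mulf_neq0 ?expf_neq0.
  have [|s [Ks s0 es]] := K_hens _ Mq.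
    by apply: fld_div => //; apply: fldM => //; apply: fldX.
  exists i, (q`_i * s); split=> //; first exact: fldM.
    by rewrite mulf_neq0.
  by rewrite -[LHS](divfK d0) es exprMn; ring.
have [u [t [uu Kt t0 ebt]]] := hb.
have nu : ~ is_ppow p K u.
  by move=> hu; apply: b_nppow; rewrite ebt; apply: is_ppowM => //; apply: is_ppow_exp.
(* Rescaling replaces beta by beta/t, a p-th root of the unit u. *)
pose q' := q \Po (t *: 'X).
have Kq' : poly_in K q' by move=> i; rewrite coef_comp_scaleX; apply: fldM => //; apply: fldX.
have sq' : (size q' <= p)%N by rewrite /q' comp_scaleXE (leq_trans (size_poly _ _)).
have q'0 : q' != 0.
  apply: contra_neq q0 => h; apply/polyP => i; rewrite coef0.
  have /eqP := congr1 (fun f : {poly Omega} => f`_i) h.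
  by rewrite coef_comp_scaleX coef0 mulf_eq0 expf_eq0 (negPf t0) andbF orbF => /eqP.
have [d [g [Kd d0 eq' [Kg Og] gu]]] := unramified_factor uu nu Kq' sq' q'0.
have root k : (zeta ^+ k * (beta / t)) ^+ p = u.
  by rewrite (zetaX_root zeta_prim) expr_div_n eb ebt mulfK // expf_neq0.
have eN : conj_norm p zeta beta q = d ^+ p * \prod_(k < p) g.[zeta ^+ k * (beta / t)].
  rewrite -[p in d ^+ p]card_ord -prodr_const -big_split; apply: eq_bigr => k _ /=.
  by rewrite -hornerZ -eq' horner_comp_scaleX; congr (_.[_]); field.
set w := \prod_(k < p) _ in eN.
have uw : val_unit_in K w.
  split.
  - have -> : w = conj_norm p zeta beta q / d ^+ p by rewrite eN mulrC mulKf // expf_neq0.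
    by apply: fld_div => //; apply: fldX.
  - by apply/prodf_neq0 => k _; case: (gu _ (root k)).
  - by apply: (subring_prod (valuation_subring O_val)) => k _; case: (gu _ (root k)).
  - rewrite -prodfV; apply: (subring_prod (valuation_subring O_val)) => k _.
    by case: (gu _ (root k)).
have [k [s [kp Ks s0 es]]] := valued_unit_class hb uw.
exists k, (d * s); split=> //; first exact: fldM.
  by rewrite mulf_neq0.
by rewrite eN es exprMn mulrCA.
Qed.

End Extension.

Theorem valued_rigid_rigid K : is_subfield K -> K zeta -> valued_rigid p O K -> p_rigid p K.
Proof.
move=> K_fld Kzeta K_val b Kb b0 nb beta eb y c Ly y0 N.
have [q Kq [sq ey]] := (adjoinP p_pr zeta_prim K_fld Kzeta Kb b0 nb eb y).1 Ly.
have q0 : q != 0 by apply: contra_neq y0 => q0; rewrite ey q0 horner0.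
rewrite ey in N; rewrite (is_norm_conj p_pr zeta_prim K_fld Kzeta Kb b0 nb eb Kq N).
have [k [s [kp Ks s0 es]]] := valued_conj_norm K_fld Kzeta K_val Kb b0 nb eb Kq sq q0.
by exists k; split=> //; exists s.
Qed.

End ValuedRigid.

Lemma adjoin_mul (Omega : fieldType) (K : Omega -> Prop) (b t : Omega) :
  is_subfield K -> K t -> t != 0 -> adjoin K (b * t) = adjoin K b.
Proof.
move=> K_fld Kt t0.
have sub x y : adjoin K x y -> sub_fld (adjoin K y) (adjoin K x).
  by move=> h; apply: adjoin_min; [apply: adjoin_fld | apply: adjoin_sub | ].
have Lt x : adjoin K x t by apply: adjoin_sub.
apply/funext => x; apply/propext; split; apply: sub.
  by apply: (fldM (adjoin_fld K b)) => //; apply: adjoin_gen.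
have -> : b = b * t / t by rewrite mulfK.
rewrite mulfK //; have e : b = (b * t) / t by rewrite mulfK.
by rewrite {2}e; apply: (fld_div (adjoin_fld K (b * t))) => //; apply: adjoin_gen.
Qed.

(** * Ascent along one Kummer extension *)

Section Ascent.
Variables (Omega : closedFieldType) (p : nat) (zeta : Omega) (O F : Omega -> Prop).
Hypotheses (p_pr : prime p) (p_odd : odd p) (zeta_prim : p.-primitive_root zeta)
  (O_val : valuation_ring O) (F_fld : is_subfield F) (Fzeta : F zeta)
  (F_val : valued_rigid p O F).
Local Notation M := (nonunit O).
Let p_gt0 : (0 < p)%N := prime_gt0 p_pr.
Let F_rigid : p_rigid p F := valued_rigid_rigid p_pr p_odd zeta_prim O_val F_fld Fzeta F_val.
Let F_hens := F_val.1.

Section Nontrivial.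
Variables (a alpha : Omega).
Hypotheses (Fa : F a) (a0 : a != 0) (a_nppow : ~ is_ppow p F a) (alpha_root : alpha ^+ p = a).
Local Notation L := (adjoin F alpha).
Let L_fld : is_subfield L := adjoin_fld F alpha.

Lemma adjoin_size_poly x : L x -> x != 0 ->
  exists q, [/\ poly_in F q, (size q <= p)%N, q != 0 & x = q.[alpha]].
Proof.
move/(adjoinP p_pr zeta_prim F_fld Fzeta Fa a0 a_nppow alpha_root) => [q Fq [sq ->]] q0.
by exists q; split=> //; apply: contra_neq q0 => ->; rewrite horner0.
Qed.

Lemma generated_mod x : L x -> x != 0 ->
  exists i f z, [/\ (i < p)%N, F f, f != 0, L z & z != 0 /\ x = alpha ^+ i * f * z ^+ p].
Proof.
have [sigma hs] := kummer_conj_ex p_pr zeta_prim F_fld Fzeta Fa a0 a_nppow alpha_root.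
exact: (kummer_generated_mod p_pr p_odd zeta_prim F_fld Fzeta Fa a0 a_nppow
          alpha_root hs (F_rigid Fa a0 a_nppow)).
Qed.

Lemma is_ppow_adjoin x : is_ppow p F x -> is_ppow p L x.
Proof. by move=> [t [Ft t0 ->]]; exists t; split=> //; apply: adjoin_sub. Qed.

(** Every element of L is a monomial d alpha^j times some w in 1 + M. Hence a unit of L is a unit of
    F times a p-th power w^p of this kind, and both properties are inherited from F. *)
Lemma ramified_ascent : ~ unit_class p O F a -> valued_rigid p O L.
Proof.
move=> na; have Lalpha : L alpha by apply: adjoin_gen.
have key x : L x -> x != 0 -> O x -> O x^-1 ->
    exists f w, [/\ val_unit_in O F f, L w, w != 0, M (w - 1) & x = f * w ^+ p].
  move=> Lx x0 Ox OxV; have [i [f [z [ip Ff f0 Lz [z0 ex]]]]] := generated_mod Lx x0.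
  have [q [Fq sq q0 ez]] := adjoin_size_poly Lz z0.
  have [j [jp qj0] dom] := ramified_dominant p_pr p_odd zeta_prim O_val F_fld Fa a0 na alpha_root Fq sq q0.
  have := dom 0%N; rewrite muln0 !expr0 !mul1r -ez => Mw.
  set d := q`_j in qj0 Mw; set w := z / (d * alpha ^+ j) in Mw.
  have Fd : F d by apply: Fq.
  have c0 : d * alpha ^+ j != 0.
    by rewrite mulf_neq0 // expf_neq0 //; apply: contra_neq a0 => h; rewrite -alpha_root h expr0n gtn_eqF.
  have [w0 Ow OwV] := nonunit_sub1_unit O_val Mw.
  have Lw : L w.
    apply: (fld_div L_fld) => //; apply: (fldM L_fld); last exact: (fldX L_fld).
    exact: adjoin_sub.
  pose f' := f * (d ^+ p * a ^+ j).
  have Ff' : F f' by apply: fldM => //; apply: fldM => //; apply: fldX.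
  have ex' : x = alpha ^+ i * f' * w ^+ p.
    rewrite ex /w expr_div_n exprMn exprAC alpha_root /f'.
    by field; rewrite !expf_neq0.
  have uaf : val_unit_in O L (alpha ^+ i * f').
    have wp0 : w ^+ p != 0 by rewrite expf_neq0.
    have e : alpha ^+ i * f' = x * (w^-1) ^+ p by rewrite ex' exprVn mulfK.
    have ux : val_unit_in O L x by [].
    have uw : val_unit_in O L w by [].
    rewrite e; apply: (val_unitM O_val) => //; apply: (val_unitX O_val) => //.
    exact: val_unitV.
  (* For i > 0 the p-th power a^i f'^p of the unit alpha^i f' would give a, up to p-th powers, the
     class of a unit. *)
  have i0 : i = 0%N.
    apply: contrapT => /eqP; rewrite -lt0n => i0; apply: na.
    apply: (unit_class_coprime p_pr O_val (n := i) F_fld Fa a0); first by rewrite gtnNdvd.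
    have f'0 : f' != 0 by have [_ + _ _] := uaf; rewrite mulf_eq0 negb_or => /andP[].
    exists ((alpha ^+ i * f') ^+ p), f'^-1; split.
    - have [_ h1 h2 h3] := val_unitX O_val p L_fld uaf; split=> //.
      by rewrite exprMn exprAC alpha_root; apply: fldM => //; apply: fldX.
    - exact: fldV.
    - by rewrite invr_eq0.
    by rewrite exprMn exprAC alpha_root exprVn mulfK // expf_neq0.
  rewrite i0 expr0 mul1r in ex' uaf; exists f', w; split=> //.
  by have [_ h1 h2 h3] := uaf; split.
split=> [x Lx Mx|].
  have [x0 Ox OxV] := nonunit_sub1_unit O_val Mx.
  have [f [w [[Ff f0 Of OfV] Lw w0 Mw ex]]] := key x Lx x0 Ox OxV.
  rewrite ex; apply: (is_ppowM L_fld); last exact: is_ppow_exp.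
  apply/is_ppow_adjoin/F_hens => //.
  have -> : f = x / w ^+ p by rewrite ex mulfK // expf_neq0.
  by apply: (nonunit_div_sub1 O_val) => //; apply: (nonunitX_sub1 O_val).
have [_ [y0 [Fy0 y00 cyc]]] := F_val; exists y0; split=> //; first exact: adjoin_sub.
move=> x Lx x0 Ox OxV; have [f [w [[Ff f0 Of OfV] Lw w0 Mw ex]]] := key x Lx x0 Ox OxV.
have [i [t [Ft t0 et]]] := cyc f Ff f0 Of OfV.
exists i, (t * w); rewrite mulf_neq0 //; split=> //; last by rewrite ex et exprMn mulrA.
by apply: (fldM L_fld) => //; apply: adjoin_sub.
Qed.

(** The units of F are powers of a, hence p-th powers in L, up to p-th powers of F; so each unit of
    L is alpha^i w^p. If it lies in 1 + M, then so does its norm a^i N(w)^p; that norm is a p-th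
    power in F, and a not being one forces i = 0. *)
Lemma unramified_ascent : val_unit_in O F a -> valued_rigid p O L.
Proof.
move=> ua; have Lalpha : L alpha by apply: adjoin_gen.
have ualpha : val_unit_in O L alpha.
  apply: (val_unit_root p_pr O_val (u := a)) => //.
  by have [_ h1 h2 h3] := ua; split=> //; apply: adjoin_sub.
have ca : unit_class p O F a.
  by exists a, 1; rewrite expr1n mulr1 oner_neq0; split=> //; apply: fld1.
have key x : L x -> x != 0 -> O x -> O x^-1 ->
    exists i w, [/\ (i < p)%N, val_unit_in O L w & x = alpha ^+ i * w ^+ p].
  move=> Lx x0 Ox OxV; have [i [f [z [ip Ff f0 Lz [z0 ex]]]]] := generated_mod Lx x0.
  have [q [Fq sq q0 ez]] := adjoin_size_poly Lz z0.
  have [d [g [Fd d0 eq [Fg Og] gu]]] := unramified_factor p_pr O_val F_fld F_val ua a_nppow Fq sq q0.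
  have [g0 Og' OgV] := gu _ alpha_root.
  have Lg : L g.[alpha] by apply: adjoin_horner.
  have ug : val_unit_in O L g.[alpha] by split.
  have ezg : z = d * g.[alpha] by rewrite ez eq hornerZ.
  have ex' : x = alpha ^+ i * (f * d ^+ p) * g.[alpha] ^+ p by rewrite ex ezg exprMn; ring.
  have uf : val_unit_in O F (f * d ^+ p).
    have Ffd : F (f * d ^+ p) by apply: fldM => //; apply: fldX.
    have ux : val_unit_in O L x by [].
    have e : f * d ^+ p = x * (alpha^-1) ^+ i * (g.[alpha]^-1) ^+ p.
      rewrite ex' !exprVn; field; rewrite !expf_neq0 //; by case: ualpha.
    have : val_unit_in O L (f * d ^+ p).
      rewrite e; apply: (val_unitM O_val) => //; first apply: (val_unitM O_val) => //.
        by apply: (val_unitX O_val) => //; apply: val_unitV.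
      by apply: (val_unitX O_val) => //; apply: val_unitV.
    by case=> _ h1 h2 h3; split.
  have [k [s [kp Fs s0 es]]] := valued_unit_class p_pr F_fld F_val a_nppow ca uf.
  have Ls : L s by apply: adjoin_sub.
  exists i, (alpha ^+ k * s * g.[alpha]).
  have ew : x = alpha ^+ i * (alpha ^+ k * s * g.[alpha]) ^+ p.
    by rewrite ex' es !exprMn (exprAC alpha) alpha_root; ring.
  have Lw : L (alpha ^+ k * s * g.[alpha]).
    by apply: (fldM L_fld) => //; apply: (fldM L_fld) => //; apply: (fldX L_fld).
  split=> //; apply: (val_unit_root p_pr O_val Lw (u := x * (alpha^-1) ^+ i)).
    by apply: (val_unitM O_val) => //; apply: (val_unitX O_val) => //; apply: val_unitV.
  by rewrite ew [RHS]mulrAC exprVn mulfV ?mul1r // expf_neq0 //; case: ualpha.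
split=> [x Lx Mx|].
  have [x0 Ox OxV] := nonunit_sub1_unit O_val Mx.
  have [i [w [ip [Lw w0 Ow OwV] ex]]] := key x Lx x0 Ox OxV.
  have [i0|i0] := posnP i; first by rewrite ex i0 mul1r; apply: is_ppow_exp.
  case: a_nppow; apply: (is_ppow_coprime F_fld (d := i)) => //; first by rewrite gtnNdvd.
  have [sigma hs] := kummer_conj_ex p_pr zeta_prim F_fld Fzeta Fa a0 a_nppow alpha_root.
  pose N y := sigma_norm p sigma y.
  have NF y : L y -> F (N y).
    move/(adjoin_poly p_pr zeta_prim F_fld Fzeta Fa a0 a_nppow alpha_root) => [q Fq ->].
    rewrite /N (sigma_norm_horner p F_fld Fzeta hs Fq).
    exact: (conj_norm_in p_pr zeta_prim F_fld Fzeta Fa alpha_root).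
  have NM y z : L y -> L z -> N (y * z) = N y * N z.
    exact: (sigma_normM p_pr zeta_prim F_fld Fzeta Fa a0 a_nppow alpha_root hs).
  have NX y n : L y -> N (y ^+ n) = N y ^+ n.
    move=> Ly; elim: n => [|n IH].
      by rewrite !expr0 /N (sigma_norm_id _ F_fld hs (fld1 F_fld)) expr1n.
    by rewrite !exprS NM ?IH //; apply: (fldX L_fld).
  have Na : N alpha = a by apply: (sigma_norm_beta p_pr p_odd zeta_prim F_fld Fzeta alpha_root hs).
  (* Writing x - 1 = d g(alpha) with g(alpha) a unit shows d in M, so all conjugates of x - 1 lie in
     M too. *)
  have MN : M (N x - 1).
    have [x1|x1] := eqVneq (x - 1) 0.
      have -> : x = 1 by apply/eqP; rewrite -subr_eq0 x1.
      by rewrite /N (sigma_norm_id _ F_fld hs (fld1 F_fld)) expr1n subrr; left.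
    have Lx1 : L (x - 1) by apply: (fldB L_fld) => //; apply: (fld1 L_fld).
    have [q [Fq sq q0 eq]] := adjoin_size_poly Lx1 x1.
    have [d [g [Fd d0 edg [Fg Og] gu]]] := unramified_factor p_pr O_val F_fld F_val ua a_nppow Fq sq q0.
    have Md : M d.
      have [g0 Og' OgV] := gu _ alpha_root.
      have -> : d = (x - 1) * g.[alpha]^-1 by rewrite eq edg hornerZ mulfK.
      exact: (nonunitMr O_val).
    have ex1 : x = (1%:P + q).[alpha] by rewrite hornerD hornerC -eq addrC subrK.
    have F1q : poly_in F (1%:P + q).
      have F_ring := subfield_subring F_fld.
      by apply: (poly_inD F_ring) => //; apply: (poly_inC F_ring); apply: fld1.
    rewrite ex1 /N (sigma_norm_horner p F_fld Fzeta hs F1q).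
    apply: (nonunit_prod_sub1 O_val) => k.
    rewrite hornerD hornerC addrAC subrr add0r edg hornerZ; apply: (nonunitMr O_val) => //.
    by have [] := gu (zeta ^+ k * alpha) (etrans (zetaX_root zeta_prim _ _) alpha_root).
  have Nw0 : N w != 0.
    apply/prodf_neq0 => k _.
    elim: (k : nat) => // l IHl; rewrite iterS.
    apply: (sigma_neq0 p_pr zeta_prim F_fld Fzeta Fa a0 a_nppow alpha_root hs) => //.
    exact: (iter_sigma_in p_pr zeta_prim F_fld Fzeta Fa a0 a_nppow alpha_root hs).
  have -> : a ^+ i = N x * (N w ^+ p)^-1.
    rewrite ex NM ?NX ?Na ?mulfK ?expf_neq0 //; exact: (fldX L_fld).
  apply: is_ppowM => //; first by apply: F_hens => //; apply: NF.
  by apply: is_ppowV => //; apply: is_ppow_exp => //; apply: NF.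
exists alpha; split=> //; first by case: ualpha.
move=> x Lx x0 Ox OxV; have [i [w [ip [Lw w0 Ow OwV] ex]]] := key x Lx x0 Ox OxV.
by exists i, w.
Qed.

End Nontrivial.

(** If a = u t^p with u a unit, alpha/t generates the same field and is a p-th root of u. *)
Theorem valued_rigid_adjoin a alpha : F a -> a != 0 -> alpha ^+ p = a ->
  valued_rigid p O (adjoin F alpha).
Proof.
move=> Fa a0 ea; have [[x [Fx x0 ex]]|na] := pselect (is_ppow p F a).
  have [k _ ek] := root_ratio zeta_prim x0 (etrans ea ex).
  by rewrite adjoin_id // ek; apply: fldM => //; apply: fldX.
have [[u [t [uu Ft t0 eu]]]|] := pselect (unit_class p O F a); last first.
  exact: ramified_ascent na ea.
have tV0 : t^-1 != 0 by rewrite invr_eq0.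
rewrite -(adjoin_mul alpha F_fld (fldV F_fld Ft) tV0).
have [Fu u0 _ _] := uu.
apply: (unramified_ascent Fu u0) => //.
  by move=> hu; apply: na; rewrite eu; apply: is_ppowM => //; apply: is_ppow_exp.
by rewrite expr_div_n ea eu mulfK // expf_neq0.
Qed.

End Ascent.

(** * Radical towers *)

Section RadicalTowers.
Variables (Omega : fieldType) (p : nat).
Implicit Types (K L : Omega -> Prop) (s : seq Omega).

Fixpoint adjoin_seq K s : Omega -> Prop :=
  if s is beta :: s' then adjoin_seq (adjoin K beta) s' else K.

Fixpoint radical_seq K s : Prop :=
  if s is beta :: s' then K (beta ^+ p) /\ radical_seq (adjoin K beta) s' else True.

Lemma adjoin_seq_fld K s : is_subfield K -> is_subfield (adjoin_seq K s).
Proof. by elim: s K => // b s IH K _; apply: IH; apply: adjoin_fld. Qed.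

Lemma adjoin_seq_sub K s : sub_fld K (adjoin_seq K s).
Proof. by elim: s K => [|b s IH] K x Kx //; apply: IH; apply: adjoin_sub. Qed.

Lemma adjoin_seq_gen K s x : x \in s -> adjoin_seq K s x.
Proof.
elim: s K => [|b s IH] K; first by rewrite in_nil.
rewrite inE => /orP[/eqP ->|]; last exact: IH.
by rewrite /=; apply: adjoin_seq_sub; apply: adjoin_gen.
Qed.

Lemma adjoin_seqS K L s : sub_fld K L -> sub_fld (adjoin_seq K s) (adjoin_seq L s).
Proof. by elim: s K L => [|b s IH] K L KL //; apply: IH; apply: adjoinS. Qed.

Lemma radical_seqS K L s : sub_fld K L -> radical_seq K s -> radical_seq L s.
Proof.
elim: s K L => // b s IH K L KL [Kb Rb]; split; first exact: KL.
by apply: IH Rb; apply: adjoinS.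
Qed.

Lemma adjoin_seq_cat K s t : adjoin_seq K (s ++ t) = adjoin_seq (adjoin_seq K s) t.
Proof. by elim: s K => //= b s IH K. Qed.

Lemma radical_seq_cat K s t :
  radical_seq K s -> radical_seq (adjoin_seq K s) t -> radical_seq K (s ++ t).
Proof. by elim: s K => //= b s IH K [Kb Rb] Rt; split=> //; apply: IH. Qed.

Definition radical_closure K x := exists s, radical_seq K s /\ adjoin_seq K s x.

(** Towers can be concatenated, as a radical tower over K remains one over any larger field. *)
Lemma radical_closure_seq K (l : seq Omega) : (forall x, x \in l -> radical_closure K x) ->
  exists s, radical_seq K s /\ forall x, x \in l -> adjoin_seq K s x.
Proof.
elim: l => [|y l IH] h; first by exists [::].
have [|s [Rs hs]] := IH; first by move=> x hx; apply: h; rewrite inE hx orbT.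
have [t [Rt ht]] := h y (mem_head y l).
have sub : sub_fld K (adjoin_seq K s) by apply: adjoin_seq_sub.
exists (s ++ t); split; first by apply: radical_seq_cat => //; apply: radical_seqS Rt.
move=> x; rewrite adjoin_seq_cat inE => /orP[/eqP ->|/hs hx]; first exact: adjoin_seqS ht.
exact: adjoin_seq_sub.
Qed.

Lemma radical_closure_sub K : sub_fld K (radical_closure K).
Proof. by move=> x Kx; exists [::]. Qed.

Lemma radical_closure_fld K : is_subfield K -> is_subfield (radical_closure K).
Proof.
move=> K_fld.
have two x y : radical_closure K x -> radical_closure K y -> exists s,
    [/\ radical_seq K s, is_subfield (adjoin_seq K s), adjoin_seq K s x & adjoin_seq K s y].
  move=> hx hy; have [|s [Rs hs]] := @radical_closure_seq K [:: x; y].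
    by move=> z; rewrite !inE => /orP[] /eqP ->.
  exists s; split=> //; first exact: adjoin_seq_fld.
    by apply: hs; rewrite !inE eqxx.
  by apply: hs; rewrite !inE eqxx orbT.
split.
- by apply: radical_closure_sub; apply: fld0.
- by apply: radical_closure_sub; apply: fld1.
- by move=> x y hx hy; have [s [Rs fs sx sy]] := two x y hx hy; exists s; split=> //; apply: fldB.
- by move=> x y hx hy; have [s [Rs fs sx sy]] := two x y hx hy; exists s; split=> //; apply: fldM.
- by move=> x hx; have [s [Rs fs sx _]] := two x x hx hx; exists s; split=> //; apply: fldV.
Qed.

Lemma radical_closure_root K x : radical_closure K (x ^+ p) -> radical_closure K x.
Proof.
move=> [s [Rs sx]]; exists (s ++ [:: x]); split; first exact: radical_seq_cat.
by rewrite adjoin_seq_cat; apply: adjoin_gen.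
Qed.

End RadicalTowers.

(** * Fields inside a radical tower *)

Section Descent.
Variables (Omega : closedFieldType) (p : nat) (zeta : Omega) (O : Omega -> Prop).
Hypotheses (p_pr : prime p) (p_odd : odd p) (zeta_prim : p.-primitive_root zeta)
  (O_val : valuation_ring O).
Let p_gt0 : (0 < p)%N := prime_gt0 p_pr.

Lemma valued_rigid_adjoin_root F alpha : is_subfield F -> F zeta -> valued_rigid p O F ->
  F (alpha ^+ p) -> valued_rigid p O (adjoin F alpha).
Proof.
move=> F_fld Fzeta F_val Fa; have [e|a0] := eqVneq (alpha ^+ p) 0.
  move/eqP: e; rewrite expf_eq0 p_gt0 => /eqP ->.
  by rewrite adjoin_id //; apply: fld0.
exact: (valued_rigid_adjoin p_pr p_odd zeta_prim O_val F_fld Fzeta F_val Fa a0).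
Qed.

Lemma valued_rigid_tower F s : is_subfield F -> F zeta -> valued_rigid p O F ->
  radical_seq p F s -> valued_rigid p O (adjoin_seq F s).
Proof.
elim: s F => // b s IH F F_fld Fzeta F_val [Fb Rs] /=.
apply: IH => //; [exact: adjoin_fld | exact: adjoin_sub | exact: valued_rigid_adjoin_root].
Qed.

(** Write x in K as q(alpha) with q over F of degree below p. Since alpha has degree p over K as
    well, q - x vanishes, and x = q_0 is in F. *)
Lemma adjoin_root_cap F K alpha : is_subfield F -> F zeta -> is_subfield K ->
  sub_fld F K -> ~ K alpha -> F (alpha ^+ p) -> sub_fld K (adjoin F alpha) -> F = K.
Proof.
move=> F_fld Fzeta K_fld FK nKa Fa Ka.
have Kzeta := FK _ Fzeta.
have a0 : alpha ^+ p != 0.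
  apply/eqP=> /eqP; rewrite expf_eq0 p_gt0 => /eqP e; apply: nKa; rewrite e.
  exact: fld0.
have nppow M : is_subfield M -> M zeta -> sub_fld M K -> ~ is_ppow p M (alpha ^+ p).
  move=> M_fld Mz MK [x [Mx x0 ex]]; apply: nKa.
  have [k _ ->] := root_ratio zeta_prim x0 ex.
  by apply: MK; apply: fldM => //; apply: fldX.
apply/funext => x; apply/propext; split=> [|Kx]; first exact: FK.
have nF := nppow F F_fld Fzeta FK.
have := (adjoinP p_pr zeta_prim F_fld Fzeta Fa a0 nF erefl x).1 (Ka x Kx).
move=> [q Fq [sq ex]].
have h : q - x%:P = 0.
  apply: (kummer_indep p_pr K_fld (FK _ Fa) a0 (nppow K K_fld Kzeta (fun _ => id)) erefl).
  - apply: poly_inB; first exact: subfield_subring.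
      by move=> i; apply: FK.
    by apply: poly_inC => //; apply: subfield_subring.
  - rewrite (leq_trans (size_polyD _ _)) // geq_max sq size_polyN.
    by rewrite (leq_trans (size_polyC_leq1 _)).
  - by rewrite hornerD hornerN hornerC -ex subrr.
have -> : x = q`_0 by move/eqP: h; rewrite subr_eq0 => /eqP ->; rewrite coefC.
exact: Fq.
Qed.

(* Let tau generate the Galois group of K(alpha)/K.  If phi^p = alpha^i f with
   0 < i < p, then mu = tau(phi)/phi has mu^p = zeta^i and tau(mu)/mu a p-th root
   of unity, whence tau^p(phi) = zeta^i phi, which is absurd. *)
Lemma no_second_root F K alpha phi i f : is_subfield F -> F zeta -> is_subfield K ->
  sub_fld F K -> ~ K alpha -> F (alpha ^+ p) -> F f -> phi != 0 -> (i < p)%N ->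
  adjoin K alpha phi -> phi ^+ p = alpha ^+ i * f ->
  i = 0%N /\ exists2 m, (m <= p)%N & K (phi * alpha ^+ m).
Proof.
move=> F_fld Fzeta K_fld FK nKa Fa Ff phi0 ip Lphi ephi.
have Kzeta := FK _ Fzeta; have Ka := FK _ Fa.
have alpha0 : alpha != 0 by apply/eqP=> e; apply: nKa; rewrite e; apply: fld0.
have a0 : alpha ^+ p != 0 by rewrite expf_neq0.
have na : ~ is_ppow p K (alpha ^+ p).
  move=> [x [Kx x0 ex]]; apply: nKa; have [k _ ->] := root_ratio zeta_prim x0 ex.
  by apply: fldM => //; apply: fldX.
have [tau ht] := kummer_conj_ex p_pr zeta_prim K_fld Kzeta Ka a0 na erefl.
pose L := adjoin K alpha; have L_fld : is_subfield L by apply: adjoin_fld.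
have Lalpha : L alpha by apply: adjoin_gen.
have KL x : K x -> L x by apply: adjoin_sub.
have tM x y : L x -> L y -> tau (x * y) = tau x * tau y.
  exact: (sigmaM p_pr zeta_prim K_fld Kzeta Ka a0 na erefl ht).
have tX x n : L x -> tau (x ^+ n) = tau x ^+ n.
  exact: (sigmaX p_pr zeta_prim K_fld Kzeta Ka a0 na erefl ht).
have tK x : K x -> tau x = x by apply: (sigma_id K_fld ht).
have tL x : L x -> L (tau x).
  exact: (sigma_in p_pr zeta_prim K_fld Kzeta Ka a0 na erefl ht).
have ta : tau alpha = zeta * alpha by apply: (sigma_beta K_fld ht).
have tp x : L x -> iter p tau x = x.
  exact: (iter_sigma_p p_pr zeta_prim K_fld Kzeta Ka a0 na erefl ht).
have z0 n : zeta ^+ n != 0 by rewrite expf_neq0 // (prim_root_eq0 zeta_prim) gtn_eqF.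
have Kzn n : K (zeta ^+ n) by apply: fldX.
pose mu := tau phi / phi.
have Lmu : L mu by apply: (fld_div L_fld) => //; apply: tL.
have emu : tau phi = mu * phi by rewrite /mu divfK.
have emup : mu ^+ p = zeta ^+ i.
  rewrite /mu expr_div_n -tX // ephi tM ?tX ?ta ?(tK f) ?exprMn //; try exact: FK.
  - have f0 : f != 0.
      by apply: contra_neq (expf_neq0 p phi0) => f0; rewrite ephi f0 mulr0.
    by field; rewrite f0 expf_neq0.
  - exact: (fldX L_fld).
  - by apply: KL; apply: FK.
have mu0 : mu != 0.
  by apply: contra_neq (z0 i) => e; rewrite -emup e expr0n gtn_eqF.
have [j _ ej] : exists2 j, (j < p)%N & tau mu = zeta ^+ j * mu.
  by apply: (root_ratio zeta_prim mu0); rewrite -tX // emup tK.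
have itmu k : iter k tau mu = zeta ^+ (k * j) * mu.
  elim: k => [|k IH]; first by rewrite mul0n mul1r.
  by rewrite iterS IH (tM _ _ (KL _ (Kzn _)) Lmu) (tK _ (Kzn _)) ej mulrA -exprD mulSn addnC.
have itphi k : iter k tau phi = \prod_(l < k) iter l tau mu * phi.
  elim: k => [|k IH]; first by rewrite big_ord0 mul1r.
  have Lit l : L (iter l tau mu) by elim: l => // l IHl; apply: tL.
  rewrite iterS IH tM //; last first.
    by apply: (subring_prod (subfield_subring L_fld)).
  rewrite emu mulrA; congr (_ * _).
  rewrite (sigma_prod p_pr zeta_prim K_fld Kzeta Ka a0 na erefl ht); last by move=> l; apply: Lit.
  by rewrite big_ord_recl mulrC.
have i0 : i = 0%N.
  have := tp phi Lphi; rewrite itphi -{2}[phi]mul1r => /(mulIf phi0).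
  under eq_bigr => l _ do rewrite itmu exprM.
  rewrite big_split /= prodrXl (prod_zeta_powers p_pr p_odd zeta_prim) expr1n mul1r.
  rewrite prodr_const card_ord emup => /eqP; rewrite -(prim_order_dvd zeta_prim).
  by case: (posnP i) => // i_gt0; rewrite gtnNdvd.
split=> //; rewrite i0 expr0 mul1r in ephi emup.
have [k kp ek] : exists2 k, (k < p)%N & tau phi = zeta ^+ k * phi.
  by apply: (root_ratio zeta_prim phi0); rewrite -tX // ephi tK //; apply: FK.
(* tau multiplies phi by zeta^k and alpha by zeta, so phi alpha^(p-k) is fixed. *)
exists (p - k)%N; first exact: leq_subr.
apply: (sigma_fixed p_pr zeta_prim K_fld Kzeta Ka a0 na erefl ht).
  by apply: (fldM L_fld) => //; apply: (fldX L_fld).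
rewrite tM //; last exact: (fldX L_fld).
rewrite tX // ek ta exprMn mulrACA -exprD subnKC ?(ltnW kp) //.
by rewrite (prim_expr_order zeta_prim) mul1r.
Qed.

(** The next generator beta has p-th power alpha^i f z^p. By [no_second_root], i = 0 and (beta/z)
    alpha^m lies in K for some m; this gam has its p-th power in F, and F(gam, alpha) contains
    F(alpha, beta). So F(gam) takes the place of F, with one generator fewer. *)
Lemma descent_step s F K alpha : is_subfield F -> F zeta -> valued_rigid p O F ->
  is_subfield K -> sub_fld F K -> ~ K alpha -> F (alpha ^+ p) ->
  radical_seq p (adjoin F alpha) s -> sub_fld K (adjoin_seq (adjoin F alpha) s) ->
  (forall x, x \in s -> adjoin K alpha x) ->
  exists2 t, radical_seq p F t & adjoin_seq F t = K.
Proof.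
elim: s F => [|beta s IH] F F_fld Fzeta F_val K_fld FK nKa Fa Rs Ks sK.
  exists [::] => //; exact: (adjoin_root_cap F_fld Fzeta K_fld FK nKa Fa Ks).
case: Rs => Lb Rs; rewrite /= in Ks.
have sK' x : x \in s -> adjoin K alpha x by move=> hx; apply: sK; rewrite inE hx orbT.
have L_fld : is_subfield (adjoin F alpha) by apply: adjoin_fld.
have [Lbeta|nLbeta] := pselect (adjoin F alpha beta).
  by rewrite adjoin_id // in Rs Ks; apply: IH.
have a0 : alpha ^+ p != 0.
  apply/eqP=> /eqP; rewrite expf_eq0 p_gt0 => /eqP e; apply: nKa; rewrite e.
  exact: fld0.
have beta0 : beta != 0 by apply/eqP=> e; apply: nLbeta; rewrite e; apply: fld0.
have na : ~ is_ppow p F (alpha ^+ p).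
  move=> [x [Fx x0 ex]]; apply: nKa; have [k _ ->] := root_ratio zeta_prim x0 ex.
  by apply: FK; apply: fldM => //; apply: fldX.
have [i [f [z [ip Ff f0 Lz [z0 eb]]]]] :=
  generated_mod p_pr p_odd zeta_prim O_val F_fld Fzeta F_val Fa a0 na erefl Lb (expf_neq0 p beta0).
pose phi := beta / z.
have ephi : phi ^+ p = alpha ^+ i * f by rewrite /phi expr_div_n eb mulfK // expf_neq0.
have phi0 : phi != 0 by rewrite mulf_neq0 ?invr_eq0.
have LK : sub_fld (adjoin F alpha) (adjoin K alpha) by apply: adjoinS.
have Lphi : adjoin K alpha phi.
  apply: (fld_div (adjoin_fld K alpha)); last exact: LK.
  by apply: sK; rewrite mem_head.
have [i0 [m mp Kphi]] := no_second_root F_fld Fzeta K_fld FK nKa Fa Ff phi0 ip Lphi ephi.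
rewrite i0 mul1r in ephi.
set gam := phi * alpha ^+ m in Kphi.
have Fgam : F (gam ^+ p) by rewrite exprMn ephi exprAC; apply: fldM => //; apply: fldX.
pose F' := adjoin F gam; have F'_fld : is_subfield F' by apply: adjoin_fld.
have FF' : sub_fld F F' by apply: adjoin_sub.
have F'K : sub_fld F' K by apply: adjoin_min.
have sub : sub_fld (adjoin (adjoin F alpha) beta) (adjoin F' alpha).
  have L'_fld : is_subfield (adjoin F' alpha) by apply: adjoin_fld.
  apply: adjoin_min => //; first exact: adjoinS.
  have alpha0 : alpha != 0 by apply: contra_neq a0 => ->; rewrite expr0n gtn_eqF.
  have -> : beta = gam / alpha ^+ m * z.
    by rewrite /gam mulfK ?expf_neq0 // /phi divfK.
  apply: (fldM L'_fld); last by apply: (adjoinS FF').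
  apply: (fld_div L'_fld); first by apply: adjoin_sub; apply: adjoin_gen.
  by apply: (fldX L'_fld); apply: adjoin_gen.
have F'_val : valued_rigid p O F' by apply: valued_rigid_adjoin_root.
have Rs' : radical_seq p (adjoin F' alpha) s by apply: radical_seqS Rs.
have Ks' : sub_fld K (adjoin_seq (adjoin F' alpha) s).
  by move=> x /Ks; apply: adjoin_seqS.
have [t Rt et] := IH F' F'_fld (FF' _ Fzeta) F'_val K_fld F'K nKa (FF' _ Fa) Rs' Ks' sK'.
by exists (gam :: t).
Qed.

(** If alpha is not in K, induction over F(alpha) first shows that K(alpha) is a tower over
    F(alpha). This provides the generators inside K(alpha) that [descent_step] asks for. *)
Theorem tower_descent s F K : is_subfield F -> F zeta -> valued_rigid p O F ->
  is_subfield K -> sub_fld F K -> radical_seq p F s -> sub_fld K (adjoin_seq F s) ->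
  exists2 t, radical_seq p F t & adjoin_seq F t = K.
Proof.
elim: s F K => [|alpha s IH] F K F_fld Fzeta F_val K_fld FK Rs Ks.
  exists [::] => //; apply/funext => x; apply/propext; split; [exact: FK | exact: Ks].
case: Rs => Fa Rs; rewrite /= in Ks.
have F1_fld : is_subfield (adjoin F alpha) by apply: adjoin_fld.
have F1zeta : adjoin F alpha zeta by apply: adjoin_sub.
have F1_val := valued_rigid_adjoin_root F_fld Fzeta F_val Fa.
have [Ka|nKa] := pselect (K alpha).
  have F1K : sub_fld (adjoin F alpha) K by apply: adjoin_min.
  have [t Rt et] := IH _ K F1_fld F1zeta F1_val K_fld F1K Rs Ks.
  by exists (alpha :: t).
have K1_fld : is_subfield (adjoin K alpha) by apply: adjoin_fld.
have F1K1 : sub_fld (adjoin F alpha) (adjoin K alpha) by apply: adjoinS.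
have K1s : sub_fld (adjoin K alpha) (adjoin_seq (adjoin F alpha) s).
  apply: adjoin_min => //; first exact: adjoin_seq_fld.
  by apply: adjoin_seq_sub; apply: adjoin_gen.
have [t Rt et] := IH _ _ F1_fld F1zeta F1_val K1_fld F1K1 Rs K1s.
apply: (descent_step (s := t) (alpha := alpha)) => //.
  by move=> x Kx; rewrite et; apply: adjoin_sub.
by move=> x hx; rewrite -et; apply: adjoin_seq_gen.
Qed.

(** One norm involves only b and the coefficients of q. They lie in the intersection K0 of K with a
    tower, which is itself a tower and hence valued rigid. *)
Theorem radical_closure_rigid F K : is_subfield F -> F zeta -> valued_rigid p O F ->
  is_subfield K -> sub_fld F K -> sub_fld K (radical_closure p F) -> p_rigid p K.
Proof.
move=> F_fld Fzeta F_val K_fld FK KR b Kb b0 nb beta eb y c Ly y0 N.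
have Kzeta := FK _ Fzeta.
have [q Kq [sq ey]] := (adjoinP p_pr zeta_prim K_fld Kzeta Kb b0 nb eb y).1 Ly.
have q0 : q != 0 by apply: contra_neq y0 => q0; rewrite ey q0 horner0.
rewrite ey in N; rewrite (is_norm_conj p_pr zeta_prim K_fld Kzeta Kb b0 nb eb Kq N).
have [|s [Rs hs]] := @radical_closure_seq _ p F (b :: q).
  move=> x; rewrite inE => /orP[/eqP ->|/(nthP 0)[i _ <-]]; first exact: KR.
  by apply: KR; apply: Kq.
pose K0 x := K x /\ adjoin_seq F s x.
have s_fld : is_subfield (adjoin_seq F s) by apply: adjoin_seq_fld.
have K0_fld : is_subfield K0.
  split.
  - by split; apply: fld0.
  - by split; apply: fld1.
  - by move=> x z [? ?] [? ?]; split; apply: fldB.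
  - by move=> x z [? ?] [? ?]; split; apply: fldM.
  - by move=> x [? ?]; split; apply: fldV.
have FK0 : sub_fld F K0 by move=> x Fx; split; [apply: FK | apply: adjoin_seq_sub].
have [|t Rt et] := tower_descent F_fld Fzeta F_val K0_fld FK0 Rs; first by move=> x [].
have K0_val : valued_rigid p O K0 by rewrite -et; apply: valued_rigid_tower.
have K0b : K0 b by split=> //; apply: hs; rewrite mem_head.
have nb0 : ~ is_ppow p K0 b by move=> [x [[Kx _] x0 ex]]; apply: nb; exists x.
have K0q : poly_in K0 q.
  move=> i; split; first exact: Kq.
  have [hi|hi] := ltnP i (size q); last by rewrite nth_default //; apply: fld0.
  by apply: hs; rewrite inE mem_nth ?orbT.
have [k [x [kp [Kx _] x0 ex]]] :=
  valued_conj_norm p_pr p_odd zeta_prim O_val K0_fld (FK0 _ Fzeta) K0_val K0b b0 nb0 eb K0q sq q0.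
by exists k; split=> //; exists x.
Qed.

End Descent.

(** * Galois p-extensions *)

Section Automorphisms.
Variables (Omega : fieldType) (F E : Omega -> Prop).
Hypotheses (F_fld : is_subfield F) (E_fld : is_subfield E) (FE : sub_fld F E).

Section One.
Variable s : Omega -> Omega.
Hypothesis s_aut : is_autF F E s.

Lemma aut_in x : E x -> E (s x).
Proof. by case: s_aut => + _; apply. Qed.

Lemma autD x y : E x -> E y -> s (x + y) = s x + s y.
Proof. by case: s_aut => _ [+ _]; apply. Qed.

Lemma autM x y : E x -> E y -> s (x * y) = s x * s y.
Proof. by case: s_aut => _ [_ [+ _]]; apply. Qed.

Lemma aut_inj x y : E x -> E y -> s x = s y -> x = y.
Proof. by case: s_aut => _ [_ [_ [_ [+ _]]]]; apply. Qed.

Lemma aut_id x : F x -> s x = x.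
Proof. by case: s_aut => _ [_ [_ [_ [_ [_ +]]]]]; apply. Qed.

Lemma autX x n : E x -> s (x ^+ n) = s x ^+ n.
Proof.
move=> Ex; elim: n => [|n IH]; first by rewrite !expr0 aut_id //; apply: fld1.
by rewrite !exprS autM ?IH //; apply: (fldX E_fld).
Qed.

Lemma aut_sum (I : Type) (r : seq I) (f : I -> Omega) : (forall i, E (f i)) ->
  s (\sum_(i <- r) f i) = \sum_(i <- r) s (f i).
Proof.
move=> Ef; elim: r => [|i r IH]; first by rewrite !big_nil aut_id //; apply: fld0.
by rewrite !big_cons autD ?IH //; apply: (subring_sum (subfield_subring E_fld)).
Qed.

End One.

Lemma aut_comp s t : is_autF F E s -> is_autF F E t -> is_autF F E (fun x => s (t x)).
Proof.
move=> hs ht; split; first by move=> x Ex; apply/(aut_in hs)/(aut_in ht).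
split; first by move=> x y Ex Ey; rewrite (autD ht) // (autD hs) //; apply: (aut_in ht).
split; first by move=> x y Ex Ey; rewrite (autM ht) // (autM hs) //; apply: (aut_in ht).
split; first by rewrite (aut_id ht (fld1 F_fld)) (aut_id hs (fld1 F_fld)).
split.
  move=> x y Ex Ey e; apply: (aut_inj ht) => //; apply: (aut_inj hs) e; exact: (aut_in ht).
split; last by move=> x Fx; rewrite (aut_id ht) // (aut_id hs).
move=> y Ey; have [_ [_ [_ [_ [_ [hsurj _]]]]]] := hs.
have [_ [_ [_ [_ [_ [tsurj _]]]]]] := ht.
have [x Ex <-] := hsurj y Ey; have [z Ez <-] := tsurj x Ex.
by exists z.
Qed.

Lemma aut_idfun : is_autF F E id.
Proof. by do 6 split=> //; move=> y Ey; exists y. Qed.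

Variables (n : nat) (sig : 'I_n -> Omega -> Omega).
Hypotheses (sig_aut : forall i, is_autF F E (sig i))
  (sig_neq : forall i j, i <> j -> exists2 x, E x & sig i x <> sig j x)
  (sig_all : forall tau, is_autF F E tau -> exists i, forall x, E x -> tau x = sig i x).

Lemma sig_inj i j : (forall x, E x -> sig i x = sig j x) -> i = j.
Proof.
by move=> h; apply: contrapT => /sig_neq[x Ex]; apply; apply: h.
Qed.

(** Independence of characters: where sig i and sig j differ at y, passing from c k to c k (sig k y
    - sig i y) kills the i-th coefficient and keeps the j-th, so the relation gets shorter. *)
Lemma dedekind (c : 'I_n -> Omega) :
  (forall x, E x -> \sum_i c i * sig i x = 0) -> forall i, c i = 0.
Proof.
have [N] := ubnP #|[set i | c i != 0]|; elim: N c => // N IH c /ltnSE hN h i.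
apply: contrapT => /eqP ci0.
have [j ji cj0] : exists2 j, j != i & c j != 0.
  apply: contrapT => N1; move/eqP: ci0; apply.
  have := h 1 (fld1 E_fld); rewrite (bigD1 i) //= big1 ?addr0.
    by rewrite (aut_id (sig_aut i) (fld1 F_fld)) mulr1.
  move=> j ji; have [->|cj] := eqVneq (c j) 0; first by rewrite mul0r.
  by case: N1; exists j.
have [y Ey nij] := sig_neq (fun e => elimN eqP ji e).
pose d k := c k * (sig k y - sig i y).
have d0 : forall k, d k = 0.
  apply: IH => [|x Ex].
    apply: leq_trans hN; apply: proper_card; apply/properP; split.
      by apply/subsetP => k; rewrite !inE /d; apply: contra_neq => ->; rewrite mul0r.
    by exists i; rewrite !inE // /d subrr mulr0 eqxx.
  have e1 := h (y * x) (fldM E_fld Ey Ex); have e2 := h x Ex.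
  have -> : \sum_k d k * sig k x = \sum_k c k * sig k (y * x) - sig i y * \sum_k c k * sig k x.
    rewrite mulr_sumr -sumrB; apply: eq_bigr => k _.
    by rewrite (autM (sig_aut k)) // /d; ring.
  by rewrite e1 e2 mulr0 subr0.
by move/eqP: (d0 j); rewrite mulf_eq0 (negPf cj0) subr_eq0 => /eqP.
Qed.

(** The matrix A of the sig i (s j) is invertible by [dedekind]. With B the matrix over F of the
    multiplication by x, invariance of x gives A B = x A, so B = x and x is an entry of B. *)
Lemma fixed_field x : (0 < n)%N -> degree_is F E n -> E x ->
  (forall i, sig i x = x) -> F x.
Proof.
move=> n0 [s [Es s_free s_span]] Ex fx.
pose A := \matrix_(i < n, j < n) sig i (s j).
have A_unit : A \in unitmx.
  rewrite -row_free_unit; apply: inj_row_free => v vA.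
  apply/rowP => i; rewrite mxE; apply: (dedekind (c := fun i => v 0 i)) => y Ey.
  have [c Fc ->] := s_span y Ey.
  have -> : \sum_i v 0 i * sig i (\sum_(j < n) c j * s j) = \sum_(j < n) c j * (v *m A) 0 j.
    under [RHS]eq_bigr do rewrite mxE mulr_sumr.
    rewrite exchange_big; apply: eq_bigr => k _ /=.
    rewrite (aut_sum (sig_aut k)); last by move=> j; apply: (fldM E_fld) => //; apply: FE.
    rewrite mulr_sumr; apply: eq_bigr => j _.
    by rewrite (autM (sig_aut k)) ?(aut_id (sig_aut k) (Fc j)) ?mxE 1?mulrCA //; apply: FE.
  by rewrite vA big1 // => j _; rewrite mxE mulr0.
have /choice[B' hB'] (j : 'I_n) : exists c : 'I_n -> Omega,
    (forall k, F (c k)) /\ x * s j = \sum_(k < n) c k * s k.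
  by have [c Fc ec] := s_span (x * s j) (fldM E_fld Ex (Es j)); exists c.
pose B := \matrix_(k < n, j < n) B' j k.
have AB : A *m B = A *m x%:M.
  apply/matrixP => i j; rewrite mul_mx_scalar !mxE.
  have [FB eB] := hB' j.
  have -> : x * sig i (s j) = sig i (x * s j) by rewrite (autM (sig_aut i)) // fx.
  rewrite eB (aut_sum (sig_aut i)); last by move=> k; apply: (fldM E_fld) => //; apply: FE.
  apply: eq_bigr => k _; rewrite !mxE (autM (sig_aut i)) ?(aut_id (sig_aut i) (FB k)) 1?mulrC //.
  exact: FE.
have eB : B = x%:M by rewrite -[B](mulKmx A_unit) AB mulKmx.
have := congr1 (fun C : 'M_n => C (Ordinal n0) (Ordinal n0)) eB.
by rewrite !mxE eqxx mulr1n => <-; have [FB _] := hB' (Ordinal n0).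
Qed.

Section PExtension.
Variables (p m : nat) (zeta : Omega).
Hypotheses (p_pr : prime p) (zeta_prim : p.-primitive_root zeta) (Fzeta : F zeta)
  (n_pow : n = (p ^ m)%N) (EF_deg : degree_is F E n).
Variable M : Omega -> Prop.
Hypotheses (M_fld : is_subfield M) (FM : sub_fld F M)
  (M_root : forall x, M (x ^+ p) -> M x).
Let p_gt0 : (0 < p)%N := prime_gt0 p_pr.

Lemma comp_index_ex : exists mu : 'I_n -> 'I_n -> 'I_n,
  forall i j x, E x -> sig i (sig j x) = sig (mu i j) x.
Proof.
have /choice[mu hmu] (ij : 'I_n * 'I_n) :
    exists k, forall x, E x -> sig ij.1 (sig ij.2 x) = sig k x.
  exact: sig_all (aut_comp (sig_aut ij.1) (sig_aut ij.2)).
by exists (fun i j => mu (i, j)) => i j; apply: (hmu (i, j)).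
Qed.

Lemma id_index_ex : exists e, forall x, E x -> sig e x = x.
Proof. by have [e he] := sig_all aut_idfun; exists e => x Ex; rewrite -he. Qed.

Section GroupOfAutomorphisms.
Variables (mu : 'I_n -> 'I_n -> 'I_n) (e : 'I_n).
Hypotheses (muE : forall i j x, E x -> sig i (sig j x) = sig (mu i j) x)
  (eE : forall x, E x -> sig e x = x).

Let sigE i x : E x -> E (sig i x). Proof. exact: aut_in. Qed.

Lemma mu_inj i : injective (mu i).
Proof.
move=> j k h; apply: sig_inj => x Ex; apply: (aut_inj (sig_aut i)); try exact: sigE.
by rewrite !muE // h.
Qed.

(** Cayley's embedding, which makes the theory of finite p-groups available; the index i is
    recovered as the image of e. *)
Definition left_perm i : {perm 'I_n} := perm (@mu_inj i).

Lemma left_perm_e i : left_perm i e = i.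
Proof. by rewrite /left_perm permE; apply: sig_inj => x Ex; rewrite -muE // eE. Qed.

Definition aut_set : {set {perm 'I_n}} := [set left_perm i | i : 'I_n].

Definition act (g : {perm 'I_n}) : Omega -> Omega := sig (g e).

Lemma left_permM i j : (left_perm i * left_perm j)%g = left_perm (mu j i).
Proof.
apply/permP => k; rewrite permM /left_perm !permE; apply: sig_inj => x Ex.
rewrite -(muE j (mu i k) Ex) -(muE i k Ex) -(muE (mu j i) k Ex) -muE //; exact: sigE.
Qed.

Lemma actM g h x : g \in aut_set -> h \in aut_set -> E x ->
  act (g * h)%g x = act h (act g x).
Proof.
move=> /imsetP[i _ ->] /imsetP[j _ ->] Ex.
by rewrite left_permM /act !left_perm_e muE.
Qed.

Lemma act1 x : E x -> act 1%g x = x.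
Proof. by move=> Ex; rewrite /act perm1 eE. Qed.

Lemma act_aut g : is_autF F E (act g).
Proof. exact: sig_aut. Qed.

Lemma aut_set_group : group_set aut_set.
Proof.
apply/group_setP; split; last first.
  by move=> _ _ /imsetP[i _ ->] /imsetP[j _ ->]; rewrite left_permM; apply: imset_f.
apply/imsetP; exists e => //; apply/permP => j; rewrite perm1 permE.
by apply: sig_inj => x Ex; rewrite -muE // eE //; apply: sigE.
Qed.

Definition aut_group : {group {perm 'I_n}} := Group aut_set_group.

Lemma card_aut_group : #|aut_group| = n.
Proof.
rewrite card_imset ?card_ord // => i j h.
by rewrite -(left_perm_e i) h left_perm_e.
Qed.

(* Descend along H with kernel Q of index p: a Q-fixed z is the average of its
   resolvents, whose p-th powers are H-fixed. *)
Lemma fixed_by_closed k : forall H : {group {perm 'I_n}}, H \subset aut_group -> #|H| = (p ^ k)%N ->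
  (forall x, E x -> (forall h, h \in H -> act h x = x) -> M x) -> forall x, E x -> M x.
Proof.
elim: k => [|k IH] H HG cH hM z Ez.
  apply: hM => // h hH; have H1 : H :=: 1%g by apply: card1_trivg; rewrite cH.
  by move: hH; rewrite H1 => /set1P ->; apply: act1.
have pH : (p.-group H)%g by rewrite /pgroup cH pnatX pnat_id.
have [Q [QH Qn cQ]] : exists Q : {group {perm 'I_n}}, [/\ Q \subset H, Q <| H & #|Q| = (p ^ k)%N]%g.
  by apply: normal_pgroup pH (normal_refl H) _; rewrite cH pfactorK.
apply: (IH Q _ cQ) => //; first exact: subset_trans QH HG.
move=> {z Ez} z Ez fz.
have [h hH hQ] : exists2 h, h \in H & h \notin Q.
  have : ~~ (H \subset Q).
    apply/negP=> /subset_leq_card; rewrite cH cQ leqNgt ltn_exp2l ?prime_gt1 //.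
    by rewrite ltnSn.
  by case/subsetPn => h; exists h.
have inG g : g \in H -> g \in aut_set by move/(subsetP HG).
have actE g x : E x -> E (act g x) by apply: (aut_in (act_aut g)).
pose u l := act (h ^+ l)%g z.
have Eu l : E (u l) by apply: actE.
have uS l : act h (u l) = u l.+1.
  by rewrite /u -actM ?expgSr // inG // groupX.
have hp : (h ^+ p)%g \in Q.
  have nQ := subsetP (normal_norm Qn) _ hH.
  apply: coset_idr; first exact: groupX.
  rewrite morphX //.
  have <- : #|(H / Q)%g| = p.
    by rewrite card_quotient ?normal_norm // -divgS // cH cQ expnSr mulKn // expn_gt0 p_gt0.
  by apply: expg_cardG; apply: mem_quotient.
have up : u p = u 0%N by rewrite /u fz // expg0 act1.
have uQ l g : g \in Q -> act g (u l) = u l.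
  move=> gQ; have hl : (h ^+ l)%g \in H by apply: groupX.
  have gH := subsetP QH _ gQ.
  rewrite /u -actM ?inG // conjgCV actM ?inG //.
    by rewrite fz // memJ_norm // groupV; apply: (subsetP (normal_norm Qn)).
  by rewrite groupJ ?groupV.
(* Lagrange resolvents of z under h: h multiplies w j by zeta^(-j), so it fixes the p-th power. *)
pose w j := \sum_(l < p) zeta ^+ (j * l) * u l.
have Ezeta : E zeta by apply: FE.
have Ezt l : E (zeta ^+ l) by apply: (fldX E_fld).
have Ew j : E (w j).
  by apply: (subring_sum (subfield_subring E_fld)) => l _; apply: (fldM E_fld).
have actw g j : act g (w j) = \sum_(l < p) zeta ^+ (j * l) * act g (u l).
  rewrite (aut_sum (act_aut g)); last by move=> l; apply: (fldM E_fld).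
  apply: eq_bigr => l _; rewrite (autM (act_aut g)) // (aut_id (act_aut g)) //.
  exact: (fldX F_fld).
have hw j : zeta ^+ j * act h (w j) = w j.
  rewrite actw mulr_sumr.
  transitivity (\sum_(l < p) zeta ^+ (j * l.+1) * u l.+1).
    by apply: eq_bigr => l _; rewrite uS mulrA -exprD mulnS.
  have e0 : zeta ^+ (j * p) * u p = zeta ^+ (j * 0) * u 0%N.
    by rewrite up mulnC exprM (prim_expr_order zeta_prim) expr1n muln0 expr0.
  rewrite /w; case: p p_gt0 e0 => // q _ e0.
  by rewrite big_ord_recr e0 [RHS]big_ord_recl addrC.
have wp_fix j g : g \in H -> act g (w j ^+ p) = w j ^+ p.
  (* This stabiliser contains Q and h. Its order is a power of p above p^k, so it is all of H. *)
  pose St := [set g in H | act g (w j ^+ p) == w j ^+ p].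
  have Ewp : E (w j ^+ p) by apply: (fldX E_fld).
  have St_group : group_set St.
    apply/group_setP; split=> [|a b]; first by rewrite inE group1 act1 // eqxx.
    rewrite !inE => /andP[aH /eqP ea] /andP[bH /eqP eb].
    by rewrite groupM // actM ?inG // ea eb eqxx.
  pose S := Group St_group.
  have SH : S \subset H by apply/subsetP => a; rewrite inE => /andP[].
  have QS : Q \subset S.
    apply/subsetP => a aQ; rewrite inE (subsetP QH) //=; apply/eqP.
    rewrite (autX (act_aut a)) // actw; congr (_ ^+ _).
    by apply: eq_bigr => l _; rewrite uQ.
  have hS : h \in S.
    rewrite inE hH /= (autX (act_aut h)) // -{2}(hw j) exprMn.
    by rewrite exprAC (prim_expr_order zeta_prim) expr1n mul1r.
  have /(dvdn_pfactor _ _ p_pr) : (#|S| %| p ^ k.+1)%N by rewrite -cH cardSg.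
  case=> l lk cS.
  have lt : (#|Q| < #|S|)%N.
    apply: proper_card; apply/properP; split=> //; by exists h.
  rewrite cQ cS ltn_exp2l ?prime_gt1 // in lt.
  have el : l = k.+1 by apply/eqP; rewrite eqn_leq lk.
  have eSH : S :=: H by apply/eqP; rewrite eqEcard SH cH cS el leqnn.
  by rewrite -eSH inE => /andP[_ /eqP].
have Mw j : M (w j).
  by apply: M_root; apply: hM; [apply: (fldX E_fld) | move=> g gH; apply: wp_fix].
have p0 : p%:R != 0 :> Omega by apply: (prim_root_natf_neq0 zeta_prim).
(* Summing over j leaves only the term l = 0, which is p z. *)
have -> : z = (\sum_(j < p) w j) / p%:R.
  apply: (canRL (mulfK p0)); rewrite exchange_big /=.
  rewrite (bigD1 (Ordinal p_gt0)) //= [X in _ = _ + X]big1 ?addr0.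
    rewrite -mulr_suml /u expg0 act1 // mulrC; congr (_ * _).
    by under eq_bigr do rewrite muln0 expr0; rewrite sumr_const card_ord.
  move=> l l0; rewrite -mulr_suml; under eq_bigr do rewrite mulnC.
  under eq_bigr do rewrite mulnC.
  rewrite (sum_zeta_powers zeta_prim) ?mul0r // gtnNdvd //.
  by rewrite lt0n; apply: contra l0 => /eqP l0; apply/eqP/val_inj.
apply: fld_div => //; first exact: (subring_sum (subfield_subring M_fld)).
elim: (p) => [|q IHq]; first exact: (fld0 M_fld).
by rewrite -natr1; apply: (fldD M_fld) => //; apply: (fld1 M_fld).
Qed.

End GroupOfAutomorphisms.

(** The descent starts with the whole group, whose fixed elements lie in F, hence in M. *)
Lemma p_ext_closed : sub_fld E M.
Proof.
have [mu muE] := comp_index_ex; have [e eE] := id_index_ex.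
have fixM x : E x -> (forall h, h \in aut_group muE eE -> act e h x = x) -> M x.
  move=> Ex fx; apply: FM; apply: fixed_field Ex _ => //.
    by rewrite n_pow expn_gt0 p_gt0.
  by move=> i; rewrite -{1}(left_perm_e muE eE i); apply: fx; apply: imset_f.
have cG : #|aut_group muE eE| = (p ^ m)%N by rewrite card_aut_group.
exact: (fixed_by_closed (subxx _) cG fixM).
Qed.

End PExtension.

End Automorphisms.

Theorem galois_p_ext_closed (Omega : fieldType) (p : nat) (zeta : Omega) (F E M : Omega -> Prop) :
  prime p -> p.-primitive_root zeta -> is_subfield F -> F zeta -> is_subfield E ->
  galois_p_ext p F E -> is_subfield M -> sub_fld F M -> (forall x, M (x ^+ p) -> M x) ->
  sub_fld E M.
Proof.
move=> p_pr zeta_prim F_fld Fzeta E_fld [FE [n [m [EF_deg n_pow [sig [h1 h2 h3]]]]]] M_fld FM M_root.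
exact: (p_ext_closed F_fld E_fld FE h1 h2 h3 p_pr zeta_prim Fzeta n_pow EF_deg M_fld FM M_root).
Qed.

Theorem theorem3p18 (Omega : closedFieldType) (p : nat) (F : Omega -> Prop)
    (zeta : Omega) :
  prime p -> odd p -> is_subfield F -> F zeta -> p.-primitive_root zeta ->
  p_rigid p F ->
  forall K : Omega -> Prop, is_subfield K -> sub_fld F K ->
    sub_fld K (max_p_ext p F) -> p_rigid p K.
Proof.
move=> p_pr p_odd F_fld Fzeta zeta_prim F_rigid K K_fld FK KF.
have [O [O_val F_val]] := rigid_valued p_pr p_odd zeta_prim F_fld Fzeta F_rigid.
apply: (radical_closure_rigid p_pr p_odd zeta_prim O_val F_fld Fzeta F_val K_fld FK).
(* [max_p_ext] is an intersection of subfields, so it is enough that the radical closure is one of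
   them. *)
move=> x /KF; apply; first exact: radical_closure_fld.
move=> E E_fld EF; apply: (galois_p_ext_closed p_pr zeta_prim F_fld Fzeta E_fld EF).
- exact: radical_closure_fld.
- exact: radical_closure_sub.
- exact: radical_closure_root.
Qed.
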